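(* Let $d\in\mathbb{N}$, $0<\tau<T$ and $0\le\alpha<1$. Let $\theta_0:\mathbb{T}^d\to\mathbb{R}$ be smooth, and let $u$ be a divergence-free $\mathbb{R}^d$-valued function on $[0,T]\times\mathbb{T}^d$ with $$u\in C^\infty\big(([0,\tau)\cup(\tau,T))\times\mathbb{T}^d\big)\cap L^1(0,T;C^\alpha(\mathbb{T}^d))\cap L^\infty([0,T)\times\mathbb{T}^d).$$ Let $\{\theta^\kappa\}_{\kappa>0}$ be a family such that, for each $\kappa>0$, $\theta^\kappa$ is a weak solution of $$\partial_t\theta^\kappa+u\cdot\nabla\theta^\kappa=\kappa\Delta\theta^\kappa,\qquad \theta^\kappa|_{t=0}=\theta_0\qquad\text{in }[0,T]\times\mathbb{T}^d.$$ If there exists a constant $c$ independent of $\kappa$ such that $$\kappa\int_0^\tau\|\nabla\theta^\kappa(s)\|_{L^2(\mathbb{T}^d)}^2\,ds\ \ge\ c\ >\ 0\qquad\text{for all }\kappa>0,$$ then the term $$\kappa\sum_{i=1}^d(\partial_{x_i}\theta^\kappa)^2\,\partial_\xi^2\chi_{\theta^\kappa}$$ does not go to $0$ as $\kappa\to0$ in the sense of distributions.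
   Context: $\mathbb{T}^d=\mathbb{R}^d/\mathbb{Z}^d$. For a real-valued function $\theta$ on $[0,T]\times\mathbb{T}^d$, the function $\chi_\theta$ on $[0,T]\times\mathbb{T}^d\times\mathbb{R}$ is defined by $\chi_\theta(t,x,\xi)=1$ if $\xi\le\theta(t,x)$ and $\chi_\theta(t,x,\xi)=0$ if $\xi>\theta(t,x)$. Weak solutions of the advection-diffusion equation are understood in the usual energy class $L^\infty(0,T;L^2(\mathbb{T}^d))\cap L^2(0,T;H^1(\mathbb{T}^d))$, so that $\sum_{i}(\partial_{x_i}\theta^\kappa)^2\in L^1((0,T)\times\mathbb{T}^d)$. Test functions are the functions $\phi\in C^\infty([0,T]\times\mathbb{T}^d\times\mathbb{R})$ whose support is a compact subset of $[0,T)\times\mathbb{T}^d\times\mathbb{R}$. The term $\kappa\sum_{i}(\partial_{x_i}\theta^\kappa)^2\partial_\xi^2\chi_{\theta^\kappa}$ is the distribution acting on a test function $\phi$ by $$\phi\mapsto\int_0^T\int_{\mathbb{T}^d}\int_{\mathbb{R}}\kappa\sum_{i=1}^d(\partial_{x_i}\theta^\kappa)^2\,\chi_{\theta^\kappa}\,\partial_\xi^2\phi\,d\xi\,dx\,dt .$$ That it goes to $0$ in the sense of distributions as $\kappa\to0$ means that this quantity tends to $0$ as $\kappa\to0$ for every test function $\phi$. *)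

(* Defs.v *)
From HB Require Import structures.
From mathcomp Require Import all_boot all_order all_algebra.
From mathcomp Require Import all_classical all_reals all_analysis.
Set Implicit Arguments.
Unset Strict Implicit.
Unset Printing Implicit Defensive.
Import Order.TTheory GRing.Theory Num.Theory.
Import numFieldNormedType.Exports.
Local Open Scope classical_set_scope.
Local Open Scope ring_scope.

(* The library provides the product sigma-algebra on tuples but not on row
   vectors, which are the ones carrying a normed module structure. *)
Definition measure_rV_display : measure_display -> measure_display.
Proof. exact. Qed.

Section measurable_rV.
Context {disp : measure_display} {E : sigmaRingType disp} (n : nat).

Let coord (i : 'I_n) (x : 'rV[E]_n) : E := x ord0 i.

Let rV_set0 : g_sigma_preimage coord set0.
Proof. exact: sigma_algebra0. Qed.

Let rV_setC A : g_sigma_preimage coord A -> g_sigma_preimage coord (~` A).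
Proof. exact: sigma_algebraC. Qed.

Let rV_bigcup (F : (set 'rV[E]_n)^nat) :
  (forall i, g_sigma_preimage coord (F i)) ->
  g_sigma_preimage coord (\bigcup_i (F i)).
Proof. exact: sigma_algebra_bigcup. Qed.

HB.instance Definition _ := @isMeasurable.Build (measure_rV_display disp)
  'rV[E]_n (g_sigma_preimage coord) rV_set0 rV_setC rV_bigcup.

End measurable_rV.

Lemma measurable_coord (disp : measure_display) (E : sigmaRingType disp)
    (n : nat) (i : 'I_n) :
  measurable_fun [set: 'rV[E]_n] (fun x : 'rV[E]_n => x ord0 i).
Proof.
move=> _ Y mY; rewrite setTI; apply: sub_sigma_algebra => /=.
rewrite -bigcup_seq/=; exists i => /=; first by rewrite mem_index_enum.
by exists Y => //; rewrite setTI.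
Qed.

Lemma measurable_fun_rV (d1 d2 : measure_display) (E1 : measurableType d1)
    (E2 : measurableType d2) (n : nat) (f : E1 -> 'rV[E2]_n) :
  (forall i, measurable_fun [set: E1] (fun x => f x ord0 i)) ->
  measurable_fun [set: E1] f.
Proof.
move=> mf _ A mA; rewrite setTI.
have : <<s preimage_set_system setT f
    (\big[setU/set0]_(i < n) preimage_set_system setT
      (fun x : 'rV[E2]_n => x ord0 i) measurable) >> (f @^-1` A).
  by rewrite g_sigma_preimageE; exists A => //; rewrite setTI.
apply: smallest_sub; first exact: sigma_algebra_measurable.
move=> _ [B + <-]; rewrite -bigcup_seq => -[i _ [C mC <-]].
by rewrite !setTI; have := mf i measurableT _ mC; rewrite setTI.
Qed.

Section torus_measure.
Context (R : realType).

Definition torus_cons (n : nat) (p : measurableTypeR R * 'rV[R]_n) :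
    'rV[R]_n.+1 := row_mx (p.1 : R)%:M p.2.

Lemma measurable_torus_cons (n : nat) : measurable_fun setT (@torus_cons n).
Proof.
apply: measurable_fun_rV => i; rewrite /torus_cons.
have [j ->|j ->] := @split_ordP 1 n i.
  rewrite (_ : (fun _ => _) = fst); first exact: measurable_fst.
  apply/funext => p; apply: etrans (@row_mxEl R 1 1 n _ _ ord0 j) _.
  by rewrite mxE !ord1.
rewrite (_ : (fun _ => _) = (fun x : 'rV[R]_n => x ord0 j) \o snd); last first.
  by apply/funext => p; exact: (@row_mxEr R 1 1 n _ _ ord0 j).
by apply: measurableT_comp; [exact: measurable_coord|exact: measurable_snd].
Qed.

HB.instance Definition _ n :=
  isMeasurableFun.Build _ _ _ _ (@torus_cons n) (@measurable_torus_cons n).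

(* T^d = R^d/Z^d is represented by R^d, functions on it by Z^d-periodic
   functions, and its measure by the Lebesgue measure on [0,1]^d. *)
Fixpoint torus_measure (n : nat) : probability 'rV[R]_n R :=
  match n with
  | 0 => \d_(0 : 'rV[R]_0)
  | n'.+1 => distribution
      (uniform_prob (@ltr01 R) \x torus_measure n')%E (@torus_cons n')
  end.

End torus_measure.

Section smoothness.
Context {R : realType} {V W : normedModType R}.

Definition iter_derive (vs : seq V) (f : V -> W) : V -> W :=
  foldr (fun v g => 'D_v g) f vs.

(* On an arbitrary set A, smoothness is local extendability to an open set, so
   that one-sided derivatives are meant at the boundary points of A in A. *)
Definition smooth_open (U : set V) (f : V -> W) : Prop :=
  forall (vs : seq V) (x : V), U x ->
    {for x, continuous (iter_derive vs f)} /\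
    forall v, derivable (iter_derive vs f) x v.

Definition smooth_on (A : set V) (f : V -> W) : Prop :=
  forall x, A x -> exists (U : set V) (g : V -> W),
    [/\ open_nbhs x U, smooth_open U g & {in A `&` U, f =1 g}].

End smoothness.

Section bochner.
Context {R : realType} {E : Type} {F : zmodType}.

Definition simple_in_time (X : set (E -> F)) (s : R -> E -> F) : Prop :=
  [/\ finite_set (range s),
      forall f, measurable (s @^-1` [set f]) & forall t, X (s t)].

(* L^p(0,T;X), for a space X of functions with (extended) norm N: strong
   measurability in time and integrability of the norm. *)
Definition bochner_Lp (T : R) (p : \bar R) (X : set (E -> F))
    (N : (E -> F) -> \bar R) (v : R -> E -> F) : Prop :=
  [/\ exists s : nat -> R -> E -> F,
        (forall n, simple_in_time X (s n)) /\
        {ae lebesgue_measure, forall t, 0 < t < T ->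
          N (s n t \- v t) @[n --> \oo] --> 0%E},
      {ae lebesgue_measure, forall t, 0 < t < T -> X (v t)} &
      ('N[lebesgue_measure]_p[(N \o v) \_ `]0%R, T[] < +oo)%E].

End bochner.

Section torus.
Context {R : realType} {d : nat}.
Local Notation point := 'rV[R]_d.
Local Notation mu := (@lebesgue_measure R).
Local Notation vol := (torus_measure R d).

Definition torus_periodic {F : Type} (f : point -> F) : Prop :=
  forall (x : point) (k : 'rV[int]_d), f (x + map_mx intr k) = f x.

Definition slice {F : Type} (f : R * point -> F) (t : R) : point -> F :=
  fun x => f (t, x).

Definition basis (i : 'I_d) : point := delta_mx ord0 i.

Definition enorm {n : nat} (v : 'rV[R]_n) : R :=
  Num.sqrt (\sum_(i < n) v ord0 i ^+ 2).

(* C^alpha(T^d; R^d). For alpha = 0 this is the space of continuous functions.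
   The quotient is 0 when p.1 = p.2; for a periodic f, the supremum over R^d is
   the one for the quotient distance of T^d. *)
Definition holder_norm (alpha : R) (f : point -> point) : \bar R :=
  (ereal_sup [set (enorm (f x))%:E | x in setT] +
   ereal_sup [set (enorm (f p.1 - f p.2) / enorm (p.1 - p.2) `^ alpha)%:E
     | p in [set: point * point]])%E.

Definition holder_space (alpha : R) : set (point -> point) :=
  [set f | [/\ torus_periodic f, continuous f & (holder_norm alpha f < +oo)%E]].

Definition L2_norm (f : point -> R) : \bar R := 'N[vol]_2[EFin \o f].

Definition L2_space : set (point -> R) :=
  [set f | [/\ torus_periodic f, measurable_fun setT f & (L2_norm f < +oo)%E]].

Definition L2_vnorm (g : point -> point) : \bar R :=
  'N[vol]_2[EFin \o (enorm \o g)].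

Definition L2_vspace : set (point -> point) :=
  [set g | [/\ torus_periodic g, measurable_fun setT g & (L2_vnorm g < +oo)%E]].

Definition weak_gradient (f : point -> R) (g : point -> point) : Prop :=
  forall psi : point -> R, torus_periodic psi -> smooth_on setT psi ->
  forall i, \int[vol]_x (f x * 'D_(basis i) psi x) =
            - \int[vol]_x (g x ord0 i * psi x).

Definition divergence_free (v : point -> point) : Prop :=
  forall psi : point -> R, torus_periodic psi -> smooth_on setT psi ->
  \int[vol]_x (\sum_(i < d) v x ord0 i * 'D_(basis i) psi x) = 0.

(* H^1(T^d) is the graph of the weak gradient: its elements are functions
   together with a representative of their gradient. *)
Definition H1_space : set (point -> R * point) :=
  [set w | [/\ L2_space (fst \o w), L2_vspace (snd \o w) &
               weak_gradient (fst \o w) (snd \o w)]].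

Definition H1_norm (w : point -> R * point) : \bar R :=
  ((L2_norm (fst \o w) ^+ 2 + L2_vnorm (snd \o w) ^+ 2) `^ 2^-1)%E.

Definition Loo_spacetime (T : R) (v : R * point -> point) : Prop :=
  let D := [set p : R * point | 0 <= p.1 < T] in
  measurable_fun D v /\
  ('N[mu \x vol]_+oo[(EFin \o (enorm \o v)) \_ D] < +oo)%E.

(* theta in L^oo(0,T;L^2) with L^2(0,T;H^1), where grad is the weak spatial
   gradient of theta. *)
Definition energy_class (T : R) (theta : R * point -> R)
    (grad : R * point -> point) : Prop :=
  let D := [set p : R * point | 0 < p.1 < T] in
  [/\ measurable_fun D theta, measurable_fun D grad,
      bochner_Lp T +oo L2_space L2_norm (slice theta) &
      bochner_Lp T 2 H1_space H1_norm (slice (fun p => (theta p, grad p)))].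

Definition dt (phi : R * point -> R) : R * point -> R :=
  'D_((1, 0) : R * point) phi.

Definition dx (i : 'I_d) (phi : R * point -> R) : R * point -> R :=
  'D_((0, basis i) : R * point) phi.

Definition dxi (phi : R * point * R -> R) : R * point * R -> R :=
  'D_((0, 1) : R * point * R) phi.

(* As T^d is compact, the support of phi in [0,T] x T^d (x R) is a compact
   subset of [0,T) x T^d (x R) iff phi vanishes for t near T (and for |xi|
   large).  The values of phi for t outside [0,T] play no role. *)
Definition test_function (T : R) (phi : R * point -> R) : Prop :=
  [/\ forall t, 0 <= t <= T -> torus_periodic (fun x => phi (t, x)),
      smooth_on [set p : R * point | 0 <= p.1 <= T] phi &
      exists2 T', T' < T & forall t x, 0 <= t <= T -> T' < t ->
        phi (t, x) = 0].

Definition kinetic_test_function (T : R) (phi : R * point * R -> R) : Prop :=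
  [/\ forall t xi, 0 <= t <= T -> torus_periodic (fun x => phi (t, x, xi)),
      smooth_on [set p : R * point * R | 0 <= p.1.1 <= T] phi &
      exists2 T', T' < T & exists M, forall t x xi, 0 <= t <= T ->
        (T' < t) || (M < `|xi|) -> phi (t, x, xi) = 0].

(* Since u is divergence free, u . grad theta = div (theta u). *)
Definition weak_solution (T kappa : R) (u : R * point -> point)
    (theta0 : point -> R) (theta : R * point -> R)
    (grad : R * point -> point) : Prop :=
  [/\ forall t, 0 <= t <= T -> torus_periodic (slice theta t),
      energy_class T theta grad &
      forall phi, test_function T phi ->
        \int[mu]_(t in `]0, T[) \int[vol]_x
          (theta (t, x) * dt phi (t, x)
           + theta (t, x) * (\sum_(i < d) u (t, x) ord0 i * dx i phi (t, x))
           - kappa * (\sum_(i < d) grad (t, x) ord0 i * dx i phi (t, x)))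
        + \int[vol]_x (theta0 x * phi (0, x)) = 0].

Definition chi (theta : R * point -> R) (t : R) (x : point) (xi : R) : R :=
  if xi <= theta (t, x) then 1 else 0.

Definition defect_distribution (T kappa : R) (theta : R * point -> R)
    (grad : R * point -> point) (phi : R * point * R -> R) : R :=
  \int[mu]_(t in `]0, T[) \int[vol]_x \int[mu]_xi
    (kappa * (\sum_(i < d) grad (t, x) ord0 i ^+ 2) * chi theta t x xi
     * dxi (dxi phi) (t, x, xi)).

End torus.

(* Main.v *)
Require Import Defs.
From mathcomp Require Import all_boot all_order all_algebra.
From mathcomp Require Import all_classical all_reals all_analysis.
From mathcomp Require Import measurable_realfun ess_sup_inf.
From Stdlib Require Import Ring Field.
Set Implicit Arguments.
Unset Strict Implicit.
Unset Printing Implicit Defensive.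
Import Order.TTheory GRing.Theory Num.Theory.
Import numFieldNormedType.Exports.
Local Open Scope classical_set_scope.
Local Open Scope ring_scope.

(** The distribution is tested on a product phi(t, x, xi) = eta(t) zeta(xi). Integrating in [xi]
    against the kinetic function leaves the derivative of zeta, so the defect on phi is the
    space-time integral of kappa |grad theta|^2 eta(t) zeta'(theta). Suppose that |theta| <= [M]
    almost everywhere, with one [M] for all [kappa]. Take zeta(xi) = xi on a neighbourhood of
    [-M, M], cut off further out, and eta with values in [0, 1], equal to 1 up to [tau] and to 0
    near [T]. Then zeta'(theta) = 1, the defect is a weighted dissipation, and it is at least the
    dissipation before [tau], hence at least [c] for every positive [kappa] ([defect_lower]). It
    cannot tend to 0.

    What remains is the maximum principle, that a bound [M] of the initial state bounds the weak
    solution ([max_principle]), for a drift that is only bounded and divergence free. Formally, let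
    b be the convex function [barrier M], which vanishes exactly on [-M, M]: the integral of
    b(theta) starts at 0 and decreases, because transport preserves it and diffusion contributes -
    kappa b''(theta) |grad theta|^2.

    To make this rigorous, theta is smeared in space by a nonnegative trigonometric kernel of finite
    rank. The smeared function S theta depends on finitely many moments of theta, each of which is a
    primitive of an integrable function ([weak_primitive]), and convexity of b bounds the growth of
    the integral of b(S theta) ([chain_rule_le]). The price of smearing is the commutator S(theta u)
    - u S theta, paired with b''(S theta) grad(S theta) ([energy_rate_le]). As grad theta is square
    integrable, plain convergence of the commutator to 0 in L^2 is enough ([commutator_cvg]), and it
    follows from S f -> f in L^2 ([smear_cvg]). Dominated convergence in time then gives that the
    integral of b(theta) is 0 ([barrier_vanishes]).

    The convergence S f -> f rests on two facts: the kernel has mass 1 and spread exactly 1/(n+1)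
    ([kernel_spread]), and functions that are Lipschitz for the chordal distance of the torus are
    dense in L^2 ([sq_integrable_approximable]). *)

(* The ring and field tactics of Stdlib match operations syntactically; they are
   run on copies of the field operations with a fixed head constant. *)
Section field_copy.
Context (R : realType).
Definition fcar : Type := R.
Definition fatom (x : R) : fcar := x.
Definition fzero : fcar := (0 : R).
Definition fone : fcar := (1 : R).
Definition fadd (x y : fcar) : fcar := (x : R) + (y : R).
Definition fmul (x y : fcar) : fcar := (x : R) * (y : R).
Definition fsub (x y : fcar) : fcar := (x : R) - (y : R).
Definition fopp (x : fcar) : fcar := - (x : R).
Definition finv (x : fcar) : fcar := (x : R)^-1.
Definition fdiv (x y : fcar) : fcar := (x : R) / (y : R).

Lemma fcar_field : field_theory fzero fone fadd fmul fsub fopp fdiv finv eq.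
Proof.
split.
- split => //; rewrite /fadd /fmul /fsub /fopp => *;
    [exact: add0r|exact: addrC|exact: addrA|exact: mul1r|exact: mulrC|
     exact: mulrA|exact: mulrDl|exact: subrr].
- by apply/eqP; exact: oner_neq0.
- by [].
- by move=> p /eqP p0; exact: mulVf.
Qed.

End field_copy.

(** The recursion mirrors the unfolding of [iterop], with no trailing zero in the case [S O]: the
    copy has to be convertible with [a *+ n], since [fprepare] relies on [change]. *)
Ltac fcopy_nat R a n :=
  lazymatch n with
  | O => constr:(fzero R)
  | S O => constr:(a)
  | S ?m => let r := fcopy_nat R a m in constr:(@fadd R a r)
  end.

Ltac fcopy_exp R a n :=
  lazymatch n with
  | O => constr:(fone R)
  | S O => constr:(a)
  | S ?m => let r := fcopy_exp R a m in constr:(@fmul R a r)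
  end.

Ltac is_nat_literal n :=
  lazymatch n with O => idtac | S ?m => is_nat_literal m end.

(** When a multiplicity or an exponent is not a literal, the failure inside the [match goal] makes
    it backtrack, and the whole term becomes an atom. *)
Ltac fcopy R t :=
  lazymatch t with
  | @GRing.add _ ?a ?b =>
    let a' := fcopy R a in let b' := fcopy R b in constr:(@fadd R a' b')
  | @GRing.mul _ ?a ?b =>
    let a' := fcopy R a in let b' := fcopy R b in constr:(@fmul R a' b')
  | @GRing.opp _ ?a => let a' := fcopy R a in constr:(@fopp R a')
  | @GRing.inv _ ?a => let a' := fcopy R a in constr:(@finv R a')
  | @GRing.zero _ => constr:(fzero R)
  | @GRing.one _ => constr:(fone R)
  | @GRing.natmul _ ?a ?n =>
    let n' := eval lazy in n in
    match goal with
    | _ => let a' := fcopy R a in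
           let _ := match goal with _ => is_nat_literal n' end in
           fcopy_nat R a' n'
    | _ => constr:(@fatom R t)
    end
  | @GRing.exp _ ?a ?n =>
    let n' := eval lazy in n in
    match goal with
    | _ => let a' := fcopy R a in
           let _ := match goal with _ => is_nat_literal n' end in
           fcopy_exp R a' n'
    | _ => constr:(@fatom R t)
    end
  | _ => constr:(@fatom R t)
  end.

Ltac fprepare R :=
  lazymatch goal with
  | |- @eq _ ?a ?b =>
    let a' := fcopy R a in let b' := fcopy R b in
    change (@eq (fcar R) a' b')
  end.

Lemma two_ne0 (R : realType) : (2 : R) <> 0.
Proof. by apply/eqP; rewrite pnatr_eq0. Qed.

Ltac fclean R := repeat split; try (exact: (@two_ne0 R)); try assumption.

Ltac fring := match goal with R : realType |- _ => fprepare R; ring end.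
Ltac ffield := match goal with R : realType |- _ => fprepare R; field; fclean R end.

(** * Smooth functions on a normed space, through directional derivatives *)

(** Differentiability is required along every direction rather than in the sense of Frechet, so that
    [Coo] yields directly the iterated directional derivatives [iter_derive] of [smooth_open]. *)
Fixpoint Ck {R : realType} {V : normedModType R} (n : nat) (f : V -> R) : Prop :=
  continuous f /\
  if n is n'.+1 then
    forall v, (forall x, derivable f x v) /\ Ck n' ('D_v f)
  else True.

Definition Coo {R : realType} {V : normedModType R} (f : V -> R) : Prop :=
  forall n, Ck n f.

Section Ck_theory.
Context {R : realType} {V : normedModType R}.
Implicit Types f g : V -> R.

Lemma Ck_continuous n f : Ck n f -> continuous f.
Proof. by case: n => [|n] []. Qed.

Lemma Ck_derivable n f v x : Ck n.+1 f -> derivable f x v.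
Proof. by move=> [_ /(_ v)[]]. Qed.

Lemma Ck_derive n f v : Ck n.+1 f -> Ck n ('D_v f).
Proof. by move=> [_ /(_ v)[]]. Qed.

Lemma CkW n f : Ck n.+1 f -> Ck n f.
Proof.
elim: n f => [|n IH] f [cf df]; split => // v.
by have [dfv cfv] := df v; split => //; exact: IH.
Qed.

(** The derivative is given by a formula [df], so that an induction on the order can proceed on
    formulas. *)
Lemma CkS n f (df : V -> V -> R) :
  (forall v x, is_derive x v f (df v x)) -> continuous f ->
  (forall v, Ck n (df v)) -> Ck n.+1 f.
Proof.
move=> fdf cf cdf; split => // v; split.
  by move=> x; exact: (@ex_derive _ _ _ _ _ _ _ (fdf v x)).
by rewrite (_ : 'D_v f = df v)//; apply/funext => x; exact: (@derive_val _ _ _ _ _ _ _ (fdf v x)).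
Qed.

Lemma Ck_cst n (c : R) : Ck n (fun _ : V => c).
Proof.
elim: n c => [|n IH] c; first by split => // x; exact: cst_continuous.
apply: (@CkS _ _ (fun _ _ => 0)) => [x|v].
- exact: cst_continuous.
- exact: IH.
Qed.

Lemma CkD n f g : Ck n f -> Ck n g -> Ck n (fun x => f x + g x).
Proof.
elim: n f g => [|n IH] f g Cf Cg.
  by split => // x; apply: continuousD; [exact: Ck_continuous Cf x|exact: Ck_continuous Cg x].
apply: (@CkS _ _ (fun v x => 'D_v f x + 'D_v g x)) => [v x|x|v].
- by apply: is_deriveD; apply/derivableP; [exact: Ck_derivable Cf|exact: Ck_derivable Cg].
- by apply: continuousD; [exact: Ck_continuous Cf x|exact: Ck_continuous Cg x].
- by apply: IH; [exact: Ck_derive Cf|exact: Ck_derive Cg].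
Qed.

Lemma CkM n f g : Ck n f -> Ck n g -> Ck n (fun x => f x * g x).
Proof.
elim: n f g => [|n IH] f g Cf Cg.
  by split => // x; apply: continuousM; [exact: Ck_continuous Cf x|exact: Ck_continuous Cg x].
apply: (@CkS _ _ (fun v x => f x * 'D_v g x + g x * 'D_v f x)) => [v x|x|v].
- apply: is_deriveM; apply/derivableP; [exact: Ck_derivable Cf|exact: Ck_derivable Cg].
- by apply: continuousM; [exact: Ck_continuous Cf x|exact: Ck_continuous Cg x].
- apply: CkD; apply: IH;
    [exact: CkW|exact: Ck_derive Cg|exact: CkW|exact: Ck_derive Cf].
Qed.

Lemma CkZ n (c : R) f : Ck n f -> Ck n (fun x => c * f x).
Proof. by move=> Cf; apply: CkM => //; exact: Ck_cst. Qed.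

Lemma CkN n f : Ck n f -> Ck n (fun x => - f x).
Proof.
move=> Cf; rewrite (_ : (fun x => - f x) = (fun x => - 1 * f x)); first exact: CkZ.
by apply/funext => x; rewrite mulN1r.
Qed.

Lemma Ck_sum n (I : Type) (s : seq I) (P : pred I) (F : I -> V -> R) :
  (forall i, P i -> Ck n (F i)) -> Ck n (fun x => \sum_(i <- s | P i) F i x).
Proof.
move=> CF; elim: s => [|i s IH].
  by under eq_fun do rewrite big_nil; exact: Ck_cst.
under eq_fun do rewrite big_cons.
by case: (boolP (P i)) => // Pi; apply: CkD => //; exact: CF.
Qed.

Lemma Ck_prod n (I : Type) (s : seq I) (P : pred I) (F : I -> V -> R) :
  (forall i, P i -> Ck n (F i)) -> Ck n (fun x => \prod_(i <- s | P i) F i x).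
Proof.
move=> CF; elim: s => [|i s IH].
  by under eq_fun do rewrite big_nil; exact: Ck_cst.
under eq_fun do rewrite big_cons.
by case: (boolP (P i)) => // Pi; apply: CkM => //; exact: CF.
Qed.

(** Derivatives along a line are derivatives of a function of one real variable; one-dimensional
    results transfer through this. *)
Lemma derivable_dir f (x v : V) :
  derivable f x v <-> derivable (fun h : R => f (h *: v + x)) 0 1.
Proof.
rewrite /derivable; set F := (X in cvg (X @ _) <-> _); set G := (X in _ <-> cvg (X @ _)).
suff -> : F = G by [].
by rewrite /F /G; apply/funext => h /=; rewrite addr0 scale0r add0r scaler1.
Qed.

Lemma derive_dir f (x v : V) : 'D_v f x = 'D_1 (fun h : R => f (h *: v + x)) 0.
Proof.
rewrite /derive; set F := (X in lim (X @ _) = _); set G := (X in _ = lim (X @ _)).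
suff -> : F = G by [].
by rewrite /F /G; apply/funext => h /=; rewrite addr0 scale0r add0r scaler1.
Qed.

(** Only the restriction of [f] to the line through [x] matters, and in one variable derivability is
    differentiability, so the usual chain rule applies although [f] is only derivable along [v]. *)
Lemma is_derive_comp (g : R -> R) f (x v : V) (dg df : R) :
  is_derive (f x) 1 g dg -> is_derive x v f df ->
  is_derive x v (fun y => g (f y)) (dg * df).
Proof.
move=> [dgx <-] [dfx <-].
move/derivable_dir : (dfx) => dF.
set F := (fun h : R => f (h *: v + x)) in dF.
have F0 : F 0 = f x by rewrite /F scale0r add0r.
rewrite -F0 in dgx *.
have gF : is_derive (0 : R) 1 (g \o F) ('D_1 g (F 0) * 'D_1 F 0).
  split.
    move/derivable1_diffP : (dF) => dF'.
    move/derivable1_diffP : (dgx) => dgx'.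
    by apply/derivable1_diffP; exact: differentiable_comp.
  rewrite -derive1E (derive1_comp dF dgx) (derive1E g) (derive1E F).
  by [].
split.
  by apply/derivable_dir; case: gF.
by rewrite derive_dir; case: gF => _; rewrite /F (derive_dir f).
Qed.

End Ck_theory.

Section Ck_theory2.
Context {R : realType} {V : normedModType R}.
Implicit Types f g : V -> R.

Lemma Ck_comp n (g : R -> R) f :
  Ck n g -> Ck n f -> Ck n (fun x => g (f x)).
Proof.
elim: n g f => [|n IH] g f Cg Cf.
  split => // x; apply: continuous_comp; first exact: Ck_continuous Cf x.
  exact: Ck_continuous Cg _.
apply: (@CkS _ _ _ _ (fun v x => 'D_1 g (f x) * 'D_v f x)) => [v x|x|v].
- by apply: is_derive_comp; apply/derivableP;
    [exact: Ck_derivable Cg|exact: Ck_derivable Cf].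
- apply: continuous_comp; first exact: Ck_continuous Cf x.
  exact: Ck_continuous Cg _.
- apply: CkM; last exact: (Ck_derive _ Cf).
  by apply: (IH ('D_1 g)); [exact: (Ck_derive _ Cg)|exact: CkW].
Qed.

Lemma Ck_inv n f : (forall x, f x != 0) -> Ck n f -> Ck n (fun x => (f x)^-1).
Proof.
move=> f0; elim: n => [|n IH] Cf.
  by split => // x; apply: continuousV => //; exact: Ck_continuous Cf x.
have ci : continuous (fun x => (f x)^-1).
  by move=> x; apply: continuousV => //; exact: Ck_continuous Cf x.
apply: (@CkS _ _ _ _ (fun v x => - 1 * ((f x)^-1 * (f x)^-1) * 'D_v f x)) => // [v x|v].
  have dfx := @Ck_derivable _ _ _ _ v x Cf.
  split; first exact: derivableV.
  by rewrite deriveV//= /GRing.scale/= mulN1r expr2 invfM.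
apply: CkM; last exact: Ck_derive.
by apply: CkZ; apply: CkM; apply: IH; exact: CkW.
Qed.

Lemma Ck_linear n (l : {linear V -> R}) : continuous l -> Ck n l.
Proof.
move=> cl; case: n => [|n]; first by split.
apply: (@CkS _ _ _ _ (fun v _ => l v)) => // [v x|v]; last exact: Ck_cst.
have dl := linear_differentiable x cl.
split; first exact: diff_derivable.
by rewrite deriveE// diff_lin.
Qed.

Lemma Coo_derive f v : Coo f -> Coo ('D_v f).
Proof. by move=> Cf n; exact/Ck_derive/Cf. Qed.

Lemma Coo_derivable f v x : Coo f -> derivable f x v.
Proof. by move=> /(_ 1); exact: Ck_derivable. Qed.

Lemma Coo_continuous f : Coo f -> continuous f.
Proof. by move=> /(_ 0); exact: Ck_continuous. Qed.

Lemma Coo_iter_derive vs f : Coo f -> Coo (iter_derive vs f).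
Proof.
elim: vs f => [//|v vs IH] f Cf /=; exact/Coo_derive/IH.
Qed.

Lemma Coo_smooth_on (A : set V) f : Coo f -> smooth_on A f.
Proof.
move=> Cf x _; exists setT, f; split => //; first by split => //; exact: openT.
move=> vs y _; split; first exact/Coo_continuous/Coo_iter_derive.
by move=> v; exact/Coo_derivable/Coo_iter_derive.
Qed.

End Ck_theory2.

(** * Mean value inequalities, flat functions and smooth steps *)

Section derivative_lipschitz.
Context {R : realType}.
Add Field Rfield : (fcar_field R).
Implicit Types f df : R -> R.

Lemma lipschitz_derive f df (C : R) : (forall x : R, is_derive x 1 f (df x)) ->
  (forall x, `|df x| <= C) -> forall x y, `|f x - f y| <= C * `|x - y|.
Proof.
move=> fdf dfC.
have H : forall x y : R, x <= y -> `|f y - f x| <= C * `|y - x|.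
  move=> x y xy.
  have cf : continuous f.
    by move=> z; apply/differentiable_continuous/derivable1_diffP; exact: (@ex_derive _ _ _ _ _ _ _ (fdf z)).
  have := @MVT_segment R f df x y xy (fun z _ => fdf z) (continuous_subspaceT cf).
  by move=> [z _ ->]; rewrite normrM ler_wpM2r.
move=> x y; have [xy|xy] := leP x y; last by apply: H; exact: ltW.
by rewrite distrC (distrC x); exact: H.
Qed.

(** The increment is [df z * (x - y)] for some [z] between the points, and monotonicity compares
    [df z] with [df x] on either side. *)
Lemma convex_tangent f df : (forall x : R, is_derive x 1 f (df x)) ->
  {homo df : x y / x <= y} -> forall x y, f x - f y <= df x * (x - y).
Proof.
move=> fdf mdf.
have cf : continuous f.
  by move=> z; apply/differentiable_continuous/derivable1_diffP; exact: (@ex_derive _ _ _ _ _ _ _ (fdf z)).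
move=> x y; have [xy|/ltW xy] := leP x y.
  have [z /itvP zxy] := @MVT_segment R f df x y xy (fun z _ => fdf z) (continuous_subspaceT cf).
  move=> /(congr1 -%R); rewrite opprB => ->.
  have := mdf x z; rewrite zxy => /(_ isT) H.
  rewrite -subr_ge0.
  have -> : df x * (x - y) - - (df z * (y - x)) = (df z - df x) * (y - x) by fring.
  by rewrite mulr_ge0// subr_ge0.
have [z /itvP zxy ->] := @MVT_segment R f df y x xy (fun z _ => fdf z) (continuous_subspaceT cf).
have := mdf z x; rewrite zxy => /(_ isT) H.
by rewrite ler_wpM2r// subr_ge0.
Qed.

End derivative_lipschitz.

Section flat.
Context {R : realType}.
Add Field Rfield : (fcar_field R).

Lemma is_derive0_quadratic (f : R -> R) (x C : R) :
  (forall h, `|f (h + x) - f x| <= C * h ^+ 2) -> is_derive x 1 f 0.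
Proof.
move=> fC; have H : h^-1 *: ((f \o shift x) (h *: 1) - f x) @[h --> 0^'] --> (0 : R).
  apply/cvgr0Pnorm_lt => e e0.
  have C1 : 0 < `|C| + 1 by rewrite ltr_wpDl.
  near=> h.
  have h0 : h != 0 by near: h; exact: nbhs_dnbhs_neq.
  rewrite normrZ /= scaler1 normfV.
  rewrite mulrC ltr_pdivrMr ?normr_gt0//.
  apply: (le_lt_trans (fC h)).
  apply: (@le_lt_trans _ _ ((`|C| + 1) * `|h| * `|h|)).
    rewrite -mulrA -normrM -expr2 (ger0_norm (sqr_ge0 h)) ler_wpM2r ?sqr_ge0//.
    by rewrite (le_trans (ler_norm _))// lerDl.
  rewrite ltr_pM2r ?normr_gt0// mulrC -ltr_pdivlMr//.
  near: h; apply: dnbhs0_lt; exact: divr_gt0.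
by split; [apply/cvg_ex; exists 0|exact/cvg_lim].
Unshelve. all: by end_near. Qed.

(** The powers of the inverse make this family closed under differentiation up to linear
    combinations ([is_derive_flat]), so that smoothness follows by induction on the order, for all
    [k] at once. *)
Definition flat (k : nat) (y : R) : R :=
  if 0 < y then y^-1 ^+ k * expR (- y^-1) else 0.

Lemma flat_le0 k y : y <= 0 -> flat k y = 0.
Proof. by rewrite /flat leNgt => /negbTE ->. Qed.

Lemma flat_gt0 k y : 0 < y -> 0 < flat k y.
Proof. by move=> y0; rewrite /flat y0 mulr_gt0 ?expR_gt0// exprn_gt0// invr_gt0. Qed.

Lemma flat_ge0 k y : 0 <= flat k y.
Proof. by have [/flat_le0->//|/(flat_gt0 k)/ltW] := leP y 0. Qed.

(** A single term of the exponential series is below the exponential. *)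
Lemma pow_expRN_le k (z : R) : 0 <= z -> z ^+ k * expR (- z) <= k`!%:R.
Proof.
case: k => [|k] z0.
  by rewrite expr0 mul1r fact0 expR_le1 oppr_le0.
have := expR_ge1Dxn k z0; rewrite expRN ler_pdivrMr ?expR_gt0//.
set f := k.+1`!%:R; have f0 : 0 < f :> R by rewrite ltr0n fact_gt0.
move=> H; rewrite mulrC -ler_pdivrMr//; apply: le_trans H.
by rewrite lerDr.
Qed.

Lemma flat_le k y : flat k y <= k`!%:R.
Proof.
have [y0|y0] := leP y 0; first by rewrite flat_le0.
by rewrite /flat y0 pow_expRN_le// invr_ge0 ltW.
Qed.

(** The bound at exponent [k.+2] leaves two spare factors of [y]; this quadratic decay is what makes
    the derivative at 0 exist and vanish. *)
Lemma flat_sqr k y : `|flat k y| <= (k.+2)`!%:R * y ^+ 2.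
Proof.
have [y0|y0] := leP y 0; first by rewrite flat_le0// normr0 mulr_ge0 ?sqr_ge0.
rewrite ger0_norm ?flat_ge0// /flat y0 -ler_pdivrMr ?exprn_gt0//.
apply: le_trans (pow_expRN_le k.+2 (_ : 0 <= y^-1)); last by rewrite invr_ge0 ltW.
by rewrite mulrAC -exprVn -exprD addn2.
Qed.

Lemma is_derive_flat k (x : R) :
  is_derive x 1 (flat k) (flat k.+2 x - k%:R * flat k.+1 x).
Proof.
have [x0|x0|x0] := ltgtP x 0.
- rewrite !flat_le0 ?ltW// mulr0 subr0.
  apply: (@near_eq_is_derive R R R (cst 0)) => //.
  near=> y; rewrite /cst flat_le0//; near: y.
  by apply: (@filterS _ _ _ _ _ _ (lt_nbhsl x0)) => y; exact: ltW.
- apply: (@near_eq_is_derive R R R (fun y : R => y^-1 ^+ k * expR (- y^-1))).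
    near=> y; rewrite /flat ifT//; near: y; exact: lt_nbhsr.
  have xn0 : x != 0 by rewrite gt_eqF.
  have dV : is_derive x 1 (fun y : R => y^-1) (- (x^-1 ^+ 2)).
    have did : derivable (@id R) x 1 by exact: derivable_id.
    split; first exact: (derivableV xn0 did).
    rewrite (@deriveV _ _ (@id R))// derive_id.
    by rewrite /GRing.scale/= mulr1 exprVn.
  have dE : is_derive x 1 (fun y : R => expR (- y^-1)) (expR (- x^-1) * (x^-1 ^+ 2)).
    apply: (@is_derive_comp R R expR (fun y : R => - y^-1) x 1 (expR (- x^-1)) (x^-1 ^+ 2)).
    by apply: is_derive_eq; rewrite opprK.
  have dX : is_derive x 1 (fun y : R => y^-1 ^+ k) (k%:R * x^-1 ^+ k.-1 * - (x^-1 ^+ 2)).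
    rewrite (_ : (fun y : R => y^-1 ^+ k) = (fun y : R => y^-1) ^+ k); last first.
      by apply/funext => y; rewrite exprfctE.
    exact: is_deriveX.
  have := is_deriveM dX dE.
  move=> H; apply: (is_derive_eq H).
  rewrite /flat x0 /GRing.scale/=.
  have -> : x^-1 ^+ k.+2 = x^-1 ^+ k * x^-1 ^+ 2 by rewrite -exprD addn2.
  case: k {H dX} => [|k]; first by rewrite !mul0r mulr0 subr0; fring.
  have -> : x^-1 ^+ k.+2 = x^-1 ^+ k * x^-1 ^+ 2 by rewrite -exprD addn2.
  rewrite [k.+1.-1]/= !exprS expr0.
  by set a := x^-1 ^+ k; set b := x^-1; set E := expR _; set N := k.+1%:R; fring.
- rewrite x0 !flat_le0// mulr0 subr0.
  apply: (@is_derive0_quadratic _ _ ((k.+2)`!%:R)) => h.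
  by rewrite addr0 (flat_le0 k (lexx _)) subr0 flat_sqr.
Unshelve. all: by end_near. Qed.

Lemma CooS1 (f df : R -> R) : (forall x : R, is_derive x 1 f (df x)) ->
  forall n, Ck n df -> Ck n.+1 f.
Proof.
move=> fdf n Cdf; have cf : continuous f.
  by move=> z; apply/differentiable_continuous/derivable1_diffP; exact: (@ex_derive _ _ _ _ _ _ _ (fdf z)).
apply: (@CkS R R n f (fun v x : R => v * df x)) => // [v x|v]; last exact: CkZ.
have dfx : differentiable f x.
  by apply/derivable1_diffP; exact: (@ex_derive _ _ _ _ _ _ _ (fdf x)).
split; first exact: diff_derivable.
rewrite deriveE// deriv1E; last exact/derivable1_diffP.
by rewrite derive1E (@derive_val _ _ _ _ _ _ _ (fdf x)).
Qed.

Lemma Coo_flat k : Coo (flat k).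
Proof.
move=> n; elim: n k => [|n IH] k.
  split => // x; apply/differentiable_continuous/derivable1_diffP.
  exact: (@ex_derive _ _ _ _ _ _ _ (is_derive_flat k x)).
apply: (CooS1 (is_derive_flat k)).
rewrite (_ : (fun x => _) = (fun x => flat k.+2 x + (- k%:R) * flat k.+1 x)); last first.
  by apply/funext => x; rewrite mulNr.
by apply: CkD => //; exact: CkZ.
Qed.

Lemma Coo_id : Coo (fun x : R => x).
Proof.
move=> n; case: n => [|n]; first by split => // x; exact: cvg_id.
by apply: (CooS1 (fun x => is_derive_id x 1)); exact: Ck_cst.
Qed.

(** A descending step, from 1 on the negative half-line to 0 beyond 1. The denominator is positive
    because [y] and [1 - y] are never both nonpositive. *)
Definition smooth_step (y : R) : R :=
  flat 0 (1 - y) / (flat 0 y + flat 0 (1 - y)).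

Let step_den y : 0 < flat 0 y + flat 0 (1 - y).
Proof.
have [y0|y0] := leP y 0; last by rewrite ltr_pwDl ?flat_ge0 ?flat_gt0.
by rewrite ltr_wpDl ?flat_ge0// flat_gt0// subr_gt0 (le_lt_trans y0).
Qed.

Lemma Coo_step : Coo smooth_step.
Proof.
have C1 : Coo (fun y : R => flat 0 (1 - y)).
  move=> n; apply: (Ck_comp (g := flat 0)); first exact: Coo_flat.
  apply: CkD; first exact: Ck_cst.
  by apply: CkN; exact: Coo_id.
move=> n; apply: CkM; first exact: C1.
apply: Ck_inv; first by move=> y; rewrite gt_eqF.
by apply: CkD; [exact: Coo_flat|exact: C1].
Qed.

Lemma step_le0 y : y <= 0 -> smooth_step y = 1.
Proof.
move=> y0; rewrite /smooth_step (flat_le0 _ y0) add0r divff// gt_eqF// flat_gt0//.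
by rewrite subr_gt0 (le_lt_trans y0).
Qed.

Lemma step_ge1 y : 1 <= y -> smooth_step y = 0.
Proof. by move=> y1; rewrite /smooth_step flat_le0 ?subr_le0// mul0r. Qed.

Lemma step_ge0 y : 0 <= smooth_step y.
Proof. by rewrite divr_ge0 ?flat_ge0// ltW. Qed.

Lemma step_le1 y : smooth_step y <= 1.
Proof. by rewrite ler_pdivrMr// mul1r lerDr flat_ge0. Qed.

End flat.

(** * A smooth convex function vanishing exactly on [-M, M] *)

Section barrier.
Context {R : realType}.
Add Field Rfield : (fcar_field R).

Lemma mul_flat k (y : R) : y * flat k.+1 y = flat k y.
Proof.
have [y0|y0] := leP y 0; first by rewrite !flat_le0// mulr0.
by rewrite /flat y0 exprS !mulrA divff ?mul1r// gt_eqF.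
Qed.

(** The function [y * flat 0 y] is a smooth substitute for the positive part: its first derivative
    lies in [0, 1] ([excess1_le1], from 1 + z <= exp z), and its second derivative is [flat 3],
    nonnegative and at most 3!. *)
Lemma is_derive_excess (x : R) :
  is_derive x 1 (fun y => y * flat 0 y) (flat 0 x + flat 1 x).
Proof.
have := is_deriveM (is_derive_id x 1) (is_derive_flat 0 x).
move=> H; apply: (is_derive_eq H).
by rewrite /GRing.scale/= mul0r subr0 mulr1 mul_flat addrC.
Qed.

Lemma is_derive_excess2 (x : R) :
  is_derive x 1 (fun y => flat 0 y + flat 1 y) (flat 3 x).
Proof.
have := is_deriveD (is_derive_flat 0 x) (is_derive_flat 1 x).
move=> H; apply: (is_derive_eq H).
by rewrite mul0r subr0 mul1r addrC subrK.
Qed.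

Lemma excess1_le1 (y : R) : flat 0 y + flat 1 y <= 1.
Proof.
have [y0|y0] := leP y 0; first by rewrite !flat_le0// addr0 ler01.
rewrite /flat y0 expr0 expr1 -mulrDl expRN ler_pdivrMr ?expR_gt0// mul1r.
exact: expR_ge1Dx.
Qed.

Variable M : R.

(* Smooth convex, vanishing exactly on [-M, M] when 0 <= M. *)
Definition barrier (s : R) : R :=
  (s - M) * flat 0 (s - M) + (- s - M) * flat 0 (- s - M).

Definition barrier1 (s : R) : R :=
  flat 0 (s - M) + flat 1 (s - M) - (flat 0 (- s - M) + flat 1 (- s - M)).

Definition barrier2 (s : R) : R := flat 3 (s - M) + flat 3 (- s - M).

Let dshift (s : R) : is_derive s 1 (fun s : R => s - M) 1.
Proof.
have := is_deriveB (is_derive_id s 1) (is_derive_cst M s 1).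
by move=> H; apply: (is_derive_eq H); rewrite subr0.
Qed.

Let dnshift (s : R) : is_derive s 1 (fun s : R => - s - M) (- 1).
Proof.
have := is_deriveB (is_deriveN (is_derive_id s 1)) (is_derive_cst M s 1).
by move=> H; apply: (is_derive_eq H); rewrite subr0.
Qed.

Let dcomp (f df : R -> R) (s : R) : (forall x : R, is_derive x 1 f (df x)) ->
  is_derive s 1 (fun s : R => f (s - M)) (df (s - M)).
Proof.
move=> fdf; have := @is_derive_comp R R f (fun s : R => s - M) s 1 _ _ (fdf _) (dshift s).
by move=> H; apply: (is_derive_eq H); rewrite mulr1.
Qed.

Let dncomp (f df : R -> R) (s : R) : (forall x : R, is_derive x 1 f (df x)) ->
  is_derive s 1 (fun s : R => f (- s - M)) (- df (- s - M)).
Proof.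
move=> fdf; have := @is_derive_comp R R f (fun s : R => - s - M) s 1 _ _ (fdf _) (dnshift s).
by move=> H; apply: (is_derive_eq H); rewrite mulrN1.
Qed.

Lemma is_derive_barrier (s : R) : is_derive s 1 barrier (barrier1 s).
Proof. exact: is_deriveD (dcomp s is_derive_excess) (dncomp s is_derive_excess). Qed.

Lemma is_derive_barrier1 (s : R) : is_derive s 1 barrier1 (barrier2 s).
Proof.
have := is_deriveB (dcomp s is_derive_excess2) (dncomp s is_derive_excess2).
by move=> H; apply: (is_derive_eq H); rewrite opprK.
Qed.

Lemma Coo_barrier1 : Coo barrier1.
Proof.
have Cs : Coo (fun s : R => s - M) by move=> n; apply: CkD; [exact: Coo_id|exact: Ck_cst].
have Cns : Coo (fun s : R => - s - M).
  by move=> n; apply: CkD; [apply: CkN; exact: Coo_id|exact: Ck_cst].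
have Cf k : Coo (fun s : R => flat k (s - M)).
  by move=> n; apply: (Ck_comp (g := flat k)); [exact: Coo_flat|exact: Cs].
have Cnf k : Coo (fun s : R => flat k (- s - M)).
  by move=> n; apply: (Ck_comp (g := flat k)); [exact: Coo_flat|exact: Cns].
move=> n; apply: CkD; first by apply: CkD; exact: Cf.
by apply: CkN; apply: CkD; exact: Cnf.
Qed.

Lemma Coo_barrier : Coo barrier.
Proof.
have H n : Ck n.+1 barrier.
  by apply: (CooS1 is_derive_barrier); exact: Coo_barrier1.
by case=> [|n]; [exact/CkW/H|exact: H].
Qed.

Lemma Coo_barrier2 : Coo barrier2.
Proof.
rewrite (_ : barrier2 = 'D_1 barrier1); first by move=> n; apply: Coo_derive; exact: Coo_barrier1.
by apply/funext => s; rewrite (@derive_val _ _ _ _ _ _ _ (is_derive_barrier1 s)).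
Qed.

Lemma barrier_ge0 s : 0 <= barrier s.
Proof.
have H (y : R) : 0 <= y * flat 0 y.
  by have [y0|/ltW y0] := leP y 0; [rewrite flat_le0// mulr0|rewrite mulr_ge0// flat_ge0].
by rewrite addr_ge0.
Qed.

Lemma barrier_eq0 s : barrier s = 0 -> `|s| <= M.
Proof.
have H (y : R) : 0 <= y * flat 0 y.
  by have [y0|/ltW y0] := leP y 0; [rewrite flat_le0// mulr0|rewrite mulr_ge0// flat_ge0].
have H2 (y : R) : 0 < y -> 0 < y * flat 0 y by move=> y0; rewrite mulr_gt0// flat_gt0.
move=> b0; rewrite ler_norml; apply/andP; split.
  rewrite leNgt; apply/negP => sM; move: b0; apply/eqP; rewrite gt_eqF//.
  by rewrite ltr_wpDl//; apply: H2; rewrite subr_gt0 ltrNr.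
rewrite leNgt; apply/negP => sM; move: b0; apply/eqP; rewrite gt_eqF//.
by rewrite ltr_pwDl//; apply: H2; rewrite subr_gt0.
Qed.

Lemma barrier_le s : `|s| <= M -> barrier s = 0.
Proof.
rewrite ler_norml => /andP[sM1 sM2]; rewrite /barrier !flat_le0 ?mulr0 ?addr0//.
- by rewrite subr_le0 lerNl.
- by rewrite subr_le0.
Qed.

Lemma barrier2_ge0 s : 0 <= barrier2 s.
Proof. by rewrite addr_ge0// flat_ge0. Qed.

Lemma barrier2_le s : `|barrier2 s| <= 12.
Proof.
rewrite ger0_norm ?barrier2_ge0// (_ : 12 = 3`!%:R + 3`!%:R :> R); last by rewrite -natrD.
by rewrite lerD// flat_le.
Qed.

Lemma barrier1_le s : `|barrier1 s| <= 1.
Proof.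
have H (y : R) : 0 <= flat 0 y + flat 1 y by rewrite addr_ge0// flat_ge0.
rewrite ler_norml; apply/andP; split.
  by rewrite lerBrDr (le_trans _ (H _))// addrC subr_le0 excess1_le1.
by rewrite lerBlDr (le_trans (excess1_le1 _))// lerDl.
Qed.

Lemma barrier1_nd : {homo barrier1 : x y / x <= y}.
Proof.
move=> x y xy.
have cf : continuous barrier1 by exact: Coo_continuous Coo_barrier1.
have [z _] := @MVT_segment R barrier1 barrier2 x y xy
  (fun z _ => is_derive_barrier1 z) (continuous_subspaceT cf).
by move=> E; rewrite -subr_ge0 E mulr_ge0 ?subr_ge0 ?barrier2_ge0.
Qed.

Lemma barrier_tangent x y : barrier x - barrier y <= barrier1 x * (x - y).
Proof. exact: convex_tangent is_derive_barrier barrier1_nd x y. Qed.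

Lemma barrier_lip x y : `|barrier x - barrier y| <= `|x - y|.
Proof.
have := lipschitz_derive is_derive_barrier barrier1_le x y.
by rewrite mul1r.
Qed.

Lemma barrier1_lip x y : `|barrier1 x - barrier1 y| <= 12 * `|x - y|.
Proof. exact: lipschitz_derive is_derive_barrier1 barrier2_le x y. Qed.

(** A primitive of [s * barrier2 s]. It writes s b''(s) grad s as a gradient, which a
    divergence-free field annihilates after integration. *)
Definition barrier_flux (s : R) : R := s * barrier1 s - barrier s.

Lemma Coo_barrier_flux : Coo barrier_flux.
Proof.
move=> n; apply: CkD; last by apply: CkN; exact: Coo_barrier.
by apply: CkM; [exact: Coo_id|exact: Coo_barrier1].
Qed.

Lemma is_derive_barrier_flux (s : R) :
  is_derive s 1 barrier_flux (s * barrier2 s).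
Proof.
have := is_deriveB (is_deriveM (is_derive_id s 1) (is_derive_barrier1 s)) (is_derive_barrier s).
by move=> H; apply: (is_derive_eq H); rewrite /GRing.scale/= mulr1 addrK.
Qed.

End barrier.

(** * Measurability, boundedness and Fubini on the torus *)

Section rV_measurability.
Context {R : realType}.

Lemma measurable_fun_countable_range (d1 d2 : measure_display)
    (T : measurableType d1) (Z : countType) (Y : measurableType d2)
    (h : T -> Z) (g : Z -> Y) :
  (forall z, measurable (h @^-1` [set z])) -> measurable_fun setT (g \o h).
Proof.
move=> mh _ B mB; rewrite setTI.
rewrite (_ : _ @^-1` _ =
  \bigcup_z (if `[< B (g z) >] then h @^-1` [set z] else set0)).
  apply: countable_bigcupT_measurable => // z.
  by case: asboolP.
apply/seteqP; split => [x Bx|x [z _]].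
  by exists (h x) => //; rewrite asboolT.
by case: asboolP => // Bz /= ->.
Qed.

Lemma cvg_rV (n : nat) (T : Type) (F : set_system T) (FF : Filter F)
    (u : T -> 'rV[R]_n) (x : 'rV[R]_n) :
  (forall i, u k ord0 i @[k --> F] --> x ord0 i) -> u k @[k --> F] --> x.
Proof.
move=> ux; apply/cvg_ballP => e e0.
have : \forall k \near F, forall j : 'I_n, ball (x ord0 j) e (u k ord0 j).
  apply: filter_forall => j; exact: (cvg_ball (ux j)).
by apply: filterS => k H; split => // i j; rewrite ord1; exact: H.
Qed.

(** The sigma-algebra is the one generated by the coordinates, so [f] is obtained as the pointwise
    limit of its values at the lower corners of the cells of the lattice of mesh 1/(k+1): each
    approximation is constant on countably many measurable cells. *)
Lemma measurable_continuous_rV (n : nat) (f : 'rV[R]_n -> R) :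
  continuous f -> measurable_fun setT f.
Proof.
move=> cf.
pose fl k (x : 'rV[R]_n) : 'rV[int]_n := map_mx (fun r => Num.floor (k.+1%:R * r)) x.
pose ce k (z : 'rV[int]_n) : 'rV[R]_n := map_mx (fun m : int => m%:~R / k.+1%:R) z.
apply: (measurable_realfun.measurable_fun_cvg (h := fun k => f \o ce k \o fl k)) => [k|x _].
  apply: (@measurable_fun_countable_range _ _ _ _ _ (fl k) (f \o ce k)) => z.
  rewrite (_ : _ @^-1` _ = \bigcap_(i in [set: 'I_n])
     ((fun x : 'rV[R]_n => x ord0 i) @^-1`
       `[(z ord0 i)%:~R / k.+1%:R, (z ord0 i + 1)%:~R / k.+1%:R[)).
    apply: fin_bigcap_measurable => [|i _]; first exact: finite_finset.
    have := @measurable_coord _ (measurableTypeR R) n i measurableT _ (measurable_itv `[(z ord0 i)%:~R / k.+1%:R, (z ord0 i + 1)%:~R / k.+1%:R[).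
    by rewrite setTI.
  apply/seteqP; split => x /=.
    move=> <- i _ /=; rewrite in_itv/= !mxE.
    by rewrite ler_pdivrMr// ltr_pdivlMr// mulrC floor_itv.
  move=> H; apply/rowP => i; rewrite mxE; apply: floor_def.
  have := H i I; rewrite /= in_itv/=.
  by rewrite ler_pdivrMr// ltr_pdivlMr// mulrC.
apply: continuous_cvg; first exact: cf.
apply: cvg_rV => i /=.
apply/cvgrPdist_le => e e0; near=> k; rewrite !mxE.
have k0 : 0 < k.+1%:R :> R by [].
have /andP[H1 H2] := floor_itv (k.+1%:R * x ord0 i).
rewrite ler_norml; apply/andP; split.
  apply: (@le_trans _ _ 0); first by rewrite oppr_le0 ltW.
  by rewrite subr_ge0 ler_pdivrMr// [leRHS]mulrC.
rewrite lerBlDr -(@ler_pM2l _ k.+1%:R)// mulrDr mulrCA divff ?gt_eqF// mulr1.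
rewrite (le_trans (ltW H2))// addrC intrD lerD2r.
rewrite -ler_pdivrMr// div1r.
apply: (@le_trans _ _ k%:R); last by rewrite ler_nat.
near: k; exact: nbhs_infty_ger.
Unshelve. all: by end_near. Qed.

End rV_measurability.

Section torus_functions.
Context {R : realType}.
Add Field Rfield : (fcar_field R).

(** Subtracting the floors of the coordinates moves any point into the unit cube, which is
    compact. *)
Lemma periodic_bounded (n : nat) (f : 'rV[R]_n -> R) :
  torus_periodic f -> continuous f -> exists2 M, 0 <= M & forall x, `|f x| <= M.
Proof.
move=> pf cf.
pose A := [set v : 'rV[R]_n | forall i, `[(0:R), 1]%classic (v ord0 i)].
have cA : compact A.
  apply: (@rV_compact R n (fun=> `[(0:R), 1]%classic)) => i; exact: segment_compact.
have A0 : A !=set0 by exists 0 => i /=; rewrite mxE in_itv/= lexx ler01.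
have cnf : continuous (fun x => `|f x|).
  by move=> x; apply: continuous_comp; [exact: cf|exact: norm_continuous].
have [c _ Hc] := EVT_max_rV A0 cA (continuous_subspaceT cnf).
exists `|f c| => // x.
have -> : f x = f (x + map_mx intr (map_mx (fun r : R => - Num.floor r) x)) by rewrite pf.
apply: Hc; rewrite inE => i /=; rewrite !mxE in_itv/= intrN.
have /andP[H1 H2] := floor_itv (x ord0 i).
by rewrite subr_ge0 H1 /= lerBlDl -intrD1 ltW.
Qed.

Definition cons_rV (n : nat) (s : R) (x : 'rV[R]_n) : 'rV[R]_n.+1 :=
  torus_cons (s, x).

Lemma cons_rV0 n s (x : 'rV[R]_n) : cons_rV s x ord0 ord0 = s.
Proof.
rewrite /cons_rV /torus_cons/=.
have -> : ord0 = lshift n (ord0 : 'I_1) :> 'I_(1 + n) by exact: val_inj.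
apply: etrans (@row_mxEl R 1 1 n _ _ ord0 ord0) _.
by rewrite mxE eqxx mulr1n.
Qed.

Lemma cons_rVS n s (x : 'rV[R]_n) (i : 'I_n) : cons_rV s x ord0 (lift ord0 i) = x ord0 i.
Proof.
rewrite /cons_rV /torus_cons/=.
have -> : lift ord0 i = rshift 1 i :> 'I_(1 + n) by exact: val_inj.
exact: (@row_mxEr R 1 1 n _ _ ord0 i).
Qed.

Lemma cons_rV_eq n s (x : 'rV[R]_n) (y : 'rV[R]_n.+1) :
  y ord0 ord0 = s -> (forall i, y ord0 (lift ord0 i) = x ord0 i) -> cons_rV s x = y.
Proof.
move=> y0 yS; apply/rowP => j; have [->|[i ->]] : j = ord0 \/ exists i, j = lift ord0 i.
  by case: (unliftP ord0 j) => [i ->|->]; [right; exists i|left].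
- by rewrite cons_rV0.
- by rewrite cons_rVS.
Qed.

Lemma line_coord n (h : R) (i j : 'I_n) (y : 'rV[R]_n) :
  (h *: Defs.basis i + y) ord0 j = h * (j == i)%:R + y ord0 j.
Proof. by rewrite [LHS]mxE; congr (_ + _); rewrite !mxE eqxx. Qed.

Lemma cons_rV_shift0 n s (x : 'rV[R]_n) (h : R) :
  cons_rV (h + s) x = h *: Defs.basis ord0 + cons_rV s x.
Proof.
apply: cons_rV_eq => [|i]; first by rewrite line_coord cons_rV0 mulr1.
by rewrite line_coord cons_rVS mulr0 add0r.
Qed.

Lemma cons_rV_shiftS n s (x : 'rV[R]_n) (h : R) (i : 'I_n) :
  cons_rV s (h *: Defs.basis i + x) = h *: Defs.basis (lift ord0 i) + cons_rV s x.
Proof.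
apply: cons_rV_eq => [|j]; first by rewrite line_coord cons_rV0 mulr0 add0r.
by rewrite !line_coord cons_rVS (inj_eq lift_inj).
Qed.

Lemma continuous_cons_rVl n (x : 'rV[R]_n) :
  continuous (fun s => cons_rV s x : 'rV[R]_n.+1).
Proof.
move=> s; apply: cvg_rV => i; case: (unliftP ord0 i) => [j|] ->.
  under eq_fun do rewrite cons_rVS; rewrite cons_rVS; exact: cvg_cst.
by under eq_fun do rewrite cons_rV0; rewrite cons_rV0; exact: cvg_id.
Qed.

Lemma continuous_cons_rVr n (s : R) : continuous (@cons_rV n s).
Proof.
move=> x; apply: (@cvg_rV _ _ _ _ (nbhs_filter x)) => i; case: (unliftP ord0 i) => [j|] ->.
  under eq_fun do rewrite cons_rVS; rewrite cons_rVS; exact: coord_continuous.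
by under eq_fun do rewrite cons_rV0; rewrite cons_rV0; exact: cvg_cst.
Qed.

End torus_functions.

Section probability_integrals.
Context {d : measure_display} {T : measurableType d} {R : realType}.
Variable P : probability T R.

Lemma bounded_integrable (f : T -> R) (M : R) :
  measurable_fun setT f -> (forall x, `|f x| <= M) ->
  P.-integrable setT (EFin \o f).
Proof.
move=> mf fM; apply: measurable_bounded_integrable => //.
  by rewrite ltey_eq fin_num_measure.
exists M; split; first exact: num_real.
by move=> r Mr x _; exact: le_trans (fM x) (ltW Mr).
Qed.

Lemma bounded_Rintegral (f : T -> R) (M : R) :
  measurable_fun setT f -> (forall x, `|f x| <= M) ->
  (\int[P]_x (f x)%:E)%E = (\int[P]_x f x)%:E.
Proof.
move=> mf fM; rewrite /Rintegral fineK//.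
by apply: integrable_fin_num => //; exact: bounded_integrable mf fM.
Qed.

Lemma Rintegral_le_bound (f : T -> R) (M : R) :
  measurable_fun setT f -> (forall x, `|f x| <= M) -> `|\int[P]_x f x| <= M.
Proof.
move=> mf fM; have If := bounded_integrable mf fM.
apply: le_trans (le_normr_Rintegral measurableT If) _.
rewrite -[leRHS]mulr1 -[X in _ <= M * X](_ : fine (P setT) = 1); last first.
  by rewrite probability_setT.
rewrite -Rintegral_cst//; apply: le_Rintegral => //.
- by apply: (@bounded_integrable (fun x => `|f x|) M) => [|x]; [exact: measurableT_comp|rewrite normr_id].
- by apply: (@bounded_integrable (fun=> M) `|M|) => [|x].
Qed.

End probability_integrals.

Section fubini_bounded.
Context {d1 d2 : measure_display} {T1 : measurableType d1} {T2 : measurableType d2}.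
Context {R : realType}.
Variables (P1 : probability T1 R) (P2 : probability T2 R) (F : T1 * T2 -> R) (M : R).
Hypotheses (mF : measurable_fun setT F) (FM : forall z, `|F z| <= M).

Lemma Fubini1_bounded :
  fine (\int[(P1 \x P2)%E]_z (F z)%:E)%E = \int[P1]_x \int[P2]_y F (x, y).
Proof.
have IF : ((P1 \x P2)%E : probability _ R).-integrable setT (EFin \o F).
  exact: bounded_integrable mF FM.
rewrite -(integral12_prod_meas1 IF) /Rintegral; congr fine.
apply: eq_integral => x _; rewrite /fubini_F/=.
rewrite (@bounded_Rintegral _ _ _ _ _ M)//.
exact: (measurableT_comp mF (measurable_pair1 x)).
Qed.

Lemma Fubini2_bounded :
  fine (\int[(P1 \x P2)%E]_z (F z)%:E)%E = \int[P2]_y \int[P1]_x F (x, y).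
Proof.
have IF : ((P1 \x P2)%E : probability _ R).-integrable setT (EFin \o F).
  exact: bounded_integrable mF FM.
rewrite -(integral21_prod_meas1 IF) /Rintegral; congr fine.
apply: eq_integral => y _; rewrite /fubini_G/=.
rewrite (@bounded_Rintegral _ _ _ _ _ M)//.
exact: (measurableT_comp mF (measurable_pair2 y)).
Qed.

End fubini_bounded.

Section torus_fubini.
Context {R : realType}.
Local Notation mu := (@lebesgue_measure R).

Lemma Rintegral_uniform (g : R -> R) : measurable_fun [set: R] g ->
  \int[uniform_prob (@ltr01 R)]_s g s = \int[mu]_(s in `[0, 1]) g s.
Proof.
move=> mg; rewrite /Rintegral; congr fine.
have /measurable_EFinP mE := mg.
rewrite integralE [RHS]integralE.
rewrite !integral_uniform//=.
- by rewrite subr0 invr1 !mul1e.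
- exact: measurable_funeneg.
- exact: measurable_funepos.
Qed.

Section cons.
Variables (n : nat) (f : 'rV[R]_n.+1 -> R) (M : R).
Hypotheses (mf : measurable_fun setT f) (fM : forall x, `|f x| <= M).

Let mfc : measurable_fun setT (fun z : measurableTypeR R * 'rV[R]_n => f (torus_cons z)).
Proof. exact: (measurableT_comp mf (@measurable_torus_cons R n)). Qed.

Let vol_cons : \int[torus_measure R n.+1]_y f y =
  fine (\int[(uniform_prob (@ltr01 R) \x torus_measure R n)%E]_z (f (torus_cons z))%:E)%E.
Proof.
rewrite /Rintegral /=; congr fine.
rewrite integral_distribution//; first exact/measurable_EFinP.
apply: (@bounded_integrable _ _ R _ _ M) => //.
Qed.

(** [torus_measure] adds one coordinate at a time. Both orders of integration serve in
    [torus_integral_derive]: the new coordinate is innermost when the derivative is along it,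
    outermost otherwise. *)
Lemma torus_integral_cons1 : \int[torus_measure R n.+1]_y f y =
  \int[mu]_(s in `[0, 1]) \int[torus_measure R n]_x f (cons_rV s x).
Proof.
rewrite vol_cons (@Fubini1_bounded _ _ _ _ _ _ _ _ M)//.
rewrite Rintegral_uniform//.
have IF : ((uniform_prob (@ltr01 R) \x torus_measure R n)%E : probability _ R).-integrable setT
    (EFin \o (fun z => f (torus_cons z))).
  exact: (@bounded_integrable _ _ _ _ _ M).
exact: (measurableT_comp (fine_measurable measurableT) (measurable_fubini_F IF)).
Qed.

Lemma torus_integral_cons2 : \int[torus_measure R n.+1]_y f y =
  \int[torus_measure R n]_x \int[mu]_(s in `[0, 1]) f (cons_rV s x).
Proof.
rewrite vol_cons (@Fubini2_bounded _ _ _ _ _ _ _ _ M)//.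
apply: eq_Rintegral => x _; rewrite Rintegral_uniform//.
exact: (measurableT_comp mfc (measurable_pair2 x)).
Qed.

End cons.

End torus_fubini.

(** * Integration by parts on the torus *)

Section torus_integration_by_parts.
Context {R : realType}.
Local Notation mu := (@lebesgue_measure R).

(** A derivative only sees the restriction to a line, so two functions on different spaces that
    agree along two lines have the same derivative there. Periodicity, slicing and translation are
    all handled this way. *)
Lemma derivable_along (V W : normedModType R) (f : V -> R) (g : W -> R)
    (x v : V) (y w : W) :
  (forall h : R, f (h *: v + x) = g (h *: w + y)) ->
  (derivable f x v <-> derivable g y w) /\ 'D_v f x = 'D_w g y.
Proof.
move=> fg; have fg0 : f x = g y by have := fg 0; rewrite !scale0r !add0r.
have E : (fun h : R => h^-1 *: ((f \o shift x) (h *: v) - f x)) =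
         (fun h : R => h^-1 *: ((g \o shift y) (h *: w) - g y)).
  by apply/funext => h; rewrite /= fg fg0.
by split; rewrite /derivable /derive E.
Qed.

Lemma derive_periodic n (f : 'rV[R]_n -> R) v :
  torus_periodic f -> torus_periodic ('D_v f).
Proof.
by move=> pf x k; apply: (derivable_along _).2 => h; rewrite addrA pf.
Qed.

(** Induction on the dimension: along the first coordinate the inner integral is a difference of
    endpoint values, which is 0 by periodicity; along any other coordinate the induction hypothesis
    applies to the slices. *)
Lemma torus_integral_derive n (f : 'rV[R]_n -> R) (i : 'I_n) :
  torus_periodic f -> continuous f -> (forall x, derivable f x (Defs.basis i)) ->
  continuous ('D_(Defs.basis i) f) ->
  \int[torus_measure R n]_x 'D_(Defs.basis i) f x = 0.
Proof.
elim: n f i => [f []//|n IH] f i pf cf df cdf.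
have mdf := measurable_continuous_rV cdf.
have [M _ dfM] := periodic_bounded (@derive_periodic _ _ (Defs.basis i) pf) cdf.
case: (unliftP ord0 i) => [j|] iE; subst i; last first.
  rewrite (torus_integral_cons2 mdf dfM).
  rewrite (@eq_Rintegral _ _ _ _ _ (cst 0)) => [|x _]; first by rewrite Rintegral_cst// mul0r.
  have Hd s : (derivable (fun s => f (cons_rV s x)) s 1 <->
      derivable f (cons_rV s x) (Defs.basis ord0)) /\
      'D_1 (fun s => f (cons_rV s x)) s = 'D_(Defs.basis ord0) f (cons_rV s x).
    by apply: derivable_along => h; rewrite -cons_rV_shift0 [h *: 1]mulr1.
  have cF : continuous (fun s => f (cons_rV s x)).
    by move=> s; apply: continuous_comp; [exact: continuous_cons_rVl|exact: cf].
  rewrite /Rintegral (@continuous_FTC2 _ _ (fun s => f (cons_rV s x)))//=.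
  (* The two endpoints differ by an integer vector, so periodicity identifies their values. *)
  - have -> : cons_rV 1 x = cons_rV 0 x + map_mx intr (\row_j (j == ord0)%:R) :> 'rV[R]_n.+1.
      apply: cons_rV_eq; first by rewrite mxE cons_rV0 !mxE eqxx add0r.
      by move=> j; rewrite mxE cons_rVS !mxE /= addr0.
    by rewrite pf subrr.
  - apply: continuous_subspaceT => s.
    exact: (@continuous_comp _ _ _ (fun s => cons_rV s x) _ s (@continuous_cons_rVl _ _ x s) (cdf _)).
  - split => [s _||]; first by apply/(Hd s).1; exact: df.
      exact: cvg_at_right_filter (cF 0).
    exact: cvg_at_left_filter (cF 1).
  - by move=> s _; rewrite derive1E (Hd s).2.
rewrite (torus_integral_cons1 mdf dfM).
rewrite (@eq_Rintegral _ _ _ _ _ (cst 0)) => [|s _]; first by rewrite Rintegral_cst// mul0r.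
have Hd x : (derivable (fun x => f (cons_rV s x)) x (Defs.basis j) <->
      derivable f (cons_rV s x) (Defs.basis (lift ord0 j))) /\
      'D_(Defs.basis j) (fun x => f (cons_rV s x)) x =
      'D_(Defs.basis (lift ord0 j)) f (cons_rV s x).
  by apply: derivable_along => h; rewrite -cons_rV_shiftS.
rewrite -[RHS](IH (fun x => f (cons_rV s x)) j).
- by apply: eq_Rintegral => x _; rewrite (Hd x).2.
- move=> x k; have -> : cons_rV s (x + map_mx intr k) =
    cons_rV s x + map_mx intr (\row_j (if unlift ord0 j is Some j' then k ord0 j' else 0)) :> 'rV[R]_n.+1.
    apply: cons_rV_eq; first by rewrite mxE cons_rV0 !mxE unlift_none addr0.
    by move=> l; rewrite mxE cons_rVS !mxE liftK.
  exact: pf.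
- by move=> x; apply: continuous_comp; [exact: continuous_cons_rVr|exact: cf].
- by move=> x; apply/(Hd x).1; exact: df.
- rewrite (_ : 'D_(Defs.basis j) _ = fun x => 'D_(Defs.basis (lift ord0 j)) f (cons_rV s x)).
    move=> x; exact: (@continuous_comp _ _ _ (cons_rV s) _ x (@continuous_cons_rVr _ _ s x) (cdf _)).
  by apply/funext => x; rewrite (Hd x).2.
Qed.

End torus_integration_by_parts.

Definition torus_smooth {R : realType} {n : nat} (f : 'rV[R]_n -> R) : Prop :=
  torus_periodic f /\ Coo f.

Section torus_smooth_theory.
Context {R : realType} {n : nat}.
Implicit Types f g : 'rV[R]_n -> R.
Local Notation vol := (torus_measure R n).

Lemma torus_smooth_bounded f : torus_smooth f ->
  exists2 M, 0 <= M & forall x, `|f x| <= M.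
Proof. by move=> [pf Cf]; apply: periodic_bounded => //; exact: Coo_continuous. Qed.

Lemma torus_smooth_measurable f : torus_smooth f -> measurable_fun setT f.
Proof. by move=> [_ Cf]; apply: measurable_continuous_rV; exact: Coo_continuous. Qed.

Lemma torus_smooth_integrable f : torus_smooth f -> vol.-integrable setT (EFin \o f).
Proof.
move=> sf; have [M _ fM] := torus_smooth_bounded sf.
exact: bounded_integrable (torus_smooth_measurable sf) fM.
Qed.

Lemma torus_smoothD f g : torus_smooth f -> torus_smooth g ->
  torus_smooth (fun x => f x + g x).
Proof.
move=> [pf Cf] [pg Cg]; split => [x k|m]; first by rewrite pf pg.
by apply: CkD; [exact: Cf|exact: Cg].
Qed.

Lemma torus_smoothM f g : torus_smooth f -> torus_smooth g ->
  torus_smooth (fun x => f x * g x).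
Proof.
move=> [pf Cf] [pg Cg]; split => [x k|m]; first by rewrite pf pg.
by apply: CkM; [exact: Cf|exact: Cg].
Qed.

Lemma torus_smooth_cst (c : R) : torus_smooth (fun _ : 'rV[R]_n => c).
Proof. by split => // m; exact: Ck_cst. Qed.

Lemma torus_smooth_comp (g : R -> R) f : Coo g -> torus_smooth f ->
  torus_smooth (fun x => g (f x)).
Proof.
move=> Cg [pf Cf]; split => [x k|m]; first by rewrite pf.
by apply: Ck_comp; [exact: Cg|exact: Cf].
Qed.

Lemma torus_smooth_sum (I : Type) (s : seq I) (P : pred I) (F : I -> 'rV[R]_n -> R) :
  (forall i, P i -> torus_smooth (F i)) ->
  torus_smooth (fun x => \sum_(i <- s | P i) F i x).
Proof.
move=> sF; split => [x k|m]; last by apply: Ck_sum => i /sF[_ /(_ m)].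
by apply: eq_bigr => i /sF[pF _]; rewrite pF.
Qed.

Lemma torus_smooth_prod (I : Type) (s : seq I) (P : pred I) (F : I -> 'rV[R]_n -> R) :
  (forall i, P i -> torus_smooth (F i)) ->
  torus_smooth (fun x => \prod_(i <- s | P i) F i x).
Proof.
move=> sF; split => [x k|m]; last by apply: Ck_prod => i /sF[_ /(_ m)].
by apply: eq_bigr => i /sF[pF _]; rewrite pF.
Qed.

Lemma torus_smooth_derive f v : torus_smooth f -> torus_smooth ('D_v f).
Proof. by move=> [pf Cf]; split; [exact: derive_periodic|exact: Coo_derive]. Qed.

Lemma torus_smooth_is_derive f v x : torus_smooth f -> is_derive x v f ('D_v f x).
Proof. by move=> [_ Cf]; apply/derivableP; exact: Coo_derivable. Qed.

Lemma torus_smooth_integral_derive f i : torus_smooth f ->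
  \int[vol]_x 'D_(Defs.basis i) f x = 0.
Proof.
move=> [pf Cf]; apply: torus_integral_derive => //.
- exact: Coo_continuous.
- by move=> x; exact: Coo_derivable.
- exact/Coo_continuous/Coo_derive.
Qed.

Lemma torus_by_parts f g i : torus_smooth f -> torus_smooth g ->
  \int[vol]_x (f x * 'D_(Defs.basis i) g x) = - \int[vol]_x ('D_(Defs.basis i) f x * g x).
Proof.
move=> sf sg; have := torus_smooth_integral_derive i (torus_smoothM sf sg).
under eq_Rintegral => x _.
  rewrite (@derive_val _ _ _ _ _ _ _ (is_deriveM (torus_smooth_is_derive (Defs.basis i) x sf)
     (torus_smooth_is_derive (Defs.basis i) x sg))).
  rewrite /GRing.scale/= [X in _ + X]mulrC; over.
rewrite RintegralD//; first by move=> /eqP; rewrite addr_eq0 => /eqP.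
- by apply: torus_smooth_integrable; apply: torus_smoothM => //; exact: torus_smooth_derive.
- by apply: torus_smooth_integrable; apply: torus_smoothM => //; exact: torus_smooth_derive.
Qed.

(** Any point is reached from 0 by moving along one axis at a time, and [f] is constant along each
    of these moves. *)
Lemma derive_basis0_cst f : Coo f -> (forall i x, 'D_(Defs.basis i) f x = 0) ->
  forall x, f x = f 0.
Proof.
move=> Cf Df.
have line i x h : f (h *: Defs.basis i + x) = f x.
  pose F (h : R) := f (h *: Defs.basis i + x).
  have dF (t : R) : is_derive t 1 F 0.
    have [H1 H2] : (derivable F t 1 <-> derivable f (t *: Defs.basis i + x) (Defs.basis i)) /\
       'D_1 F t = 'D_(Defs.basis i) f (t *: Defs.basis i + x).
      by apply: derivable_along => k; rewrite /F [k *: 1]mulr1 scalerDl addrA.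
    by split; [apply/H1; exact: Coo_derivable|rewrite H2 Df].
  have := @is_derive_0_is_cst _ F h 0 dF.
  by rewrite /F scale0r add0r.
move=> x; rewrite (row_sum_delta x); elim: (index_enum _) => [|i s IH].
  by rewrite big_nil.
by rewrite big_cons line.
Qed.

End torus_smooth_theory.

(** * The trigonometric functions behind the kernel *)

Section trigonometry.
Context {R : realType}.
Add Field Rfield : (fcar_field R).

Lemma periodicz (f : R -> R) (T : R) : periodic f T ->
  forall (m : int) a, f (a + T * m%:~R) = f a.
Proof.
move=> fT [k|k] a; rewrite mulrzr; first exact: periodicn.
by rewrite NegzE mulrNz -(periodicn fT k.+1 (a - _)) subrK.
Qed.

Lemma is_derive_coord n (i : 'I_n) (x v : 'rV[R]_n) :
  is_derive x v (fun x : 'rV[R]_n => x ord0 i) (v ord0 i).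
Proof.
have [H1 H2] : (derivable (fun x : 'rV[R]_n => x ord0 i) x v <->
    derivable (fun t : R => t) (x ord0 i) (v ord0 i)) /\
    'D_v (fun x : 'rV[R]_n => x ord0 i) x = 'D_(v ord0 i) (fun t : R => t) (x ord0 i).
  by apply: derivable_along => h; rewrite !mxE.
split; first by apply/H1; exact: derivable_id.
by rewrite H2 derive_id.
Qed.

Lemma Coo_coord n (i : 'I_n) : Coo (fun x : 'rV[R]_n => x ord0 i).
Proof.
case=> [|m]; first by split => // x; exact: coord_continuous.
apply: (@CkS R 'rV[R]_n m (fun x : 'rV[R]_n => x ord0 i) (fun v _ : 'rV[R]_n => v ord0 i)) => [v x|x|v].
- exact: is_derive_coord.
- exact: coord_continuous.
- exact: Ck_cst.
Qed.

Lemma Coo_sin_cos : Coo (@sin R) /\ Coo (@cos R).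
Proof.
suff H m : Ck m (@sin R) /\ Ck m (@cos R) by split => m; case: (H m).
elim: m => [|m [IHs IHc]].
  by split; split => //; [exact: continuous_sin|exact: continuous_cos].
split; first exact: (CooS1 (fun x => is_derive_sin x)).
by apply: (CooS1 (fun x => is_derive_cos x)); exact: CkN.
Qed.

(** The functions 1, cos and sin of 2 pi s. They split 1 + cos(2 pi (s - t)) into a sum of three
    products of a function of [s] and one of [t] ([sum_wave]), which is why smearing has finite
    rank. *)
Definition wave (a : 'I_3) (s : R) : R :=
  if a == ord0 then 1 else if a == ord_max then sin (pi *+ 2 * s) else cos (pi *+ 2 * s).

Lemma sum_wave (s t : R) :
  \sum_(a < 3) wave a s * wave a t = 1 + cos (pi *+ 2 * (s - t)).
Proof.
rewrite !big_ord_recl big_ord0 /wave/= mulr1 addr0 mulrBr cosB.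
by [].
Qed.

Lemma torus_smooth_wave n (i : 'I_n) a :
  torus_smooth (fun x : 'rV[R]_n => wave a (x ord0 i)).
Proof.
have C2pi : Coo (fun x : 'rV[R]_n => pi *+ 2 * x ord0 i).
  by move=> m; apply: CkZ; exact: Coo_coord.
have [Cs Cc] := Coo_sin_cos.
rewrite /wave; case: (a == ord0); first exact: torus_smooth_cst.
case: (a == ord_max); split => [x k|m].
- by rewrite !mxE mulrDr periodicz//; exact: sinD2pi.
- by apply: Ck_comp; [exact: Cs|exact: C2pi].
- by rewrite !mxE mulrDr periodicz//; exact: cosD2pi.
- by apply: Ck_comp; [exact: Cc|exact: C2pi].
Qed.

End trigonometry.

(** * Integrable and square-integrable functions *)

Section integrable_functions.
Context {d : measure_display} {T : measurableType d} {R : realType}.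
Variable P : {measure set T -> \bar R}.
Implicit Types f g : T -> R.

Lemma integrable_measurable f : P.-integrable setT (EFin \o f) -> measurable_fun setT f.
Proof. by move=> /measurable_int/measurable_EFinP. Qed.

Lemma integrable_le f g : measurable_fun setT f -> (forall x, `|f x| <= g x) ->
  P.-integrable setT (EFin \o g) -> P.-integrable setT (EFin \o f).
Proof.
move=> mf fg Ig; apply: (le_integrable measurableT _ _ Ig).
  exact/measurable_EFinP.
move=> x _ /=; rewrite lee_fin (le_trans (fg x))//; exact: ler_norm.
Qed.

Lemma integrable_funD f g : P.-integrable setT (EFin \o f) ->
  P.-integrable setT (EFin \o g) -> P.-integrable setT (EFin \o (fun x => f x + g x)).
Proof. by move=> If Ig; have := integrableD measurableT If Ig. Qed.

Lemma integrable_funB f g : P.-integrable setT (EFin \o f) ->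
  P.-integrable setT (EFin \o g) -> P.-integrable setT (EFin \o (fun x => f x - g x)).
Proof. by move=> If Ig; have := integrableB measurableT If Ig. Qed.

Lemma integrable_funZ (c : R) f : P.-integrable setT (EFin \o f) ->
  P.-integrable setT (EFin \o (fun x => c * f x)).
Proof. by move=> If; have := integrableZl measurableT c If. Qed.

Lemma integrable_fun_sum (I : Type) (s : seq I) (F : I -> T -> R) :
  (forall i, P.-integrable setT (EFin \o F i)) ->
  P.-integrable setT (EFin \o (fun x => \sum_(i <- s) F i x)).
Proof.
move=> IF; elim: s => [|i s IH].
  under [X in _.-integrable _ (_ \o X)]eq_fun do rewrite big_nil.
  exact: integrable0.
under [X in _.-integrable _ (_ \o X)]eq_fun do rewrite big_cons.
exact: integrable_funD.
Qed.

Lemma Rintegral_sum (I : Type) (s : seq I) (F : I -> T -> R) :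
  (forall i, P.-integrable setT (EFin \o F i)) ->
  \int[P]_x (\sum_(i <- s) F i x) = \sum_(i <- s) \int[P]_x F i x.
Proof.
move=> IF; elim: s => [|i s IH].
  under eq_Rintegral do rewrite big_nil.
  by rewrite big_nil Rintegral_cst// mul0r.
under eq_Rintegral do rewrite big_cons.
by rewrite big_cons RintegralD// ?IH//; exact: integrable_fun_sum.
Qed.

Lemma integrable_bounded_mul f g (M : R) : P.-integrable setT (EFin \o f) ->
  measurable_fun setT g -> (forall x, `|g x| <= M) ->
  P.-integrable setT (EFin \o (fun x => f x * g x)).
Proof.
move=> If mg gM.
apply: (@integrable_le _ (fun x => M * `|f x|)).
- by apply: measurable_funM => //; exact: integrable_measurable.
- by move=> x; rewrite normrM mulrC ler_wpM2r.
- by apply: integrable_funZ; exact: (integrable_abse If).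
Qed.

End integrable_functions.

Section square_integrable.
Context {d : measure_display} {T : measurableType d} {R : realType}.
Variable P : probability T R.
Add Field Rfield : (fcar_field R).
Implicit Types f g : T -> R.

Definition sq_integrable f : Prop :=
  measurable_fun setT f /\ P.-integrable setT (EFin \o (fun x => f x ^+ 2)).

Lemma integrable_fun_cst (c : R) : P.-integrable setT (EFin \o (fun _ : T => c)).
Proof. by apply: (@bounded_integrable _ _ _ P (fun=> c) `|c|) => // x. Qed.

Lemma Rintegral_fun_cst (c : R) : \int[P]_(_ in setT) c = c.
Proof.
rewrite Rintegral_cst// [X in fine X](_ : _ = 1%E) ?mulr1//; exact: probability_setT.
Qed.

Lemma young (e a b : R) : 0 < e -> `|a * b| <= e / 2 * a ^+ 2 + (2 * e)^-1 * b ^+ 2.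
Proof.
move=> e0; rewrite normrM -[a ^+ 2]real_normK ?num_real// -[b ^+ 2]real_normK ?num_real//.
set x := `|a|; set y := `|b|.
have en0 : e <> 0 by apply/eqP; rewrite gt_eqF.
rewrite -subr_ge0 (_ : _ - _ = (2 * e)^-1 * (e * x - y) ^+ 2); last by ffield.
by rewrite mulr_ge0 ?sqr_ge0// invr_ge0 mulr_ge0// ltW.
Qed.

Lemma sq_integrable_mul f g : sq_integrable f -> sq_integrable g ->
  P.-integrable setT (EFin \o (fun x => f x * g x)).
Proof.
move=> [mf If] [mg Ig].
apply: (@integrable_le _ _ _ P _ (fun x => 1 / 2 * f x ^+ 2 + (2 * 1)^-1 * g x ^+ 2)).
- exact: measurable_funM.
- by move=> x; exact: young.
- by apply: integrable_funD; exact: integrable_funZ.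
Qed.

Lemma sq_integrable_bounded f (M : R) : measurable_fun setT f ->
  (forall x, `|f x| <= M) -> sq_integrable f.
Proof.
move=> mf fM; split => //.
apply: (@bounded_integrable _ _ _ P _ (M ^+ 2)) => [|x].
  exact: measurable_funX.
by rewrite normrX ler_sqr ?nnegrE// (le_trans _ (fM x)).
Qed.

Lemma sq_integrable_cst (c : R) : sq_integrable (fun=> c).
Proof. by apply: (@sq_integrable_bounded _ `|c|). Qed.

Lemma sq_integrable_integrable f : sq_integrable f -> P.-integrable setT (EFin \o f).
Proof.
move=> sf; have := sq_integrable_mul sf (sq_integrable_cst 1).
by under [X in _.-integrable _ (_ \o X)]eq_fun do rewrite mulr1.
Qed.

Lemma sq_integrableD f g : sq_integrable f -> sq_integrable g ->
  sq_integrable (fun x => f x + g x).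
Proof.
move=> sf sg; split; first by apply: measurable_funD; [exact: sf.1|exact: sg.1].
rewrite (_ : (fun x => _) = fun x => f x ^+ 2 + (2 * (f x * g x) + g x ^+ 2)); last first.
  by apply/funext => x; fring.
apply: integrable_funD; first exact: sf.2.
by apply: integrable_funD; [apply: integrable_funZ; exact: sq_integrable_mul|exact: sg.2].
Qed.

Lemma sq_integrable_bounded_mul f g (M : R) : sq_integrable f ->
  measurable_fun setT g -> (forall x, `|g x| <= M) ->
  sq_integrable (fun x => f x * g x).
Proof.
move=> [mf If] mg gM; split; first exact: measurable_funM.
under [X in _.-integrable _ (_ \o X)]eq_fun do rewrite exprMn.
apply: (@integrable_bounded_mul _ _ _ _ _ _ (M ^+ 2)) => // [|x]; first exact: measurable_funX.
by rewrite normrX ler_sqr ?nnegrE// (le_trans _ (gM x)).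
Qed.

Lemma sq_integrableZ (c : R) f : sq_integrable f -> sq_integrable (fun x => c * f x).
Proof.
move=> sf; under eq_fun do rewrite mulrC.
by apply: (@sq_integrable_bounded_mul _ _ `|c|).
Qed.

Lemma sq_integrableN f : sq_integrable f -> sq_integrable (fun x => - f x).
Proof.
by move=> sf; under eq_fun do rewrite -mulN1r; exact: sq_integrableZ.
Qed.

Lemma sq_integrableB f g : sq_integrable f -> sq_integrable g ->
  sq_integrable (fun x => f x - g x).
Proof. by move=> sf sg; apply: sq_integrableD => //; exact: sq_integrableN. Qed.

Lemma sq_integrable_sum (I : Type) (s : seq I) (F : I -> T -> R) :
  (forall i, sq_integrable (F i)) -> sq_integrable (fun x => \sum_(i <- s) F i x).
Proof.
move=> IF; elim: s => [|i s IH].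
  under eq_fun do rewrite big_nil; exact: sq_integrable_cst.
by under eq_fun do rewrite big_cons; exact: sq_integrableD.
Qed.

Definition sqnorm f : R := \int[P]_x (f x ^+ 2).

Lemma sqnorm_ge0 f : 0 <= sqnorm f.
Proof. by apply: Rintegral_ge0 => x _; rewrite sqr_ge0. Qed.

Lemma sqnormD f g : sq_integrable f -> sq_integrable g ->
  sqnorm (fun x => f x + g x) <= 2 * sqnorm f + 2 * sqnorm g.
Proof.
move=> sf sg; rewrite /sqnorm -!RintegralZl//; [|exact: sg.2|exact: sf.2].
rewrite -RintegralD//; [|exact: (integrable_funZ _ sf.2)|exact: (integrable_funZ _ sg.2)].
apply: le_Rintegral => //.
- exact: (sq_integrableD sf sg).2.
- by apply: integrable_funD; [exact: (integrable_funZ _ sf.2)|exact: (integrable_funZ _ sg.2)].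
- move=> x _; rewrite -subr_ge0.
  rewrite (_ : _ - _ = (f x - g x) ^+ 2) ?sqr_ge0//; fring.
Qed.

Lemma Rintegral_young (e : R) f g : 0 < e -> sq_integrable f -> sq_integrable g ->
  `|\int[P]_x (f x * g x)| <= e / 2 * sqnorm f + (2 * e)^-1 * sqnorm g.
Proof.
move=> e0 sf sg; rewrite /sqnorm -!RintegralZl//; [|exact: sg.2|exact: sf.2].
rewrite -RintegralD//; [|exact: (integrable_funZ _ sf.2)|exact: (integrable_funZ _ sg.2)].
apply: (le_trans (le_normr_Rintegral _ _)) => //; first exact: sq_integrable_mul.
apply: le_Rintegral => //.
- exact: integrable_abse (sq_integrable_mul sf sg).
- by apply: integrable_funD; [exact: (integrable_funZ _ sf.2)|exact: (integrable_funZ _ sg.2)].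
- by move=> x _; exact: young.
Qed.

Lemma Rintegral_sqr_le f : sq_integrable f -> (\int[P]_x f x) ^+ 2 <= sqnorm f.
Proof.
move=> sf; set m := \int[P]_x f x.
have If := sq_integrable_integrable sf.
have : 0 <= \int[P]_x (f x - m) ^+ 2 by apply: Rintegral_ge0 => x _; exact: sqr_ge0.
under eq_Rintegral => x _.
  rewrite (_ : (f x - m) ^+ 2 = f x ^+ 2 + ((- 2 * m) * f x + m ^+ 2)); last fring.
  over.
rewrite RintegralD//; [|exact: sf.2|].
  rewrite RintegralD//; [|exact: integrable_funZ|exact: integrable_fun_cst].
  rewrite RintegralZl// Rintegral_fun_cst -/m -/(sqnorm f).
  by rewrite (_ : _ + _ = sqnorm f - m ^+ 2) ?subr_ge0//; fring.
by apply: integrable_funD; [exact: integrable_funZ|exact: integrable_fun_cst].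
Qed.

End square_integrable.

(** * A nonnegative trigonometric kernel of finite rank, concentrating on the diagonal *)

Section trigonometric_kernel.
Context {R : realType} {d : nat}.
Variable n : nat.
Add Field Rfield : (fcar_field R).
Local Notation vol := (torus_measure R d).
Local Notation point := 'rV[R]_d.

Definition waves (j : {ffun 'I_d * 'I_n -> 'I_3}) (x : point) : R :=
  \prod_(k : 'I_d * 'I_n) wave (j k) (x ord0 k.1).

Definition bump (i : 'I_d) (x y : point) : R := 1 + cos (pi *+ 2 * (x ord0 i - y ord0 i)).

(** Since 1 + cos(2 pi s) is twice the square of cos(pi s), this is, up to a constant factor, the
    tensor product of de la Vallee-Poussin kernels of order [n] at x - y. Distributing the product
    over its factors [bump] gives the [waves], indexed by one choice of [wave] for each coordinate
    and each of the [n] factors ([raw_kernelE]). *)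
Definition raw_kernel (x y : point) : R := \prod_(i < d) bump i x y ^+ n.

Lemma raw_kernelE x y : raw_kernel x y = \sum_j waves j x * waves j y.
Proof.
rewrite /raw_kernel; under [RHS]eq_bigr do rewrite -big_split.
rewrite -(bigA_distr_bigA (fun (k : 'I_d * 'I_n) a => wave a (x ord0 k.1) * wave a (y ord0 k.1))).
under [RHS]eq_bigr do rewrite sum_wave.
rewrite -(pair_big predT predT (fun i _ => bump i x y))/=.
by apply: eq_bigr => i _; rewrite prodr_const card_ord.
Qed.

Lemma torus_smooth_waves j : torus_smooth (waves j).
Proof. by apply: torus_smooth_prod => k _; exact: torus_smooth_wave. Qed.

Lemma bump_ge0 i x y : 0 <= bump i x y.
Proof. by rewrite /bump addrC -lerBlDr sub0r cos_geN1. Qed.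

Lemma raw_kernel_ge0 x y : 0 <= raw_kernel x y.
Proof. by apply: prodr_ge0 => i _; rewrite exprn_ge0// bump_ge0. Qed.

Lemma raw_kernelC x y : raw_kernel x y = raw_kernel y x.
Proof. by rewrite !raw_kernelE; apply: eq_bigr => j _; rewrite mulrC. Qed.

Lemma raw_kernel_shift x y z : raw_kernel (z + x) y = raw_kernel x (y - z).
Proof.
apply: eq_bigr => i _; rewrite /bump !mxE; congr ((1 + cos (_ * _)) ^+ _).
by rewrite opprB addrCA addrA.
Qed.

Lemma torus_smooth_kernel x : torus_smooth (raw_kernel x).
Proof.
rewrite (_ : raw_kernel x = fun y => \sum_j waves j x * waves j y); last first.
  by apply/funext => y; rewrite raw_kernelE.
apply: torus_smooth_sum => j _; apply: torus_smoothM; first exact: torus_smooth_cst.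
exact: torus_smooth_waves.
Qed.

Lemma derive_opp_dir (f : point -> R) v x : Coo f -> 'D_(- v) f x = - 'D_v f x.
Proof.
move=> Cf; rewrite derive_dir [in RHS]derive_dir.
pose F (h : R) := f (h *: v + x).
have dF : derivable F (0 : R) 1 by apply: (derivable_dir f x v).1; exact: Coo_derivable.
have -> : (fun h : R => f (h *: - v + x)) = (fun h => F (- h)).
  by apply/funext => h; rewrite /F scalerN scaleNr.
have dF0 : is_derive (- (0 : R)) 1 F ('D_1 F 0) by rewrite oppr0; exact/derivableP.
have := @is_derive_comp R R F (fun h => - h) 0 1 _ _ dF0 (is_deriveN (is_derive_id (0 : R) (1 : R))).
by move=> /@derive_val ->; rewrite mulrN1.
Qed.

Lemma derive_waves_sum v x (a : {ffun 'I_d * 'I_n -> 'I_3} -> R) :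
  'D_v (fun x => \sum_j a j * waves j x) x = \sum_j a j * 'D_v (waves j) x.
Proof.
have H s : is_derive x v (fun x => \sum_(j <- s) a j * waves j x)
    (\sum_(j <- s) a j * 'D_v (waves j) x).
  elim: s => [|j s IH].
    rewrite big_nil (_ : (fun x => _) = cst 0); first exact: is_derive_cst.
    by apply/funext => y; rewrite big_nil.
  rewrite big_cons (_ : (fun x => _) =
    (a j \*: waves j) + (fun x => \sum_(j <- s) a j * waves j x)); last first.
    by apply/funext => y; rewrite big_cons.
  apply: is_deriveD; apply: is_deriveZ.
  exact/torus_smooth_is_derive/torus_smooth_waves.
exact: (@derive_val _ _ _ _ _ _ _ (H _)).
Qed.

(** The kernel depends on x - y only, so moving [x] along [v] amounts to moving [y] along [- v]. *)
Lemma derive_kernel v x y :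
  \sum_j 'D_v (waves j) x * waves j y = - \sum_j waves j x * 'D_v (waves j) y.
Proof.
transitivity ('D_v (raw_kernel ^~ y) x).
  rewrite (_ : raw_kernel ^~ y = fun x => \sum_j waves j y * waves j x); last first.
    by apply/funext => z; rewrite raw_kernelE; apply: eq_bigr => j _; rewrite mulrC.
  by rewrite derive_waves_sum; apply: eq_bigr => j _; rewrite mulrC.
transitivity ('D_(- v) (raw_kernel x) y).
  apply: (derivable_along _).2 => h; rewrite raw_kernel_shift scalerN.
  by rewrite addrC.
rewrite derive_opp_dir; last by case: (torus_smooth_kernel x).
rewrite (_ : raw_kernel x = fun y => \sum_j waves j x * waves j y) ?derive_waves_sum//.
by apply/funext => z; rewrite raw_kernelE.
Qed.

Definition kernel_mass : R := \int[vol]_y raw_kernel 0 y.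

Let int_kernelE x : \int[vol]_y raw_kernel x y = \sum_j waves j x * \int[vol]_y waves j y.
Proof.
under eq_Rintegral do rewrite raw_kernelE.
rewrite Rintegral_sum => [|j]; last first.
  by apply: integrable_funZ; exact/torus_smooth_integrable/torus_smooth_waves.
apply: eq_bigr => j _; rewrite RintegralZl//.
exact/torus_smooth_integrable/torus_smooth_waves.
Qed.

(** The mass is a smooth function of [x] whose derivatives vanish: a derivative in [x] is minus a
    derivative in [y] ([derive_kernel]), which integrates to 0 over the torus. This replaces an
    appeal to translation invariance of the measure. *)
Lemma integral_kernel x : \int[vol]_y raw_kernel x y = kernel_mass.
Proof.
rewrite /kernel_mass.
apply: (@derive_basis0_cst _ _ (fun x => \int[vol]_y raw_kernel x y)) => [m|i z].
  rewrite (_ : (fun x => _) = fun x => \sum_j (\int[vol]_y waves j y) * waves j x); last first.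
    by apply/funext => z; rewrite int_kernelE; apply: eq_bigr => j _; rewrite mulrC.
  by apply: Ck_sum => j _; apply: CkZ; case: (torus_smooth_waves j) => _ /(_ m).
rewrite (_ : (fun x => _) = fun x => \sum_j (\int[vol]_y waves j y) * waves j x); last first.
  by apply/funext => w; rewrite int_kernelE; apply: eq_bigr => j _; rewrite mulrC.
rewrite derive_waves_sum.
transitivity (\int[vol]_y (\sum_j 'D_(Defs.basis i) (waves j) z * waves j y)).
  rewrite Rintegral_sum => [|j]; last first.
    by apply: integrable_funZ; exact/torus_smooth_integrable/torus_smooth_waves.
  apply: eq_bigr => j _; rewrite RintegralZl 1?mulrC//.
  exact/torus_smooth_integrable/torus_smooth_waves.
under eq_Rintegral do rewrite derive_kernel -sumrN.
have Iw j := torus_smooth_integrable (torus_smooth_derive (Defs.basis i) (torus_smooth_waves j)).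
under eq_Rintegral => y _ do under eq_bigr => j _ do rewrite -mulNr.
rewrite Rintegral_sum => [|j]; last exact: integrable_funZ.
apply: big1 => j _; rewrite RintegralZl// torus_smooth_integral_derive ?mulr0//.
exact: torus_smooth_waves.
Qed.

(** Averaging the constant mass over [x] as well turns it into a sum of squares, and the index whose
    factors are all 1 contributes 1. *)
Lemma kernel_mass_gt0 : 0 < kernel_mass.
Proof.
have -> : kernel_mass = \sum_j (\int[vol]_y waves j y) ^+ 2.
  rewrite -(@Rintegral_fun_cst _ _ R vol kernel_mass).
  under eq_Rintegral => x _ do rewrite -(integral_kernel x) int_kernelE.
  under eq_Rintegral => x _ do under eq_bigr => j _ do rewrite mulrC.
  have Iw j := torus_smooth_integrable (torus_smooth_waves j).
  rewrite Rintegral_sum => [|j]; last exact: integrable_funZ.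
  by apply: eq_bigr => j _; rewrite RintegralZl// expr2.
rewrite (bigD1 [ffun=> ord0])//= ltr_pwDl//; last by apply: sumr_ge0 => j _; exact: sqr_ge0.
rewrite (_ : waves _ = fun=> 1) ?Rintegral_fun_cst ?expr1n//.
by apply/funext => x; rewrite /waves big1// => k _; rewrite ffunE /wave eqxx.
Qed.

Definition kernel (x y : point) : R := kernel_mass^-1 * raw_kernel x y.

Lemma kernel_ge0 x y : 0 <= kernel x y.
Proof. by rewrite mulr_ge0 ?raw_kernel_ge0// invr_ge0 ltW// kernel_mass_gt0. Qed.

Lemma kernelC x y : kernel x y = kernel y x.
Proof. by rewrite /kernel raw_kernelC. Qed.

Lemma torus_smooth_kernel1 x : torus_smooth (kernel x).
Proof. by apply: torus_smoothM; [exact: torus_smooth_cst|exact: torus_smooth_kernel]. Qed.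

Lemma integral_kernel1 x : \int[vol]_y kernel x y = 1.
Proof.
rewrite RintegralZl//; last exact/torus_smooth_integrable/torus_smooth_kernel.
by rewrite integral_kernel mulVf// gt_eqF// kernel_mass_gt0.
Qed.

Lemma is_derive_phase (h dh : R -> R) i (x y : point) :
  (forall t : R, is_derive t 1 h (dh t)) ->
  is_derive y (Defs.basis i) (fun y : point => h (pi *+ 2 * (x ord0 i - y ord0 i)))
    (dh (pi *+ 2 * (x ord0 i - y ord0 i)) * - (pi *+ 2)).
Proof.
move=> hdh; apply: (@is_derive_comp _ _ h (fun y : point => pi *+ 2 * (x ord0 i - y ord0 i))).
have H := is_deriveB (is_derive_cst (x ord0 i) y (Defs.basis i))
  (is_derive_coord i y (Defs.basis i)).
have H2 := is_deriveZ (pi *+ 2) H.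
apply: (is_derive_eq H2).
by rewrite !mxE !eqxx sub0r /GRing.scale/= mulrN1.
Qed.

Lemma torus_smooth_phase (h : R -> R) i (x : point) : Coo h -> periodic h (pi *+ 2) ->
  torus_smooth (fun y : point => h (pi *+ 2 * (x ord0 i - y ord0 i))).
Proof.
move=> Ch ph; split => [y k|m].
  by rewrite !mxE opprD addrA mulrBr -mulrN -intrN periodicz.
apply: (Ck_comp (g := h)); first exact: Ch.
apply: CkZ; apply: CkD; first exact: Ck_cst.
by apply: CkN; exact: Coo_coord.
Qed.

(** Write [t] for 2 pi (x_i - y_i). The derivative of sin t (1 + cos t)^n is (1 + cos t)^n (1 -
    (n+1)(1 - cos t)). Multiplied by the factors of the other coordinates, which do not depend on
    y_i, it is up to a constant a derivative in y_i of a periodic function, so its integral is 0: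
    the mass equals n+1 times the spread. *)
Lemma raw_kernel_spread i x :
  n.+1%:R * \int[vol]_y (raw_kernel x y * (1 - cos (pi *+ 2 * (x ord0 i - y ord0 i)))) =
  kernel_mass.
Proof.
have [Cs Cc] := @Coo_sin_cos R.
pose h (t : R) := sin t * (1 + cos t) ^+ n.
pose dh (t : R) := (1 + cos t) ^+ n * (cos t - n%:R * (1 - cos t)).
have dhE (t : R) : is_derive t 1 h (dh t).
  have H1 := is_deriveD (is_derive_cst (1 : R) t 1) (is_derive_cos t).
  have H := is_deriveM (is_derive_sin t) (is_deriveX n H1).
  rewrite (_ : h = sin * (cst 1 + cos) ^+ n); last first.
    by apply/funext => s; rewrite /h mulrfctE exprfctE.
  apply: (is_derive_eq H); rewrite /GRing.scale/= /dh !fctE.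
  case: (n) => [|m]; first by rewrite !expr0; set c := cos t; set s := sin t; fring.
  rewrite [m.+1.-1]/= !exprS.
  transitivity ((1 + cos t) * (1 + cos t) ^+ m * cos t -
    m.+1%:R * (1 + cos t) ^+ m * (sin t * sin t)).
    by set c := cos t; set s := sin t; set a := (1 + c) ^+ m; set N := m.+1%:R; fring.
  rewrite -expr2 sin2cos2.
  by set c := cos t; set a := (1 + c) ^+ m; set N := m.+1%:R; fring.
have Ch : Coo h.
  move=> m; apply: CkM; first exact: Cs.
  elim: (n) => [|k IH]; first exact: Ck_cst.
  under eq_fun do rewrite exprS.
  by apply: CkM => //; apply: CkD; [exact: Ck_cst|exact: Cc].
have ph : periodic h (pi *+ 2) by move=> t; rewrite /h sinD2pi cosD2pi.
pose Q (y : point) := \prod_(j < d | j != i) bump j x y ^+ n.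
have sb j : torus_smooth (bump j x).
  apply: (@torus_smooth_phase (fun t => 1 + cos t)) => [m|t].
    by apply: CkD; [exact: Ck_cst|exact: Cc].
  by rewrite cosD2pi.
have sQ : torus_smooth Q.
  apply: torus_smooth_prod => j _.
  elim: (n) => [|k IH]; first exact: torus_smooth_cst.
  by under eq_fun do rewrite exprS; exact: torus_smoothM.
have dQ y : is_derive y (Defs.basis i) Q 0.
  have [H1 H2] : (derivable Q y (Defs.basis i) <-> derivable (fun _ : R => Q y) 0 1) /\
     'D_(Defs.basis i) Q y = 'D_1 (fun _ : R => Q y) (0 : R).
    apply: derivable_along => t; apply: eq_bigr => j ji.
    by rewrite /bump line_coord (negbTE ji) mulr0 add0r.
  by split; [apply/H1; exact: derivable_cst|rewrite H2 derive_cst].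
have sh := torus_smooth_phase i x Ch ph.
have := torus_smooth_integral_derive i (torus_smoothM sh sQ).
have E y : 'D_(Defs.basis i) (fun y : point => h (pi *+ 2 * (x ord0 i - y ord0 i)) * Q y) y =
  - (pi *+ 2) * (raw_kernel x y +
    (- n.+1%:R) * (raw_kernel x y * (1 - cos (pi *+ 2 * (x ord0 i - y ord0 i))))).
  have := is_deriveM (is_derive_phase i x y dhE) (dQ y).
  move=> /@derive_val ->; rewrite /GRing.scale/= mulr0 add0r /dh.
  rewrite /raw_kernel (bigD1 i)//= -/(Q y) /bump -[n.+1%:R]natr1.
  set c := cos _; set a := (1 + c) ^+ n; set q := Q y; set N := n%:R; set p := pi *+ 2.
  by fring.
under eq_Rintegral do rewrite E.
have s1 := torus_smooth_kernel x.
have s2 : torus_smooth (fun y => raw_kernel x y * (1 - cos (pi *+ 2 * (x ord0 i - y ord0 i)))).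
  apply: torus_smoothM => //.
  apply: (@torus_smooth_phase (fun t => 1 - cos t)) => [m|t].
    by apply: CkD; [exact: Ck_cst|apply: CkN; exact: Cc].
  by rewrite cosD2pi.
have I1 := torus_smooth_integrable s1; have I2 := torus_smooth_integrable s2.
rewrite RintegralZl//; last by apply: integrable_funD => //; exact: integrable_funZ.
rewrite RintegralD//; last exact: integrable_funZ.
rewrite RintegralZl// integral_kernel => /eqP.
rewrite mulf_eq0 oppr_eq0 mulrn_eq0/= gt_eqF ?pi_gt0//= mulNr subr_eq0 => /eqP <-.
by [].
Qed.

Lemma kernel_spread i x :
  \int[vol]_y (kernel x y * (1 - cos (pi *+ 2 * (x ord0 i - y ord0 i)))) = n.+1%:R^-1.
Proof.
have s2 : torus_smooth (fun y => raw_kernel x y * (1 - cos (pi *+ 2 * (x ord0 i - y ord0 i)))).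
  apply: torus_smoothM; first exact: torus_smooth_kernel.
  apply: (@torus_smooth_phase (fun t => 1 - cos t)) => [m|t].
    by apply: CkD; [exact: Ck_cst|apply: CkN; case: (@Coo_sin_cos R)].
  by rewrite cosD2pi.
under eq_Rintegral do rewrite -mulrA.
rewrite RintegralZl//; last exact: torus_smooth_integrable.
have := raw_kernel_spread i x; set I := Rintegral _ _ _ => /esym mE.
have n0 : n.+1%:R != 0 :> R by rewrite pnatr_eq0.
have m0 : kernel_mass != 0 by rewrite gt_eqF ?kernel_mass_gt0.
by apply: (mulfI m0); rewrite mulrA divff// mul1r [in RHS]mE mulrC mulrA mulVf// mul1r.
Qed.

End trigonometric_kernel.

(** * Smearing: convolution with the kernel *)

Section smearing.
Context {R : realType} {d : nat}.
Variable n : nat.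
Add Field Rfield : (fcar_field R).
Local Notation vol := (torus_measure R d).
Local Notation point := 'rV[R]_d.
Local Notation sqi := (sq_integrable vol).
Local Notation w := (@waves R d n).
Local Notation K := (@kernel R d n).
Local Notation c := (@kernel_mass R d n)^-1.
Local Notation L1 f := (vol.-integrable setT (EFin \o f)).
Implicit Types f g : point -> R.

(** The convolution with [kernel] ([smearE]), written as a finite combination of waves: it is
    visibly smooth for any [f], and depends on [f] only through finitely many moments, whose
    evolution in time is a finite system. *)
Definition smear f (x : point) : R :=
  c * \sum_j w j x * \int[vol]_y (f y * w j y).

Let L1w f j : L1 f -> L1 (fun y => f y * w j y).
Proof.
move=> If; have sw : torus_smooth (w j) := torus_smooth_waves j; have [M _ wM] := torus_smooth_bounded sw.
by apply: (@integrable_bounded_mul _ _ _ _ _ _ M) => //; exact: torus_smooth_measurable.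
Qed.

Let L1K f x : L1 f -> L1 (fun y => f y * K x y).
Proof.
move=> If; have sw := torus_smooth_kernel1 n x; have [M _ wM] := torus_smooth_bounded sw.
by apply: (@integrable_bounded_mul _ _ _ _ _ _ M) => //; exact: torus_smooth_measurable.
Qed.

Lemma smearE f x : L1 f -> smear f x = \int[vol]_y (f y * K x y).
Proof.
move=> If; rewrite /smear.
under eq_bigr => j _.
  rewrite -RintegralZl//; last exact: L1w.
  over.
rewrite -Rintegral_sum => [|j]; last by apply: integrable_funZ; exact: L1w.
rewrite -RintegralZl//; last first.
  by apply: integrable_fun_sum => j; apply: integrable_funZ; exact: L1w.
apply: eq_Rintegral => y _; rewrite /kernel raw_kernelE [RHS]mulrCA [in RHS]mulr_sumr.
by congr (_ * _); apply: eq_bigr => j _; rewrite mulrCA.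
Qed.

Lemma torus_smooth_smear f : torus_smooth (smear f).
Proof.
apply: torus_smoothM; first exact: torus_smooth_cst.
apply: torus_smooth_sum => j _; apply: torus_smoothM; last exact: torus_smooth_cst.
exact: torus_smooth_waves.
Qed.

Lemma derive_smear f v x :
  'D_v (smear f) x = c * \sum_j 'D_v (w j) x * \int[vol]_y (f y * w j y).
Proof.
rewrite (_ : smear f = fun x => \sum_j (c * \int[vol]_y (f y * w j y)) * w j x); last first.
  apply/funext => z; rewrite /smear mulr_sumr; apply: eq_bigr => j _.
  by rewrite mulrAC mulrA.
rewrite derive_waves_sum mulr_sumr; apply: eq_bigr => j _.
by rewrite mulrAC mulrA.
Qed.

(* Smearing commutes with derivatives because the kernel is a function of x - y. *)
Lemma derive_smear_weak f g i : L1 f -> L1 g ->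
  (forall psi, torus_smooth psi ->
    \int[vol]_x (f x * 'D_(Defs.basis i) psi x) = - \int[vol]_x (g x * psi x)) ->
  'D_(Defs.basis i) (smear f) = smear g.
Proof.
move=> If Ig fg; apply/funext => x; rewrite derive_smear /smear; congr (_ * _).
have sw j : torus_smooth (w j) := torus_smooth_waves j.
have L1dw j : L1 (fun y => f y * 'D_(Defs.basis i) (w j) y).
  have sdw := torus_smooth_derive (Defs.basis i) (sw j).
  have [M _ wM] := torus_smooth_bounded sdw.
  by apply: (@integrable_bounded_mul _ _ _ _ _ _ M) => //; exact: torus_smooth_measurable.
transitivity (\int[vol]_y (f y * \sum_j 'D_(Defs.basis i) (w j) x * w j y)).
  under [RHS]eq_Rintegral do rewrite mulr_sumr.
  under [RHS]eq_Rintegral => y _ do under eq_bigr => j _ do rewrite mulrCA.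
  rewrite Rintegral_sum => [|j]; last by apply: integrable_funZ; exact: L1w.
  by apply: eq_bigr => j _; rewrite RintegralZl//; exact: L1w.
under eq_Rintegral do rewrite derive_kernel mulrN -mulNr mulr_sumr.
under eq_Rintegral => y _ do under eq_bigr => j _ do rewrite mulNr mulrCA -mulNr.
rewrite Rintegral_sum => [|j]; last exact: integrable_funZ.
apply: eq_bigr => j _; rewrite RintegralZl// fg//.
by rewrite mulrNN.
Qed.

(** Both sides are the same symmetric bilinear form in the moments of [f] and [g]. *)
Lemma smear_adjoint f g : L1 f -> L1 g ->
  \int[vol]_x (smear f x * g x) = \int[vol]_x (f x * smear g x).
Proof.
have H f' g' : L1 f' -> L1 g' -> \int[vol]_x (smear f' x * g' x) =
    \sum_j c * (\int[vol]_y (f' y * w j y) * \int[vol]_y (g' y * w j y)).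
  move=> If Ig.
  transitivity (\int[vol]_x (\sum_j (c * \int[vol]_y (f' y * w j y)) * (g' x * w j x))).
    apply: eq_Rintegral => x _; rewrite /smear mulr_sumr mulr_suml.
    apply: eq_bigr => j _; set a := \int[vol]_y _; set b := w j x; set e := g' x.
    by rewrite -!mulrA; congr (_ * _); rewrite mulrCA [b * e]mulrC.
  rewrite Rintegral_sum => [|j]; last by apply: integrable_funZ; exact: L1w.
  by apply: eq_bigr => j _; rewrite RintegralZl ?mulrA//; exact: L1w.
move=> If Ig; rewrite H//; under [RHS]eq_Rintegral do rewrite mulrC.
by rewrite H//; apply: eq_bigr => j _; congr (_ * _); rewrite mulrC.
Qed.

Lemma smear_cst (a : R) x : smear (fun=> a) x = a.
Proof.
rewrite smearE; last exact: integrable_fun_cst.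
rewrite RintegralZl//; last exact/torus_smooth_integrable/torus_smooth_kernel1.
by rewrite integral_kernel1 mulr1.
Qed.

Lemma smearD f g x : L1 f -> L1 g -> smear (fun y => f y + g y) x = smear f x + smear g x.
Proof.
move=> If Ig; rewrite !smearE//; last exact: integrable_funD.
under eq_Rintegral do rewrite mulrDl.
by rewrite RintegralD//; exact: L1K.
Qed.

Lemma smearZ (a : R) f x : L1 f -> smear (fun y => a * f y) x = a * smear f x.
Proof.
move=> If; rewrite !smearE//; last exact: integrable_funZ.
under eq_Rintegral do rewrite -mulrA.
by rewrite RintegralZl//; exact: L1K.
Qed.

Lemma smearB f g x : L1 f -> L1 g -> smear (fun y => f y - g y) x = smear f x - smear g x.
Proof.
move=> If Ig; rewrite -mulN1r -smearZ// -smearD//; last exact: integrable_funZ.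
by congr (smear _ _); apply/funext => y; rewrite mulN1r.
Qed.

Lemma smear_le f g x : L1 f -> L1 g -> (forall y, f y <= g y) -> smear f x <= smear g x.
Proof.
move=> If Ig fg; rewrite !smearE//; apply: le_Rintegral => //; [exact: L1K|exact: L1K|].
by move=> y _; rewrite ler_wpM2r// kernel_ge0.
Qed.

Lemma smear_bound f (M : R) x : measurable_fun setT f -> (forall y, `|f y| <= M) ->
  `|smear f x| <= M.
Proof.
move=> mf fM; have If := bounded_integrable vol mf fM.
rewrite ler_norml; apply/andP; split.
  rewrite -(smear_cst (- M) x); apply: smear_le => // [|y]; first exact: integrable_fun_cst.
  by have := fM y; rewrite ler_norml => /andP[].
rewrite -[leRHS](smear_cst M x); apply: smear_le => // [|y]; first exact: integrable_fun_cst.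
by have := fM y; rewrite ler_norml => /andP[].
Qed.

(** Jensen's inequality for the probability density [kernel]: smear the nonnegative function (f -
    m)^2, where m is the value of [smear f] at [x]. *)
Lemma smear_sqr_le f x : sqi f -> smear f x ^+ 2 <= smear (fun y => f y ^+ 2) x.
Proof.
move=> sf; have If := sq_integrable_integrable sf.
set m := smear f x.
have I2 : L1 (fun y => f y ^+ 2) by exact: sf.2.
have := @smear_le (fun=> 0) (fun y => f y ^+ 2 + ((- (2 * m)) * f y + m ^+ 2)) x.
rewrite smear_cst smearD//; last first.
  by apply: integrable_funD; [exact: integrable_funZ|exact: integrable_fun_cst].
rewrite smearD//; [|exact: integrable_funZ|exact: integrable_fun_cst].
rewrite smearZ// smear_cst -/m.
rewrite (_ : - (2 * m) * m + m ^+ 2 = - (m ^+ 2)); last by fring.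
rewrite subr_ge0; apply; first exact: integrable_fun_cst.
  apply: integrable_funD => //.
  by apply: integrable_funD; [exact: integrable_funZ|exact: integrable_fun_cst].
move=> y; rewrite (_ : _ + _ = (f y - m) ^+ 2) ?sqr_ge0//.
by set a := f y; fring.
Qed.

Lemma sq_integrable_smear f : sqi (smear f).
Proof.
have sS := torus_smooth_smear f; have [M _ SM] := torus_smooth_bounded sS.
exact: sq_integrable_bounded (torus_smooth_measurable sS) SM.
Qed.

(** Integrate the pointwise Jensen inequality and move the smearing onto the constant 1, which it
    fixes. *)
Lemma sqnorm_smear f : sqi f -> sqnorm vol (smear f) <= sqnorm vol f.
Proof.
move=> sf; apply: (@le_trans _ _ (\int[vol]_x (smear (fun y => f y ^+ 2) x))).
  apply: le_Rintegral => //.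
  - exact: (sq_integrable_smear f).2.
  - exact/torus_smooth_integrable/torus_smooth_smear.
  - by move=> x _; exact: smear_sqr_le.
under eq_Rintegral do rewrite -[smear _ _]mulr1.
rewrite smear_adjoint//; [|exact: sf.2|exact: integrable_fun_cst].
by under eq_Rintegral do rewrite smear_cst mulr1.
Qed.

(** By Jensen, the squared error at [x] is at most the kernel average of (f - f(x))^2. The
    hypothesis bounds this by the average of 1 - cos over the [d] coordinates, each of which is
    1/(n+1) by [kernel_spread]. *)
Lemma smear_close f (M L : R) : measurable_fun setT f -> (forall x, `|f x| <= M) ->
  (forall x y, (f x - f y) ^+ 2 <=
    L * \sum_(i < d) (1 - cos (pi *+ 2 * (x ord0 i - y ord0 i)))) ->
  forall x, (smear f x - f x) ^+ 2 <= L * d%:R * n.+1%:R^-1.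
Proof.
move=> mf fM fL x.
have sfi := sq_integrable_bounded vol mf fM.
have If := sq_integrable_integrable sfi.
have sB : sqi (fun y => f y - f x).
  by apply: sq_integrableD => //; exact: sq_integrable_cst.
rewrite -[f x in leLHS](smear_cst (f x) x) -smearB//; last exact: integrable_fun_cst.
apply: le_trans (smear_sqr_le x sB) _.
have sphase i : torus_smooth (fun y : point => 1 - cos (pi *+ 2 * (x ord0 i - y ord0 i))).
  apply: (@torus_smooth_phase _ _ (fun t => 1 - cos t)) => [m|t].
    by apply: CkD; [exact: Ck_cst|apply: CkN; case: (@Coo_sin_cos R)].
  by rewrite cosD2pi.
have Iphase i := torus_smooth_integrable (sphase i).
have Isum : L1 (fun y => L * \sum_(i < d) (1 - cos (pi *+ 2 * (x ord0 i - y ord0 i)))).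
  by apply: integrable_funZ; exact: integrable_fun_sum.
apply: le_trans (smear_le x sB.2 Isum _) _.
  by move=> y; rewrite -sqrrN opprB.
rewrite smearZ; last exact: integrable_fun_sum.
rewrite smearE; last exact: integrable_fun_sum.
under eq_Rintegral do rewrite mulr_suml.
rewrite Rintegral_sum => [|i]; last exact: L1K.
under eq_bigr => i _.
  under eq_Rintegral do rewrite mulrC.
  rewrite kernel_spread; over.
by rewrite sumr_const card_ord -mulrA mulr_natl.
Qed.

End smearing.

(** * Density in L^2 of the functions that are Lipschitz for the chordal distance *)

Section dominated_Rintegral.
Context {d : measure_display} {T : measurableType d} {R : realType}.

Lemma dominated_Rintegral (mu : {measure set T -> \bar R}) (D : set T)
    (f_ : nat -> T -> R) (f g : T -> R) : measurable D ->
  (forall k, measurable_fun D (f_ k)) -> measurable_fun D f ->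
  {ae mu, forall x, D x -> f_ k x @[k --> \oo] --> f x} ->
  mu.-integrable D (EFin \o g) ->
  {ae mu, forall x k, D x -> `|f_ k x| <= g x} ->
  \int[mu]_(x in D) f_ k x @[k --> \oo] --> \int[mu]_(x in D) f x.
Proof.
move=> mD mf_ mf ff Ig fg.
have [] := @dominated_convergence _ _ _ mu D mD (fun k => EFin \o f_ k) (EFin \o f) (EFin \o g).
- by move=> k; exact/measurable_EFinP.
- exact/measurable_EFinP.
- by apply: filterS ff => x fx Dx; apply: cvg_EFin; [exact: nearW|exact: fx].
- exact: Ig.
- by apply: filterS fg => x fx k Dx /=; rewrite lee_fin; exact: fx.
move=> If _ cf; rewrite /Rintegral; apply: fine_cvg.
by rewrite fineK//; exact: integrable_fin_num.
Qed.

Variable P : probability T R.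

Lemma sqnorm_dominated (f_ : nat -> T -> R) (f g : T -> R) :
  (forall k, measurable_fun setT (f_ k)) -> measurable_fun setT f ->
  {ae P, forall x, f_ k x @[k --> \oo] --> f x} ->
  sq_integrable P g -> (forall k x, `|f x - f_ k x| <= g x) ->
  sqnorm P (fun x => f x - f_ k x) @[k --> \oo] --> 0.
Proof.
move=> mf_ mf ff sg fg.
rewrite -(@Rintegral_fun_cst _ _ _ P 0).
apply: (@dominated_Rintegral P setT (fun k x => (f x - f_ k x) ^+ 2) (fun=> 0) (fun x => g x ^+ 2)) => //.
- by move=> k; apply: measurable_funX; exact: measurable_funB.
- apply: filterS ff => x fx _.
  rewrite (_ : 0 = (f x - f x) ^+ 2); last by rewrite subrr expr0n.
  by under eq_fun do rewrite expr2; rewrite expr2; apply: cvgM; apply: cvgB => //; exact: cvg_cst.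
- exact: sg.2.
- apply: aeW => x k _; rewrite normrX ler_sqr ?nnegrE//.
  by rewrite (le_trans _ (fg k x)).
Qed.

End dominated_Rintegral.

Section torus_coordinates.
Context {R : realType}.
Local Notation mu := (@lebesgue_measure R).

Lemma torus_measure_coord n (i : 'I_n) (B : set (measurableTypeR R)) : measurable B ->
  torus_measure R n [set x | B (x ord0 i)] = uniform_prob (@ltr01 R) B.
Proof.
move=> mB; elim: n i => [[]//|n IH] i.
rewrite /= /pushforward/=.
case: (unliftP ord0 i) => [j|] ->.
  rewrite (_ : _ @^-1` _ = setT `*` [set x : 'rV[R]_n | B (x ord0 j)]); last first.
    apply/seteqP; split => [[s x]|[s x]] /=.
      by rewrite -/(cons_rV s x) cons_rVS.
    by rewrite -/(cons_rV s x) cons_rVS => -[].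
  have mj : measurable [set x : 'rV[R]_n | B (x ord0 j)].
    by have := @measurable_coord _ (measurableTypeR R) n j measurableT _ mB; rewrite setTI.
  rewrite product_measure1E//= IH.
  rewrite [X in (X * _)%E](_ : _ = 1%E) ?mul1e//; exact: probability_setT.
rewrite (_ : _ @^-1` _ = B `*` setT); last first.
  apply/seteqP; split => [[s x]|[s x]] /=.
    by rewrite -/(cons_rV s x) cons_rV0.
  by rewrite -/(cons_rV s x) cons_rV0 => -[].
rewrite product_measure1E//=.
rewrite [X in (_ * X)%E](_ : _ = 1%E) ?mule1//; exact: probability_setT.
Qed.

(** The marginals of the torus measure are uniform on [0, 1] ([torus_measure_coord]), hence do not
    charge the endpoints. *)
Lemma torus_ae_interior n (i : 'I_n) :
  {ae torus_measure R n, forall x : 'rV[R]_n, 0 < x ord0 i < 1}.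
Proof.
pose B : set (measurableTypeR R) := ~` `]0, 1[%classic.
have mB : measurable B by apply: measurableC; exact: measurable_itv.
have mA : measurable [set x : 'rV[R]_n | B (x ord0 i)].
  by have := @measurable_coord _ (measurableTypeR R) n i measurableT _ mB; rewrite setTI.
exists [set x : 'rV[R]_n | B (x ord0 i)]; split => //.
apply: etrans (torus_measure_coord i mB) _.
rewrite -(setIT B) -integral_indic// integral_uniform//; last first.
  exact/measurable_EFinP/measurable_indic.
rewrite integral_indic//.
have : mu (B `&` `[0, 1]) = 0%E.
  apply: countable_lebesgue_measure0.
  apply: (@sub_countable _ _ _ [set 0; 1]); last exact: finite_set_countable.
  apply: subset_card_le => x [] /=; rewrite /B /= !in_itv/=.
  by move=> /negP; rewrite negb_and -!leNgt => /orP[x0|x1] /andP[x0' x1'];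
    [left|right]; apply/eqP; rewrite eq_le; apply/andP.
by move=> muB; rewrite [X in (_ * X)%E](_ : _ = 0%E) ?mule0//.
Qed.

End torus_coordinates.

Section density.
Context {R : realType} {d : nat}.
Add Field Rfield : (fcar_field R).
Local Notation vol := (torus_measure R d).
Local Notation point := 'rV[R]_d.
Local Notation sqi := (sq_integrable vol).
Local Notation nrm := (sqnorm vol).
Implicit Types f g p q : point -> R.

(** Half of the squared chordal distance, each coordinate being seen as a point of the unit circle;
    it is the quantity whose kernel average [kernel_spread] computes. *)
Definition separation (x y : point) : R :=
  \sum_(i < d) (1 - cos (pi *+ 2 * (x ord0 i - y ord0 i))).

Lemma separation_ge0 x y : 0 <= separation x y.
Proof. by apply: sumr_ge0 => i _; rewrite subr_ge0 cos_le1. Qed.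

(* Bounded Lipschitz functions for the chordal distance of the torus. *)
Definition chordal_lipschitz p : Prop := exists M L : R,
  [/\ measurable_fun setT p, 0 <= M, 0 <= L, forall x, `|p x| <= M &
      forall x y, (p x - p y) ^+ 2 <= L * separation x y].

Lemma quarters (e : R) : 2 * (e / 4) + 2 * (e / 4) = e.
Proof. by rewrite -mulrDl -natrD mulrC divfK// pnatr_eq0. Qed.

Lemma sqrD_le (a b : R) : (a + b) ^+ 2 <= 2 * a ^+ 2 + 2 * b ^+ 2.
Proof.
rewrite -subr_ge0 (_ : _ - _ = (a - b) ^+ 2) ?sqr_ge0//; fring.
Qed.

Lemma chordal_lipschitzD p q : chordal_lipschitz p -> chordal_lipschitz q ->
  chordal_lipschitz (fun x => p x + q x).
Proof.
move=> [M [L [mp M0 L0 pM pL]]] [N [K [mq N0 K0 qN qK]]].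
exists (M + N), (2 * L + 2 * K); split.
- exact: measurable_funD.
- exact: addr_ge0.
- by rewrite addr_ge0// mulr_ge0.
- by move=> x; rewrite (le_trans (ler_normD _ _))// lerD.
- move=> x y; rewrite (_ : _ - _ = (p x - p y) + (q x - q y)); last first.
    by set a := p x; set b := q x; fring.
  apply: le_trans (sqrD_le _ _) _; rewrite [leRHS]mulrDl -[X in _ <= X + _]mulrA -[X in _ <= _ + X]mulrA.
  by apply: lerD; rewrite ler_pM2l.
Qed.

Lemma chordal_lipschitzM p q : chordal_lipschitz p -> chordal_lipschitz q ->
  chordal_lipschitz (fun x => p x * q x).
Proof.
move=> [M [L [mp M0 L0 pM pL]]] [N [K [mq N0 K0 qN qK]]].
exists (M * N), (2 * (M ^+ 2 * K) + 2 * (N ^+ 2 * L)); split.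
- exact: measurable_funM.
- exact: mulr_ge0.
- by rewrite addr_ge0// mulr_ge0// mulr_ge0// sqr_ge0.
- by move=> x; rewrite normrM ler_pM.
- move=> x y; rewrite (_ : _ - _ = p x * (q x - q y) + q y * (p x - p y)); last first.
    by set a := p x; set b := q x; set a' := p y; set b' := q y; fring.
  apply: le_trans (sqrD_le _ _) _; rewrite [leRHS]mulrDl -[X in _ <= X + _]mulrA -[X in _ <= _ + X]mulrA.
  have sqM (a b : R) : `|a| <= b -> a ^+ 2 <= b ^+ 2.
    by move=> ab; rewrite -real_normK ?num_real// ler_sqr ?nnegrE// (le_trans _ ab).
  by apply: lerD; rewrite ler_pM2l// exprMn -[leRHS]mulrA; apply: ler_pM; rewrite ?sqr_ge0//; exact: sqM.
Qed.

Lemma chordal_lipschitz_comp (h : R -> R) p (C : R) : 0 <= C ->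
  measurable_fun setT h -> (forall a b, `|h a - h b| <= C * `|a - b|) ->
  chordal_lipschitz p -> chordal_lipschitz (fun x => h (p x)).
Proof.
move=> C0 mh hC [M [L [mp M0 L0 pM pL]]].
exists (`|h 0| + C * M), (C ^+ 2 * L); split.
- exact: measurableT_comp.
- by rewrite addr_ge0// mulr_ge0.
- by rewrite mulr_ge0// sqr_ge0.
- move=> x; rewrite -[h (p x)](subrK (h 0)) addrC (le_trans (ler_normD _ _))// lerD2l.
  by rewrite (le_trans (hC _ _))// subr0 ler_wpM2l.
- move=> x y; rewrite -real_normK ?num_real//.
  apply: (@le_trans _ _ ((C * `|p x - p y|) ^+ 2)).
    by rewrite ler_sqr ?nnegrE// mulr_ge0.
  by rewrite exprMn real_normK ?num_real// -mulrA ler_wpM2l ?sqr_ge0.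
Qed.

Lemma chordal_lipschitz_cst (c : R) : chordal_lipschitz (fun=> c).
Proof.
exists `|c|, 0; split => // x y.
by rewrite subrr expr0n mul0r.
Qed.

Lemma chordal_lipschitz_wave (i : 'I_d) (b : bool) : chordal_lipschitz
  (fun x : point => (if b then cos else sin) (pi *+ 2 * x ord0 i)).
Proof.
exists 1, 2; split => //.
- apply: measurable_continuous_rV; apply: Coo_continuous => m.
  apply: (Ck_comp (g := if b then cos else sin)); first by case: b; case: (@Coo_sin_cos R).
  by apply: CkZ; exact: Coo_coord.
- by move=> x; case: b; [exact: cos_max|exact: sin_max].
- move=> x y; apply: (@le_trans _ _ (2 * (1 - cos (pi *+ 2 * (x ord0 i - y ord0 i))))).
    rewrite [pi *+ 2 * (_ - _)]mulrBr cosB; set a := pi *+ 2 * _; set a' := pi *+ 2 * _.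
    have E : 2 * (1 - (cos a * cos a' + sin a * sin a')) =
        (cos a - cos a') ^+ 2 + (sin a - sin a') ^+ 2.
      have H1 := cos2Dsin2 a; have H2 := cos2Dsin2 a'.
      have -> : 2 * (1 - (cos a * cos a' + sin a * sin a')) =
        (cos a ^+ 2 + sin a ^+ 2) + (cos a' ^+ 2 + sin a' ^+ 2) -
        2 * (cos a * cos a' + sin a * sin a') by rewrite H1 H2; fring.
      by set u := cos a; set v := sin a; set u' := cos a'; set v' := sin a'; fring.
    by rewrite E; case: b; [rewrite lerDl sqr_ge0|rewrite lerDr sqr_ge0].
  rewrite ler_pM2l// /separation (bigD1 i)//= lerDl.
  by apply: sumr_ge0 => j _; rewrite subr_ge0 cos_le1.
Qed.

(** The L^2 closure of the chordal Lipschitz functions, shown below to be all of L^2. *)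
Definition approximable f : Prop := sqi f /\
  forall e : R, 0 < e -> exists2 p, chordal_lipschitz p & nrm (fun x => f x - p x) <= e.

Lemma chordal_lipschitz_sqi p : chordal_lipschitz p -> sqi p.
Proof. by move=> [M [L [mp _ _ pM _]]]; exact: sq_integrable_bounded mp pM. Qed.

Lemma approximable_lipschitz p : chordal_lipschitz p -> approximable p.
Proof.
move=> lp; split; first exact: chordal_lipschitz_sqi.
move=> e e0; exists p => //; rewrite /sqnorm.
under eq_Rintegral do rewrite subrr expr0n/=.
by rewrite Rintegral_fun_cst ltW.
Qed.

Lemma approximable_limit f : sqi f ->
  (forall e : R, 0 < e -> exists2 g, approximable g & nrm (fun x => f x - g x) <= e) ->
  approximable f.
Proof.
move=> sf H; split => // e e0; have e4 : 0 < e / 4 by rewrite divr_gt0.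
have [g [sg ag] fg] := H _ e4; have [p lp gp] := ag _ e4.
exists p => //.
have sp := chordal_lipschitz_sqi lp.
have -> : (fun x => f x - p x) = (fun x => (f x - g x) + (g x - p x)).
  by apply/funext => x; rewrite addrA subrK.
apply: le_trans (sqnormD (sq_integrableB sf sg) (sq_integrableB sg sp)) _.
apply: (@le_trans _ _ (2 * (e / 4) + 2 * (e / 4))); first by rewrite lerD// ler_pM2l.
by rewrite quarters.
Qed.

Lemma approximableD f g : approximable f -> approximable g ->
  approximable (fun x => f x + g x).
Proof.
move=> [sf af] [sg ag]; split; first exact: sq_integrableD.
move=> e e0; have e4 : 0 < e / 4 by rewrite divr_gt0.
have [p lp fp] := af _ e4; have [q lq gq] := ag _ e4.
exists (fun x => p x + q x); first exact: chordal_lipschitzD.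
have sp := chordal_lipschitz_sqi lp; have sq := chordal_lipschitz_sqi lq.
have -> : (fun x => f x + g x - (p x + q x)) = (fun x => (f x - p x) + (g x - q x)).
  by apply/funext => x; rewrite opprD addrACA.
apply: le_trans (sqnormD (sq_integrableB sf sp) (sq_integrableB sg sq)) _.
apply: (@le_trans _ _ (2 * (e / 4) + 2 * (e / 4))); first by rewrite lerD// ler_pM2l.
by rewrite quarters.
Qed.

Lemma sqnorm_bounded_mul f g (M : R) : sqi f -> measurable_fun setT g ->
  (forall x, `|g x| <= M) -> nrm (fun x => f x * g x) <= M ^+ 2 * nrm f.
Proof.
move=> sf mg gM; rewrite /sqnorm -RintegralZl//; last exact: sf.2.
apply: le_Rintegral => //.
- exact: (sq_integrable_bounded_mul sf mg gM).2.
- by apply: integrable_funZ; exact: sf.2.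
- move=> x _; rewrite exprMn mulrC ler_wpM2r ?sqr_ge0//.
  by rewrite -real_normK ?num_real// ler_sqr ?nnegrE// (le_trans _ (gM x)).
Qed.

Lemma approximable_bounded_mul f g (M : R) : approximable f -> approximable g ->
  (forall x, `|g x| <= M) -> approximable (fun x => f x * g x).
Proof.
move=> [sf af] [sg ag] gM.
have M0 : 0 <= M by apply: le_trans (gM 0).
split; first exact: sq_integrable_bounded_mul sf sg.1 gM.
move=> e e0.
have e1 : 0 < e / 4 / (M ^+ 2 + 1) by rewrite !divr_gt0// ltr_wpDl ?sqr_ge0.
have [p lp fp] := af _ e1.
have sp := chordal_lipschitz_sqi lp.
have [N [L [mp N0 L0 pN pL]]] := lp.
(* The second approximation is chosen after the first: its tolerance depends on the bound [N] of
   [p], as fg - pq = (f - p) g + (g - q) p. *)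
have e2 : 0 < e / 4 / (N ^+ 2 + 1) by rewrite !divr_gt0// ltr_wpDl ?sqr_ge0.
have [q lq gq] := ag _ e2.
have sq := chordal_lipschitz_sqi lq.
exists (fun x => p x * q x); first exact: chordal_lipschitzM.
have -> : (fun x => f x * g x - p x * q x) =
    (fun x => (f x - p x) * g x + (g x - q x) * p x).
  by apply/funext => x; set a := f x; set b := g x; set a' := p x; set b' := q x; fring.
have s1 := sq_integrableB sf sp; have s2 := sq_integrableB sg sq.
apply: le_trans (sqnormD (sq_integrable_bounded_mul s1 sg.1 gM)
  (sq_integrable_bounded_mul s2 mp pN)) _.
have key (A r : R) : 0 <= A -> r <= e / 4 / (A ^+ 2 + 1) -> A ^+ 2 * r <= e / 4.
  move=> A0; rewrite ler_pdivlMr ?ltr_wpDl ?sqr_ge0// => H.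
  have [r0|r0] := leP 0 r.
    by apply: le_trans H; rewrite mulrC ler_wpM2l// lerDl.
  apply: (@le_trans _ _ 0); first by rewrite mulr_ge0_le0 ?sqr_ge0// ltW.
  by rewrite divr_ge0// ltW.
apply: (@le_trans _ _ (2 * (e / 4) + 2 * (e / 4))).
  apply: lerD; rewrite ler_pM2l//.
    apply: le_trans (sqnorm_bounded_mul s1 sg.1 gM) _; exact: key.
  apply: le_trans (sqnorm_bounded_mul s2 mp pN) _; exact: key.
by rewrite quarters.
Qed.

Lemma approximableZ (c : R) f : approximable f -> approximable (fun x => c * f x).
Proof.
move=> af; under eq_fun do rewrite mulrC.
by apply: (@approximable_bounded_mul _ _ `|c|) => //; exact/approximable_lipschitz/chordal_lipschitz_cst.
Qed.

End density.

Section density_sets.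
Context {R : realType} {d : nat}.
Add Field Rfield : (fcar_field R).
Local Notation vol := (torus_measure R d).
Local Notation point := 'rV[R]_d.
Local Notation sqi := (sq_integrable vol).
Local Notation nrm := (sqnorm vol).

(** These sets form a sigma-algebra that contains the half-spaces of [approximable_ray], hence every
    measurable set. *)
Definition approximable_set (A : set point) : Prop :=
  measurable A /\ approximable (\1_A : point -> R).

Lemma indic_le1 (A : set point) x : `|\1_A x : R| <= 1.
Proof. by rewrite indicE; case: (_ \in _); rewrite ?normr0 ?normr1. Qed.

Lemma approximable_setC A : approximable_set A -> approximable_set (~` A).
Proof.
move=> [mA aA]; split; first exact: measurableC.
rewrite (_ : \1_(~` A) = (fun x => 1 + (- 1) * (\1_A x : R)) :> (point -> R)).
  apply: approximableD; first exact/approximable_lipschitz/chordal_lipschitz_cst.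
  exact: approximableZ.
apply/funext => x; rewrite !indicE in_setC.
by case: (x \in A); rewrite /= ?mulr1 ?subrr// mulr0 addr0.
Qed.

Lemma approximable_setU A B : approximable_set A -> approximable_set B ->
  approximable_set (A `|` B).
Proof.
move=> [mA aA] [mB aB]; split; first exact: measurableU.
rewrite (_ : \1_(A `|` B) = (fun x => (\1_A x + \1_B x) + (- 1) * (\1_A x * \1_B x) : R)).
  apply: approximableD; first exact: approximableD.
  by apply: approximableZ; apply: (@approximable_bounded_mul _ _ _ _ 1) => //; exact: indic_le1.
apply/funext => x; rewrite !indicE in_setU.
by case: (x \in A); case: (x \in B); rewrite /= ?mulr1 ?mulr0 ?mul0r ?mulr0 ?addr0 ?add0r ?addrK.
Qed.

Lemma approximable_set0 : approximable_set set0.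
Proof.
split => //; rewrite (_ : \1_set0 = (fun=> 0)).
  exact/approximable_lipschitz/chordal_lipschitz_cst.
by apply/funext => x; rewrite indicE in_set0.
Qed.

Lemma approximable_ae_limit (f_ : nat -> point -> R) (f : point -> R) (M : R) :
  (forall k, approximable (f_ k)) -> measurable_fun setT f ->
  (forall x, `|f x| <= M) -> (forall k x, `|f_ k x| <= M) ->
  {ae vol, forall x, f_ k x @[k --> \oo] --> f x} -> approximable f.
Proof.
move=> af mf fM f_M ff.
apply: approximable_limit; first exact: sq_integrable_bounded mf fM.
move=> e e0.
have H : nrm (fun x => f x - f_ k x) @[k --> \oo] --> 0.
  apply: (sqnorm_dominated (g := fun=> M + M)) => //.
  - by move=> k; case: (af k) => -[].
  - exact: sq_integrable_cst.
  - by move=> k x; rewrite (le_trans (ler_normB _ _))// lerD.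
have /cvgr0Pnorm_le/(_ e e0)[k _ /(_ k (leqnn k)) He] := H.
by exists (f_ k); [exact: af|exact: le_trans (ler_norm _) He].
Qed.

Lemma approximable_bigcup (F : nat -> set point) :
  (forall k, approximable_set (F k)) -> approximable_set (\bigcup_k F k).
Proof.
move=> aF; split; first by apply: bigcup_measurable => k _; case: (aF k).
have aB k : approximable_set (\big[setU/set0]_(i < k) F i).
  elim: k => [|k IH]; first by rewrite big_ord0; exact: approximable_set0.
  by rewrite big_ord_recr; exact: approximable_setU.
apply: (@approximable_ae_limit (fun k => \1_(\big[setU/set0]_(i < k) F i)) _ 1).
- by move=> k; case: (aB k).
- apply: measurable_indic; apply: bigcup_measurable => k _; by case: (aF k).
- by move=> x; exact: indic_le1.
- by move=> k x; exact: indic_le1.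
apply: aeW => x; have [[i _ Fx]|nFx] := pselect ((\bigcup_k F k) x).
  rewrite indicE mem_set; last by exists i.
  apply: cvg_near_cst; exists i.+1 => // k /= ik.
  by rewrite indicE mem_set// -bigcup_mkord; exists i.
apply: cvg_near_cst; apply: nearW => k; rewrite !indicE !memNset//.
by rewrite -bigcup_mkord => -[i _ Fx]; apply: nFx; exists i.
Qed.

(** A periodic function with the sign of x_i - a on the open unit cell: it equals 2 sin(pi x_i)
    sin(pi (x_i - a)), and the first sine is positive there. *)
Definition ray_fun (i : 'I_d) (a : R) (x : point) : R :=
  cos (pi * a) - (cos (pi * a) * cos (pi *+ 2 * x ord0 i) + sin (pi * a) * sin (pi *+ 2 * x ord0 i)).

Lemma ray_funE i a x :
  ray_fun i a x = 2 * (sin (pi * x ord0 i) * sin (pi * (x ord0 i - a))).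
Proof.
rewrite /ray_fun -cosB.
set u := pi * x ord0 i; set v := pi * (x ord0 i - a).
have -> : pi * a = u - v by rewrite /u /v mulrBr opprB addrC subrK.
have -> : u - v - pi *+ 2 * x ord0 i = - (u + v).
  by rewrite mulrnAl -/u mulr2n; fring.
by rewrite cosN cosB cosD; set c := cos u * cos v; set s := sin u * sin v; fring.
Qed.

Lemma ray_fun_gt0 i a (x : point) : 0 <= a < 1 -> 0 < x ord0 i < 1 ->
  (0 < ray_fun i a x) = (a < x ord0 i).
Proof.
move=> /andP[a0 a1] /andP[x0 x1].
have pi0 := @pi_gt0 R.
have sx : 0 < sin (pi * x ord0 i).
  by apply: sin_gt0_pi; rewrite mulr_gt0//= -ltr_pdivlMl// mulVf ?gt_eqF.
rewrite ray_funE pmulr_rgt0// pmulr_rgt0//.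
have [ax|xa] := ltP a (x ord0 i).
  apply: sin_gt0_pi; rewrite mulr_gt0 ?subr_gt0//=.
  rewrite -ltr_pdivlMl// mulVf ?gt_eqF// ltrBlDr.
  by rewrite (lt_le_trans x1)// lerDl.
apply/negbTE; rewrite -leNgt -[x ord0 i - a]opprB mulrN sinN oppr_le0.
apply: sin_ge0_pi; apply/andP; split; first by rewrite mulr_ge0 ?subr_ge0// ltW.
rewrite -ler_pdivlMl// mulVf ?gt_eqF// lerBlDr.
by rewrite (le_trans (ltW a1))// lerDl ltW.
Qed.

(** For 0 <= a < 1 the indicator is almost everywhere the limit of [flat 0 (k * r)], with r =
    [ray_fun i a x]: these values are exp(- 1/(k r)) -> 1 when r > 0, and 0 otherwise. For other
    values of [a] the indicator is almost everywhere constant on the unit cell. *)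
Lemma approximable_ray (i : 'I_d) (a : R) : approximable_set [set x | a < x ord0 i].
Proof.
have mray : measurable [set x : point | a < x ord0 i].
  have := @measurable_coord _ (measurableTypeR R) d i measurableT _ (measurable_itv `]a, +oo[).
  rewrite setTI; congr measurable; apply/seteqP; split => x /=;
    by rewrite in_itv/= andbT.
split => //; have mI : measurable_fun setT (\1_[set x : point | a < x ord0 i] : point -> R).
  exact: measurable_indic.
have ae01 := @torus_ae_interior R d i.
have [a0|a0] := ltP a 0.
  apply: (@approximable_ae_limit (fun _ => fun=> 1) _ 1) => //.
  - by move=> _; exact/approximable_lipschitz/chordal_lipschitz_cst.
  - exact: indic_le1.
  - by move=> _ x; rewrite normr1.
  - apply: filterS ae01 => x /andP[x0 x1]; rewrite indicE mem_set; first exact: cvg_cst.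
    exact: lt_trans x0.
have [a1|a1] := leP 1 a.
  apply: (@approximable_ae_limit (fun _ => fun=> 0) _ 1) => //.
  - by move=> _; exact/approximable_lipschitz/chordal_lipschitz_cst.
  - exact: indic_le1.
  - by move=> _ x; rewrite normr0.
  - apply: filterS ae01 => x /andP[x0 x1]; rewrite indicE memNset; first exact: cvg_cst.
    by move=> /= ax; have := lt_le_trans x1 a1; rewrite ltNge (ltW ax).
pose h (k : nat) (s : R) : R := flat 0 (k%:R * s).
have lh k s t : `|h k s - h k t| <= (2 * k%:R) * `|s - t|.
  have dflat (y : R) : is_derive y 1 (flat 0) (flat 2 y).
    by have := is_derive_flat 0 y; rewrite mul0r subr0.
  have bflat (y : R) : `|flat 2 y| <= 2 by rewrite ger0_norm ?flat_ge0// flat_le.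
  apply: le_trans (lipschitz_derive dflat bflat _ _) _.
  by rewrite -mulrBr normrM normr_nat mulrA.
have lray : chordal_lipschitz (ray_fun i a).
  rewrite /ray_fun; apply: chordal_lipschitzD; first exact: chordal_lipschitz_cst.
  rewrite (_ : (fun x => _) = (fun x : point => (- cos (pi * a)) * cos (pi *+ 2 * x ord0 i) +
      (- sin (pi * a)) * sin (pi *+ 2 * x ord0 i))); last first.
    by apply/funext => x; rewrite opprD !mulNr.
  apply: chordal_lipschitzD; apply: chordal_lipschitzM.
  - exact: chordal_lipschitz_cst.
  - exact: chordal_lipschitz_wave i true.
  - exact: chordal_lipschitz_cst.
  - exact: chordal_lipschitz_wave i false.
have h01 k s : 0 <= h k s <= 1.
  by rewrite /h flat_ge0 flat_le.
apply: (@approximable_ae_limit (fun k x => h k (ray_fun i a x)) _ 1) => //.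
- move=> k; apply: approximable_lipschitz.
  apply: (@chordal_lipschitz_comp _ _ (h k) _ (2 * k%:R)) => //.
  apply: continuous_measurable_fun; apply: Coo_continuous.
  move=> m; apply: (Ck_comp (g := flat 0)); first exact: Coo_flat.
  by apply: CkZ; exact: Coo_id.
- exact: indic_le1.
- by move=> k x; have /andP[h0 h1] := h01 k (ray_fun i a x); rewrite ger0_norm.
apply: filterS ae01 => x x01.
have a01 : 0 <= a < 1 by rewrite a0.
have E := ray_fun_gt0 a01 x01.
have [r0|r0] := ltP 0 (ray_fun i a x).
  rewrite indicE mem_set/= -?E//.
  apply/cvgrPdist_le => e e0; near=> k.
  set s := ray_fun i a x in r0 *.
  have k1 : 1 <= k%:R :> R by near: k; exact: nbhs_infty_ger.
  have ks0 : 0 < k%:R * s by rewrite mulr_gt0// (lt_le_trans _ k1).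
  rewrite /h /flat ks0 expr0 mul1r ger0_norm; last first.
    by rewrite subr_ge0 expR_le1 oppr_le0 invr_ge0 ltW.
  apply: (@le_trans _ _ ((k%:R * s)^-1)).
    by rewrite lerBlDl -lerBlDr expR_ge1Dx.
  rewrite invf_ple ?posrE// -ler_pdivrMr//; near: k; exact: nbhs_infty_ger.
rewrite indicE memNset/=; last by rewrite -E => r1; have := lt_le_trans r1 r0; rewrite ltxx.
by apply: cvg_near_cst; apply: nearW => k; rewrite /h flat_le0// mulr_ge0_le0.
Unshelve. all: by end_near. Qed.

Lemma measurable_approximable_set A : measurable A -> approximable_set A.
Proof.
suff : <<s \big[setU/set0]_(i < d) preimage_set_system setT
    (fun x : 'rV[measurableTypeR R]_d => x ord0 i) measurable >> `<=` approximable_set.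
  by apply.
apply: smallest_sub.
  split; [exact: approximable_set0| |exact: approximable_bigcup].
  by move=> B aB; rewrite setTD; exact: approximable_setC.
move=> B; rewrite -bigcup_seq => -[i _ [C mC <-]]; rewrite setTI.
have : (@RGenOInfty.G R).-sigma.-measurable C by rewrite -RGenOInfty.measurableE.
suff : <<s @RGenOInfty.G R >> `<=`
    [set C : set R | approximable_set ((fun x : point => x ord0 i) @^-1` C)] by apply.
apply: smallest_sub.
  split => /=.
  - by rewrite preimage_set0; exact: approximable_set0.
  - by move=> D aD; rewrite setTD preimage_setC; exact: approximable_setC.
  - by move=> F aF; rewrite preimage_bigcup; exact: approximable_bigcup.
move=> _ [a ->]; suff -> : [set C0 : set R | approximable_set ((fun x : point => x ord0 i) @^-1` C0)] `]a, +oo[%classic =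
   approximable_set [set x | a < x ord0 i] by exact: approximable_ray.
congr approximable_set.
by apply/seteqP; split => x /=; rewrite in_itv/= andbT.
Qed.

End density_sets.

(** * Convergence of smearing in L^2 *)

Section smear_convergence.
Context {R : realType} {d : nat}.
Add Field Rfield : (fcar_field R).
Local Notation vol := (torus_measure R d).
Local Notation point := 'rV[R]_d.
Local Notation sqi := (sq_integrable vol).
Local Notation nrm := (sqnorm vol).

Lemma sum_lt_ord (L t : nat) : (t <= L)%N -> \sum_(m < L) (m < t)%:R = t%:R :> R.
Proof.
elim: L => [|L IH]; first by rewrite leqn0 big_ord0 => /eqP ->.
rewrite big_ord_recr/= leq_eqVlt => /predU1P[->|tL].
  rewrite ltnSn (eq_bigr (fun=> 1)) => [|m _]; last by rewrite ltnS ltnW.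
  by rewrite sumr_const card_ord natr1.
by rewrite IH// ltnNge -ltnS tL addr0.
Qed.

Lemma approximable_sum (I : Type) (s : seq I) (F : I -> point -> R) :
  (forall i, approximable (F i)) -> approximable (fun x => \sum_(i <- s) F i x).
Proof.
move=> aF; elim: s => [|i s IH].
  under eq_fun do rewrite big_nil; exact/approximable_lipschitz/chordal_lipschitz_cst.
by under eq_fun do rewrite big_cons; exact: approximableD.
Qed.

(** A staircase approximation: the integer part of (k+1) f, divided by k+1, is within 1/(k+1) of [f]
    and is a finite combination of indicators of superlevel sets. *)
Lemma approximable_ge0_bounded (f : point -> R) (M : R) : measurable_fun setT f ->
  (forall x, 0 <= f x <= M) -> approximable f.
Proof.
move=> mf fM; have M0 : 0 <= M by have /andP[f0 /(le_trans f0)] := fM 0.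
have [N MN] : exists N : nat, M <= N%:R.
  by exists (Num.truncn M).+1; rewrite ltW// truncnS_gt.
have fbd x : `|f x| <= N%:R by have /andP[f0 f1] := fM x; rewrite ger0_norm// (le_trans f1).
apply: approximable_limit; first exact: sq_integrable_bounded mf fbd.
move=> e e0.
have [k ke] : exists k : nat, (k.+1%:R^-1) ^+ 2 <= e.
  have [j je] : exists j : nat, e^-1 <= j%:R.
    by exists (Num.truncn e^-1).+1; rewrite ltW// truncnS_gt.
  exists j; apply: (@le_trans _ _ j.+1%:R^-1).
    by rewrite expr2 ler_piMr// invf_le1// ler1n.
  by rewrite invf_ple ?posrE// (le_trans je)// ler_nat.
pose A m := [set x : point | m.+1%:R <= k.+1%:R * f x].
have mA m : measurable (A m).
  rewrite /A (_ : [set _ | _] = (fun x => k.+1%:R * f x) @^-1` `[m.+1%:R, +oo[); last first.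
    by apply/seteqP; split => x /=; rewrite in_itv/= andbT.
  rewrite -[X in measurable X]setTI; apply: measurable_funM => //.
exists (fun x => k.+1%:R^-1 * \sum_(m < k.+1 * N) \1_(A m) x).
  apply: approximableZ; apply: approximable_sum => m.
  by case: (measurable_approximable_set (mA m)).
rewrite -(Rintegral_fun_cst vol e); apply: le_Rintegral => //.
- apply: (sq_integrableB (sq_integrable_bounded vol mf fbd) _).2.
  apply: sq_integrableZ; apply: sq_integrable_sum => m.
  by case: (measurable_approximable_set (mA m)) => _ [].
- exact: integrable_fun_cst.
move=> x _; apply: le_trans ke.
have /andP[f0 f1] := fM x.
have kf0 : 0 <= k.+1%:R * f x by rewrite mulr_ge0.
have /andP[t1 t2] := truncn_itv kf0; set t := Num.truncn _ in t1 t2.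
have -> : \sum_(m < k.+1 * N) \1_(A m) x = t%:R :> R.
  rewrite -(@sum_lt_ord (k.+1 * N)).
    apply: eq_bigr => m _; rewrite indicE; congr (nat_of_bool _)%:R.
    apply/idP/idP; rewrite inE /A /= => H.
      by rewrite -ltnS -(ltr_nat R) (le_lt_trans H t2).
    by apply: le_trans t1; rewrite ler_nat.
  rewrite -(ler_nat R) (le_trans t1)// natrM ler_pM2l//.
  exact: le_trans f1 MN.
have k0 : 0 < k.+1%:R :> R by [].
have -> : f x - k.+1%:R^-1 * t%:R = k.+1%:R^-1 * (k.+1%:R * f x - t%:R).
  by rewrite mulrBr mulrA mulVf ?gt_eqF// mul1r.
rewrite exprMn ler_piMr ?sqr_ge0// expr_le1// ?subr_ge0//.
by rewrite lerBlDl natr1 ltW.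
Qed.

(** Truncating where |f| > k converges in L^2 by domination, and adding the constant [k] makes the
    truncation nonnegative and bounded. *)
Lemma sq_integrable_approximable (f : point -> R) : sqi f -> approximable f.
Proof.
move=> sf; have [mf If] := sf.
pose A (k : nat) := [set x : point | `|f x| <= k%:R].
have mA k : measurable (A k).
  rewrite /A (_ : [set _ | _] = (fun x => `|f x|) @^-1` `]-oo, k%:R]); last first.
    by apply/seteqP; split => x /=; rewrite in_itv/=.
  by rewrite -[X in measurable X]setTI; apply: measurableT_comp.
have mfA k : measurable_fun setT (fun x => f x * \1_(A k) x).
  by apply: measurable_funM => //; exact: measurable_indic.
apply: approximable_limit => // e e0.
have H : nrm (fun x => f x - f x * \1_(A k) x) @[k --> \oo] --> 0.
  apply: (sqnorm_dominated (g := fun x => `|f x|)) => //.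
  - apply: aeW => x; apply: cvg_near_cst; near=> k.
    rewrite indicE mem_set ?mulr1// /A /=; near: k; exact: nbhs_infty_ger.
  - by split; [exact: measurableT_comp|]; under [X in _.-integrable _ (_ \o X)]eq_fun do rewrite real_normK ?num_real//.
  - move=> k x; rewrite indicE; case: (_ \in _); rewrite ?mulr1 ?subrr ?normr0//.
    by rewrite mulr0 subr0.
have /cvgr0Pnorm_le/(_ e e0)[k _ /(_ k (leqnn k)) He] := H.
exists (fun x => f x * \1_(A k) x); last exact: le_trans (ler_norm _) He.
have fAk x : `|f x * \1_(A k) x| <= k%:R.
  rewrite indicE; case: (boolP (x \in A k)) => [|_]; last by rewrite mulr0 normr0.
  by rewrite inE mulr1.
rewrite (_ : (fun x => _) = fun x => (f x * \1_(A k) x + k%:R) + (- k%:R)); last first.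
  by apply/funext => x; rewrite addrK.
apply: approximableD; last exact/approximable_lipschitz/chordal_lipschitz_cst.
apply: (@approximable_ge0_bounded _ (k%:R + k%:R)) => [|x].
  exact: measurable_funD.
have := fAk x; rewrite ler_norml => /andP[h1 h2].
by rewrite lerD2r h2 andbT -lerBlDr sub0r.
Unshelve. all: by end_near. Qed.

(** Smearing contracts L^2 ([sqnorm_smear]) and is uniformly close to the identity on a chordal
    Lipschitz function ([smear_close]), and such functions are dense. *)
Lemma smear_cvg (f : point -> R) : sqi f ->
  nrm (fun x => smear n f x - f x) @[n --> \oo] --> 0.
Proof.
move=> sf; apply/cvgr0Pnorm_le => e e0.
(* Two nested uses of [sqnormD], each dividing the tolerance by four ([quarters]). *)
have e16 : 0 < e / 4 / 4 by rewrite !divr_gt0.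
have [_ /(_ _ e16)[p lp fp]] := sq_integrable_approximable sf.
have sp := chordal_lipschitz_sqi lp.
have [M [L [mp M0 L0 pM pL]]] := lp.
near=> n.
have sfp := sq_integrableB sf sp.
have If := sq_integrable_integrable sf; have Ip := sq_integrable_integrable sp.
have sS g := sq_integrable_smear n (g : point -> R).
rewrite ger0_norm ?sqnorm_ge0//.
have -> : (fun x => smear n f x - f x) = (fun x => smear n (fun y => f y - p y) x +
    ((smear n p x - p x) + (-1) * (f x - p x))).
  apply/funext => x; rewrite smearB//.
  by set a := smear n f x; set b := smear n p x; set u := f x; set v := p x; fring.
apply: le_trans (sqnormD (sS _) (sq_integrableD (sq_integrableB (sS _) sp) (sq_integrableZ _ sfp))) _.
rewrite -[leRHS]quarters; apply: lerD; rewrite ler_pM2l//.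
  apply: le_trans (sqnorm_smear n sfp) _; apply: le_trans fp _.
  by rewrite ler_piMr ?divr_ge0 ?ltW// invf_lt1// ltr1n.
apply: le_trans (sqnormD (sq_integrableB (sS _) sp) (sq_integrableZ _ sfp)) _.
rewrite -[leRHS]quarters; apply: lerD; rewrite ler_pM2l//; last first.
  rewrite /sqnorm; under eq_Rintegral do rewrite exprMn sqrrN expr1n mul1r.
  exact: fp.
rewrite -(Rintegral_fun_cst vol (e / 4 / 4)); apply: le_Rintegral => //.
- exact: (sq_integrableB (sS _) sp).2.
- exact: integrable_fun_cst.
move=> x _; apply: le_trans (smear_close n mp pM pL x) _.
rewrite ler_pdivrMr// -ler_pdivrMl//.
apply: (@le_trans _ _ n%:R); last by rewrite ler_nat.
near: n; exact: nbhs_infty_ger.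
Unshelve. all: by end_near. Qed.

End smear_convergence.

(** * Primitives in time and functions with quadratic increments *)

Section primitive.
Context {R : realType}.
Add Field Rfield : (fcar_field R).
Local Notation mu := (@lebesgue_measure R).
Local Notation L1 f := (mu.-integrable setT (EFin \o f)).
Implicit Types f g h : R -> R.

Definition prim g (t : R) : R := \int[mu]_(s in `[0, t]) g s.

Lemma integrable_sub f (A : set (measurableTypeR R)) : measurable A -> L1 f ->
  mu.-integrable A (EFin \o f).
Proof. by move=> mA If; apply: integrableS If. Qed.

Lemma primB g (s t : R) : L1 g -> 0 <= s <= t ->
  prim g t - prim g s = \int[mu]_(r in `]s, t]) g r.
Proof.
move=> Ig /andP[s0 st]; rewrite /prim Rintegral_itvB//.
exact: integrable_sub.
Qed.

Lemma prim0 g : prim g 0 = 0.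
Proof. by rewrite /prim set_itv1 Rintegral_set1. Qed.

Lemma prim_continuous g (t : R) : L1 g -> 0 <= t -> {within `[0, t], continuous (prim g)}.
Proof.
move=> Ig t0; apply: parameterized_integral_continuous => //.
exact: integrable_sub.
Qed.

Lemma prim_ge0_nd g (s t : R) : L1 g -> (forall r, 0 <= g r) -> 0 <= s <= t ->
  prim g s <= prim g t.
Proof. by move=> Ig g0 st; rewrite -subr_ge0 primB// Rintegral_ge0. Qed.

Lemma prim_incr_le f g (s t : R) : L1 f -> L1 g -> (forall r, `|f r| <= g r) ->
  0 <= s <= t -> `|prim f t - prim f s| <= prim g t - prim g s.
Proof.
move=> If Ig fg st; rewrite !primB//.
have mst : measurable (`]s, t] : set (measurableTypeR R)) by exact: measurable_itv.
apply: le_trans (le_normr_Rintegral mst (integrable_sub mst If)) _.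
apply: le_Rintegral => //; last exact: integrable_sub.
by apply: (@integrable_sub (fun r => `|f r|)) => //; exact: (integrable_abse If).
Qed.

(* Cut [0, t] at the points where gamma has grown by one N-th of its increment:
   the N errors are then quadratically small. *)
Lemma quadratic_increments (Phi gamma : R -> R) (C t : R) : 0 <= t ->
  {within `[0, t], continuous gamma} ->
  (forall r s, 0 <= r -> r <= s -> s <= t -> gamma r <= gamma s) ->
  (forall r s, 0 <= r -> r <= s -> s <= t ->
    Phi s - Phi r <= C * (gamma s - gamma r) ^+ 2) ->
  Phi t <= Phi 0.
Proof.
move=> t0 cg mg H.
set D := gamma t - gamma 0.
have D0 : 0 <= D by rewrite subr_ge0 mg.
have step (N : nat) (k : nat) : (k <= N.+1)%N -> forall s, 0 <= s <= t ->
    gamma s = gamma 0 + k%:R * (D / N.+1%:R) ->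
    Phi s <= Phi 0 + k%:R * (C * (D / N.+1%:R) ^+ 2).
  elim: k => [_ s /andP[s0 st]|k IH kN s /andP[s0 st]].
    rewrite !mul0r !addr0 => gs; have := H 0 s (lexx _) s0 st.
    by rewrite gs subrr expr0n/= mulr0 subr_le0.
  move=> gs.
  have kd : gamma 0 <= gamma 0 + k%:R * (D / N.+1%:R) <= gamma s.
    rewrite lerDl mulr_ge0 ?divr_ge0//= gs lerD2l ler_wpM2r ?divr_ge0//.
    by rewrite ler_nat.
  have cgs : {within `[0, s], continuous gamma}.
    by apply: continuous_subspaceW cg; apply: subset_itvl; rewrite bnd_simp.
  have gm : gamma 0 <= gamma s by case/andP: kd => /le_trans; apply.
  have [r] : exists2 c, c \in `[0, s] & gamma c = gamma 0 + k%:R * (D / N.+1%:R).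
    by apply: IVT => //; rewrite min_l// max_r.
  rewrite in_itv/= => /andP[r0 rs] gr.
  have := IH (ltnW kN) r _ gr; rewrite r0 (le_trans rs st) => /(_ isT) IHr.
  have := H r s r0 rs st; rewrite gs gr.
  rewrite [X in X ^+ 2](_ : _ = D / N.+1%:R); last first.
    by rewrite -[k.+1%:R]natr1; set a := k%:R; set b := D / _; set c := gamma 0; fring.
  rewrite lerBlDr => /le_trans; apply.
  set E := C * _ ^+ 2 in IHr *.
  have -> : Phi 0 + k.+1%:R * E = E + (Phi 0 + k%:R * E).
    by rewrite -[k.+1%:R]natr1 mulrDl mul1r addrA addrC.
  by rewrite lerD2l.
have fin (N : nat) : Phi t <= Phi 0 + C * D ^+ 2 / N.+1%:R.
  have N0 : N.+1%:R != 0 :> R by rewrite pnatr_eq0.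
  have := step N N.+1 (leqnn _) t; rewrite t0 lexx => /(_ isT).
  rewrite mulrC divfK// /D addrC subrK => /(_ erefl).
  rewrite -/D (_ : N.+1%:R * _ = C * D ^+ 2 / N.+1%:R)//.
  by move: N0 => /eqP; set n := N.+1%:R => N0; ffield.
rewrite -[leRHS]addr0; apply/ler_addgt0Pr => e e0; rewrite addr0.
pose N := Num.truncn (C * D ^+ 2 / e).
apply: le_trans (fin N) _; rewrite lerD2l ler_pdivrMr// [leRHS]mulrC -ler_pdivrMr//.
by rewrite ltW// truncnS_gt.
Qed.

End primitive.

(** * A function with an integrable weak derivative is almost everywhere its primitive *)

Section step_derivative.
Context {R : realType}.

Lemma derive_step_out (y : R) : ~~ (0 <= y <= 1) -> 'D_1 smooth_step y = 0.
Proof.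
rewrite negb_and -!ltNge => /orP[y0|y1].
- rewrite (@near_eq_derive R R R _ (cst 1)) ?derive_cst//.
  near=> z; rewrite step_le0//; near: z.
  by apply: (@filterS _ _ _ _ _ _ (lt_nbhsl y0)) => z; exact: ltW.
- rewrite (@near_eq_derive R R R _ (cst 0)) ?derive_cst//.
  near=> z; rewrite step_ge1//; near: z.
  by apply: (@filterS _ _ _ _ _ _ (lt_nbhsr y1)) => z; exact: ltW.
Unshelve. all: by end_near. Qed.

Lemma derive_step_bounded : exists2 C : R, 0 <= C & forall y, `|'D_1 smooth_step y| <= C.
Proof.
have c1 : continuous ('D_1 (@smooth_step R)).
  by apply: Coo_continuous; apply: Coo_derive; exact: Coo_step.
have cd : continuous (fun y : R => `|'D_1 (@smooth_step R) y|).
  by move=> y; exact: (continuous_comp (c1 y) (@norm_continuous _ _ _)).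
have [c _ Hc] := EVT_max ler01 (continuous_subspaceT cd).
exists (`|'D_1 smooth_step c|); first exact: normr_ge0.
move=> y.
have [y01|/derive_step_out ->] := boolP (0 <= y <= 1); first by apply: Hc; rewrite in_itv.
by rewrite normr0.
Qed.

End step_derivative.

Section weak_primitive.
Context {R : realType}.
Add Field Rfield : (fcar_field R).
Local Notation mu := (@lebesgue_measure R).
Local Notation L1 f := (mu.-integrable setT (EFin \o f)).

Variables (T : R) (h g : R -> R) (h0 : R).
Hypotheses (Ih : L1 h) (Ig : L1 g).
Hypothesis g_out : forall t, ~~ (0 < t < T) -> g t = 0.
Hypothesis weak : forall eta : R -> R, Coo eta ->
  (exists2 T', T' < T & forall t, T' < t -> eta t = 0) ->
  \int[mu]_t (h t * 'D_1 eta t + g t * eta t) + h0 * eta 0 = 0.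

(** It is 1 up to [t] and 0 from t + 1/(k+1) on; minus its derivative is a function of integral 1
    that concentrates to the right of [t]. *)
Let eta (t : R) (k : nat) (s : R) : R := smooth_step (k.+1%:R * (s - t)).

Let Coo_eta t k : Coo (eta t k).
Proof.
move=> m; apply: (Ck_comp (g := smooth_step)); first exact: Coo_step.
by apply: CkZ; apply: CkD; [exact: Coo_id|exact: Ck_cst].
Qed.

Let derive_eta t k s : 'D_1 (eta t k) s = k.+1%:R * 'D_1 smooth_step (k.+1%:R * (s - t)).
Proof.
have H1 := is_deriveB (is_derive_id s 1) (is_derive_cst t s (1 : R)).
have H2 := is_deriveZ (k.+1%:R : R) H1.
have H3 : is_derive (k.+1%:R * (s - t)) 1 smooth_step ('D_1 smooth_step (k.+1%:R * (s - t))).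
  by apply/derivableP; exact: Coo_derivable (@Coo_step R).
have := @is_derive_comp R R smooth_step (fun s => k.+1%:R * (s - t)) s 1 _ _ H3 H2.
by move=> /@derive_val ->; rewrite subr0 /GRing.scale/= mulr1 mulrC.
Qed.

Let eta_le t k s : s <= t -> eta t k s = 1.
Proof. by move=> st; rewrite /eta step_le0// mulr_ge0_le0// subr_le0. Qed.

Let eta_ge t k s : t + k.+1%:R^-1 <= s -> eta t k s = 0.
Proof.
move=> st; rewrite /eta step_ge1// -ler_pdivrMl// mulr1.
by rewrite lerBrDl.
Qed.

Let derive_eta_out t k s : ~~ (t <= s <= t + k.+1%:R^-1) -> 'D_1 (eta t k) s = 0.
Proof.
move=> st; rewrite derive_eta derive_step_out ?mulr0//; apply: contra st.
rewrite pmulr_rge0// subr_ge0 => /andP[-> /=].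
by rewrite -ler_pdivlMl// mulr1 lerBlDl.
Qed.

Let int_derive_eta t k : \int[mu]_s 'D_1 (eta t k) s = - 1.
Proof.
have tk : t < t + k.+1%:R^-1 by rewrite ltrDl.
transitivity (\int[mu]_(s in `[t, t + k.+1%:R^-1]) 'D_1 (eta t k) s).
  rewrite [RHS]Rintegral_mkcond; apply: eq_Rintegral => s _.
  rewrite patchE; case: ifPn => //; rewrite notin_setE/= in_itv/= => /negP.
  exact: derive_eta_out.
have ce : continuous (eta t k) by apply: Coo_continuous; exact: Coo_eta.
have cde : continuous ('D_1 (eta t k)).
  by apply: Coo_continuous; apply: Coo_derive; exact: Coo_eta.
rewrite /Rintegral (@continuous_FTC2 _ ('D_1 (eta t k)) (eta t k) _ _ tk).
- by rewrite /= eta_ge// eta_le// sub0r.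
- exact: continuous_subspaceT.
- split => [s _||]; first exact: Coo_derivable (@Coo_eta t k).
    exact: cvg_at_right_filter (ce _).
  exact: cvg_at_left_filter (ce _).
- by move=> s _; rewrite derive1E.
Qed.

Let derive_eta_bound : exists2 C : R, 0 <= C & forall t k s, `|'D_1 (eta t k) s| <=
  (k.+1%:R * C) * \1_(`[t, t + k.+1%:R^-1]%classic) s.
Proof.
have [C C0 HC] := @derive_step_bounded R; exists C => // t k s.
rewrite indicE; case: (boolP (s \in _)) => [_|].
  by rewrite mulr1 derive_eta normrM normr_nat ler_wpM2l.
by rewrite notin_setE/= in_itv/= => /negP/derive_eta_out ->; rewrite normr0 mulr0.
Qed.

Let derive_eta_measurable t k : measurable_fun [set: R] ('D_1 (eta t k)).
Proof.
apply: continuous_measurable_fun.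
by apply: Coo_continuous; apply: Coo_derive; exact: Coo_eta.
Qed.

Let derive_eta_integrable t k : L1 ('D_1 (eta t k)).
Proof.
have [C C0 HC] := derive_eta_bound.
apply: (@integrable_le _ _ R mu ('D_1 (eta t k)) (fun s : R => (k.+1%:R * C) * \1_(`[t, t + k.+1%:R^-1]%classic) s)).
- exact: derive_eta_measurable.
- by move=> s; exact: HC.
- apply: integrable_funZ; exact: integrable_indic_itv.
Qed.

Let eta_measurable t k : measurable_fun [set: R] (eta t k).
Proof. by apply: continuous_measurable_fun; apply: Coo_continuous; exact: Coo_eta. Qed.

Let eta_bound t k s : `|eta t k s| <= 1.
Proof. by rewrite ger0_norm ?step_ge0// step_le1. Qed.

Let eta_mul_integrable f t k : L1 f -> L1 (fun s => f s * eta t k s).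
Proof.
move=> If; apply: (@integrable_bounded_mul _ _ _ _ _ _ 1) => //.
exact: eta_measurable.
Qed.

Let derive_eta_mul_integrable f t k : L1 f -> L1 (fun s => f s * 'D_1 (eta t k) s).
Proof.
move=> If; have [C C0 HC] := derive_eta_bound.
apply: (@integrable_bounded_mul _ _ _ _ _ _ (k.+1%:R * C)) => //.
  exact: derive_eta_measurable.
move=> s.
by apply: le_trans (HC _ _ _) _; rewrite ler_piMr ?mulr_ge0.
Qed.

Let cvg_primitive t : 0 <= t -> \int[mu]_s (g s * eta t k s) @[k --> \oo] --> prim g t.
Proof.
move=> t0.
have mt : measurable (`[0, t] : set (measurableTypeR R)) by exact: measurable_itv.
rewrite /prim Rintegral_mkcond.
apply: (@dominated_Rintegral _ _ _ mu setT (fun k s => g s * eta t k s) _ (fun s => `|g s|)) => //.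
- by move=> k; apply: integrable_measurable; exact: eta_mul_integrable.
- apply: (measurable_restrict g mt measurableT).1.
  by rewrite setTI; apply: (measurable_funS measurableT) => //; exact: integrable_measurable Ig.
- apply: aeW => s _; rewrite patchE; case: ifPn => [|]; last rewrite notin_setE.
    rewrite inE /= in_itv/= => /andP[s0 st].
    by apply: cvg_near_cst; apply: nearW => k; rewrite eta_le// mulr1.
  rewrite /= in_itv/= => /negP; rewrite negb_and -!ltNge => /orP[s0|ts].
    apply: cvg_near_cst; apply: nearW => k; rewrite g_out ?mul0r//.
    by rewrite negb_and -leNgt ltW.
  apply: cvg_near_cst; near=> k; rewrite eta_ge ?mulr0//.
  rewrite -lerBrDl invf_ple ?posrE ?subr_gt0//.
  apply: (@le_trans _ _ k%:R); last by rewrite ler_nat.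
  near: k; exact: nbhs_infty_ger.
- exact: (integrable_abse Ig).
- by apply: aeW => s k _; rewrite normrM ler_piMr// eta_bound.
Unshelve. all: by end_near. Qed.

(** The derivative of [eta t k] is at most (k+1) [C] on an interval of length 1/(k+1), so the error
    is at most 4 [C] times the mean of |h - h(t)| on a ball around [t], which tends to 0 at a
    Lebesgue point. *)
Let cvg_value t : 0 < t < T -> lebesgue_pt h t ->
  \int[mu]_s (h s * 'D_1 (eta t k) s) @[k --> \oo] --> - h t.
Proof.
move=> t0T pt; have [C C0 HC] := derive_eta_bound.
apply/cvgrPdist_le => e e0.
have C1 : 0 < C + 1 by rewrite ltr_wpDl.
have e4 : 0 < e / (4 * (C + 1)) by rewrite divr_gt0// mulr_gt0.
have /fine_cvgP[_ /cvgr0Pnorm_lt/(_ _ e4)] := pt.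
move=> [r0 /= r00 Hr].
near=> k.
have k0 : 0 < k.+1%:R :> R by [].
(* Twice the length of the support: the ball is open, while the support may contain its endpoint t +
   1/(k+1). *)
pose r : R := 2 / k.+1%:R.
have r_gt0 : 0 < r by rewrite divr_gt0.
have rr0 : r < r0.
  rewrite /r ltr_pdivrMr// -ltr_pdivrMl// mulrC.
  apply: (@lt_trans _ _ k%:R); last by rewrite ltr_nat.
  near: k; exact: nbhs_infty_gtr.
have Hk : `|fine (davg h t r)| < e / (4 * (C + 1)).
  by apply: Hr => //=; rewrite sub0r normrN ger0_norm// ltW.
pose ht (s : R) : R := h s - h t.
have Iht : L1 (fun s => ht s * 'D_1 (eta t k) s).
  rewrite (_ : (fun s => _) = (fun s => h s * 'D_1 (eta t k) s - h t * 'D_1 (eta t k) s)).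
    by apply: integrable_funB; [exact: derive_eta_mul_integrable|exact: integrable_funZ].
  by apply/funext => s; rewrite mulrBl.
have -> : - h t - \int[mu]_s (h s * 'D_1 (eta t k) s) = - \int[mu]_s (ht s * 'D_1 (eta t k) s).
  under [in RHS]eq_Rintegral do rewrite mulrBl.
  rewrite RintegralB//; [|exact: derive_eta_mul_integrable|exact: integrable_funZ].
  by rewrite RintegralZl// int_derive_eta mulrN1 opprB.
rewrite normrN.
have mb : measurable (ball t r : set (measurableTypeR R)) by exact: measurable_ball.
have mub : mu (ball t r) = (r *+ 2)%:E by apply: lebesgue_measure_ball; exact: ltW.
have Ib : mu.-integrable (ball t r) (EFin \o (fun s => `|ht s|)).
  suff Iht' : mu.-integrable (ball t r) (EFin \o ht) by exact: (integrable_abse Iht').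
  apply: (@integrableB _ _ _ mu _ mb (EFin \o h) (EFin \o (fun=> h t))); first exact: integrable_sub.
  apply: measurable_bounded_integrable => //; last exact: bounded_cst.
  by rewrite [X in (X < _)%E](_ : _ = (r *+ 2)%:E) ?ltry.
apply: (@le_trans _ _ ((k.+1%:R * C) * \int[mu]_(s in ball t r) `|ht s|)).
  apply: le_trans (le_normr_Rintegral measurableT Iht) _.
  rewrite [X in _ * X]Rintegral_mkcond.
  have Ir : L1 ((fun s => `|ht s|) \_ (ball t r)).
    rewrite (_ : EFin \o _ = (EFin \o (fun s => `|ht s|)) \_ (ball t r)); last first.
      by rewrite restrict_EFin.
    exact: (integrable_mkcond _ mb).1.
  rewrite -RintegralZl//; apply: le_Rintegral => //.
  - exact: (integrable_abse Iht).
  - exact: integrable_funZ.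
  move=> s _; rewrite normrM mulrC; have [sI|/derive_eta_out ->] := boolP (t <= s <= t + k.+1%:R^-1).
    rewrite patchE mem_set; last first.
      move: sI => /andP[ts st]; rewrite /ball/= distrC ger0_norm ?subr_ge0// ltrBlDl.
      apply: le_lt_trans st _; rewrite ltrD2l /r ltr_pMl ?invr_gt0//.
      by rewrite (_ : 1 = 1%:R)// ltr_nat.
    apply: ler_wpM2r => //; apply: le_trans (HC _ _ _) _.
    by rewrite ler_piMr ?mulr_ge0// indicE; case: (_ \in _).
  rewrite normr0 mul0r mulr_ge0 ?mulr_ge0//.
  by rewrite patchE; case: ifPn.
have Iball : (\int[mu]_(s in ball t r) `|(h s - h t)%:E|)%E = (\int[mu]_(s in ball t r) `|ht s|)%:E.
  by rewrite /Rintegral fineK//; apply: integrable_fin_num.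
have Edavg : fine (davg h t r) = (r *+ 2)^-1 * \int[mu]_(s in ball t r) `|ht s|.
  rewrite /davg /iavg [X in (X^-1 * _)%E](_ : _ = (r *+ 2)%:E)//.
  by rewrite inver mulrn_eq0/= gt_eqF//= Iball.
have I0 : 0 <= \int[mu]_(s in ball t r) `|ht s| by apply: Rintegral_ge0.
move: Hk; rewrite Edavg ger0_norm; last by rewrite mulr_ge0// invr_ge0 mulrn_wge0// ltW.
set I := \int[mu]_(s in _) _ in I0 *.
rewrite ltr_pdivrMl ?mulrn_wgt0// => HI.
apply: (@le_trans _ _ ((k.+1%:R * C) * (r *+ 2 * (e / (4 * (C + 1)))))).
  by rewrite ler_wpM2l ?mulr_ge0// ltW.
have -> : k.+1%:R * C * (r *+ 2 * (e / (4 * (C + 1)))) = e * (C / (C + 1)).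
  rewrite /r invfM; set K := k.+1%:R; set y := (C + 1)^-1; set q := 4^-1.
  have -> : K * C * ((2 / K) *+ 2 * (e * (q * y))) = (K / K) * (4 * q) * (e * (C * y)).
    by set x := K^-1; fring.
  by rewrite !divff ?mul1r ?gt_eqF.
by rewrite ler_piMr ?ltW// ltr_pdivrMr// mul1r ltrDl.
Unshelve. all: by end_near. Qed.

(** At a Lebesgue point [t] of [h] the equation is tested with [eta t k]. As [k] grows, the
    derivative term tends to - h(t), the source term to [prim g t], and the initial term is [h0]
    because [eta t k] is 1 at time 0. *)
Lemma weak_primitive : {ae mu, forall t, 0 < t < T -> h t = h0 + prim g t}.
Proof.
have locI : locally_integrable setT h by apply: open_integrable_locally => //; exact: openT.
move: (lebesgue_differentiation locI); apply: filterS.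
  exact: (ae_filter_ringOfSetsType mu).
move=> t pt t0T.
have /andP[t0 tT] := t0T.
have H1 := cvg_value t0T pt.
have H2 : \int[mu]_s (h s * 'D_1 (eta t k) s) @[k --> \oo] --> - prim g t - h0.
  have : - (\int[mu]_s (g s * eta t k s)) - h0 @[k --> \oo] --> - prim g t - h0.
    by apply: cvgB; [apply: cvgN; exact: cvg_primitive (ltW t0)|exact: cvg_cst].
  apply: cvg_trans; apply: near_eq_cvg; near=> k.
  have := weak (@Coo_eta t k).
  have tkT : t + k.+1%:R^-1 < T.
    rewrite -ltrBrDl invf_plt ?posrE ?subr_gt0//.
    apply: (@lt_trans _ _ k%:R); last by rewrite ltr_nat.
    near: k; exact: nbhs_infty_gtr.
  have H : exists2 T', T' < T & forall s, T' < s -> eta t k s = 0.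
    by exists (t + k.+1%:R^-1) => // s /ltW; exact: eta_ge.
  move=> /(_ H); rewrite eta_le ?ltW// mulr1.
  rewrite RintegralD//; [|exact: derive_eta_mul_integrable|exact: eta_mul_integrable].
  by move=> /eqP; rewrite -addrA addr_eq0 opprD => /eqP ->.
have : - h t = - prim g t - h0 by exact: (cvg_unique _ H1 H2).
by move=> /(congr1 -%R); rewrite opprK opprB opprK.
Unshelve. all: by end_near. Qed.

End weak_primitive.

(** * An energy inequality for finite combinations with absolutely continuous coefficients *)

Section parametrized_integrals.
Context {R : realType} {d : measure_display} {X : measurableType d}.
Variable P : probability X R.

Lemma measurable_Rintegral_snd (f : measurableTypeR R * X -> R) : measurable_fun setT f ->
  measurable_fun [set: measurableTypeR R] (fun t => \int[P]_x f (t, x)).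
Proof.
move=> mf; pose F : measurableTypeR R * X -> \bar R := EFin \o f.
have mF : measurable_fun setT F by exact/measurable_EFinP.
apply: (measurableT_comp (fine_measurable measurableT)).
rewrite (_ : (fun t => _) = (fun t => (\int[P]_x (F^\+ (t, x)) - \int[P]_x (F^\- (t, x)))%E)); last first.
  apply/funext => t; rewrite integralE; congr (_ - _)%E.
    by under eq_integral do rewrite (funepos_comp (EFin \o f) (pair t)).
  by under eq_integral do rewrite (funeneg_comp (EFin \o f) (pair t)).
apply: emeasurable_funB.
- by apply: measurable_fun_fubini_tonelli_F => //; exact: measurable_funepos.
- by apply: measurable_fun_fubini_tonelli_F => //; exact: measurable_funeneg.
Qed.

End parametrized_integrals.

Section chain_rule.
Context {R : realType} {d : nat}.
Add Field Rfield : (fcar_field R).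
Local Notation mu := (@lebesgue_measure R).
Local Notation vol := (torus_measure R d).
Local Notation point := 'rV[R]_d.
Local Notation L1 f := (mu.-integrable setT (EFin \o f)).

Variables (M c : R) (J : finType) (w : J -> point -> R) (g : J -> R -> R) (a0 : J -> R).
Hypotheses (c0 : 0 <= c) (sw : forall j, torus_smooth (w j)).
Hypotheses (w1 : forall j x, `|w j x| <= 1) (Ig : forall j, L1 (g j)).

Definition coef j t : R := a0 j + prim (g j) t.
Definition galerkin t x : R := c * \sum_j w j x * coef j t.
Definition energy t : R := \int[vol]_x barrier M (galerkin t x).
Definition dual_coef j t : R := c * \int[vol]_x (barrier1 M (galerkin t x) * w j x).
Definition energy_rate t : R := \sum_j dual_coef j t * g j t.

(** A common modulus: the increments of all [coef], [galerkin] and [dual_coef] are bounded by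
    constant multiples of the increments of [gam]. *)
Let gam : R -> R := prim (fun r => \sum_j `|g j r|).

Let Isum : L1 (fun r => \sum_j `|g j r|).
Proof. by apply: integrable_fun_sum => j; exact: (integrable_abse (Ig j)). Qed.

Lemma torus_smooth_galerkin t : torus_smooth (galerkin t).
Proof.
apply: torus_smoothM; first exact: torus_smooth_cst.
by apply: torus_smooth_sum => j _; apply: torus_smoothM => //; exact: torus_smooth_cst.
Qed.

Let Ibarrier t : vol.-integrable setT (EFin \o (fun x => barrier M (galerkin t x))).
Proof.
apply: torus_smooth_integrable; apply: torus_smooth_comp; last exact: torus_smooth_galerkin.
exact: Coo_barrier.
Qed.

Let sb1 t : torus_smooth (fun x => barrier1 M (galerkin t x)).
Proof. by apply: torus_smooth_comp; [exact: Coo_barrier1|exact: torus_smooth_galerkin]. Qed.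

Let Ib1 t j : vol.-integrable setT (EFin \o (fun x => barrier1 M (galerkin t x) * w j x)).
Proof. by apply: torus_smooth_integrable; exact: torus_smoothM. Qed.

Let gam_nd s t : 0 <= s -> s <= t -> gam s <= gam t.
Proof.
by move=> s0 st; apply: prim_ge0_nd; rewrite ?s0//; move=> r; exact: sumr_ge0.
Qed.

Let g_le j r : `|g j r| <= \sum_l `|g l r|.
Proof. by rewrite (bigD1 j)//= lerDl sumr_ge0. Qed.

Let coef_incr j s t : 0 <= s -> s <= t -> `|coef j t - coef j s| <= gam t - gam s.
Proof.
move=> s0 st; rewrite /coef opprD addrACA subrr add0r.
by apply: prim_incr_le; rewrite ?s0//; exact: g_le.
Qed.

Let galerkinB s t x : galerkin t x - galerkin s x = c * \sum_j w j x * (coef j t - coef j s).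
Proof.
rewrite -mulrBr -sumrB; congr (_ * _); apply: eq_bigr => j _.
by rewrite mulrBr.
Qed.

Let galerkin_incr s t x : 0 <= s -> s <= t ->
  `|galerkin t x - galerkin s x| <= c * #|J|%:R * (gam t - gam s).
Proof.
move=> s0 st; rewrite galerkinB normrM ger0_norm// -mulrA ler_wpM2l//.
apply: le_trans (ler_norm_sum _ _ _) _.
rewrite [leRHS]mulr_natl -sumr_const ler_sum// => j _.
rewrite normrM -[leRHS]mul1r ler_pM//; exact: coef_incr.
Qed.

Let C1 : R := c * (12 * (c * #|J|%:R)).

Let C10 : 0 <= C1.
Proof. by rewrite !mulr_ge0. Qed.

Let dual_incr j s t : 0 <= s -> s <= t ->
  `|dual_coef j t - dual_coef j s| <= C1 * (gam t - gam s).
Proof.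
move=> s0 st; rewrite -mulrBr -RintegralB// normrM ger0_norm// /C1 -mulrA ler_wpM2l//.
apply: Rintegral_le_bound.
  apply: measurable_funB; apply: integrable_measurable; exact: Ib1.
move=> x; rewrite -mulrBl normrM -[leRHS]mulr1 ler_pM//.
apply: le_trans (barrier1_lip _ _ _) _; rewrite -mulrA ler_wpM2l//.
exact: galerkin_incr.
Qed.

Lemma dual_coef_bound j t : `|dual_coef j t| <= c.
Proof.
rewrite normrM ger0_norm// -[leRHS]mulr1 ler_wpM2l//.
apply: Rintegral_le_bound; first exact: integrable_measurable (Ib1 t j).
by move=> x; rewrite normrM -[leRHS]mulr1 ler_pM// barrier1_le.
Qed.

(** Splitting [f] as (|f| + f) - |f| makes the primitive a difference of two nondecreasing
    functions. *)
Lemma measurable_prim (f : R -> R) : L1 f -> measurable_fun [set: R] (prim f).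
Proof.
move=> If.
pose ind (z : measurableTypeR R * measurableTypeR R) : R :=
  if (0 <= z.2) && (z.2 <= z.1) then 1 else 0.
have H (h : R -> R) : L1 h -> (forall r, 0 <= h r) -> measurable_fun [set: R] (prim h).
  move=> Ih h0; apply: nondecreasing_measurable => //.
  move=> s t st; rewrite /prim; have [s0|s0] := ltP s 0.
    by rewrite set_itv_ge ?bnd_simp -?ltNge// Rintegral_set0 Rintegral_ge0.
  by rewrite -/(prim h s) -/(prim h t); apply: prim_ge0_nd => //; rewrite s0.
pose fp r := `|f r| + f r; pose fm r := `|f r|.
have Ifm : L1 fm by exact: (integrable_abse If).
have Ifp : L1 fp by exact: integrable_funD.
rewrite (_ : prim f = (fun t => prim fp t - prim fm t)).
  apply: measurable_funB; apply: H => // r; last exact: normr_ge0.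
  by rewrite /fp addrC -lerBlDr sub0r lerNl; have := ler_norm (- f r); rewrite normrN lerNl.
apply/funext => t; rewrite /prim -RintegralB//; last 2 first.
- exact: integrable_sub.
- exact: integrable_sub.
by apply: eq_Rintegral => r _; rewrite /fp /fm addrAC subrr add0r.
Qed.

Lemma measurable_dual_coef j : measurable_fun [set: measurableTypeR R] (dual_coef j).
Proof.
apply: measurable_funM => //.
apply: (@measurable_Rintegral_snd _ _ _ vol
  (fun z : measurableTypeR R * point => barrier1 M (galerkin z.1 z.2) * w j z.2)).
have mw i : measurable_fun setT (fun z : measurableTypeR R * point => w i z.2).
  apply: measurableT_comp => //; exact: torus_smooth_measurable.
apply: measurable_funM => //; apply: measurableT_comp.
  apply: continuous_measurable_fun; exact: Coo_continuous (@Coo_barrier1 R M).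
apply: measurable_funM => //; apply: measurable_sum => i.
apply: measurable_funM => //; apply: measurable_funD => //.
apply: measurableT_comp; last exact: measurable_fst.
exact: measurable_prim.
Qed.

Lemma energy_rate_integrable : L1 energy_rate.
Proof.
apply: integrable_fun_sum => j.
under [X in _.-integrable _ (_ \o X)]eq_fun do rewrite mulrC.
apply: (@integrable_bounded_mul _ _ _ _ _ _ c) => //.
- exact: measurable_dual_coef.
- exact: dual_coef_bound.
Qed.

Let energy_tangent s t :
  energy t - energy s <= \sum_j dual_coef j t * (coef j t - coef j s).
Proof.
rewrite /energy -RintegralB//.
have -> : \sum_j dual_coef j t * (coef j t - coef j s) =
    \int[vol]_x (barrier1 M (galerkin t x) * (galerkin t x - galerkin s x)).
  under [RHS]eq_Rintegral => x _.
    rewrite galerkinB mulr_sumr mulr_sumr.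
    under eq_bigr => j _.
      rewrite (_ : barrier1 M (galerkin t x) * (c * (w j x * (coef j t - coef j s))) =
        (c * (coef j t - coef j s)) * (barrier1 M (galerkin t x) * w j x)); last first.
        by set a := barrier1 _ _; set b := coef j t - _; set e := w j x; fring.
      over.
    over.
  rewrite Rintegral_sum => [|j]; last exact: integrable_funZ.
  by apply: eq_bigr => j _; rewrite RintegralZl// /dual_coef mulrAC.
apply: le_Rintegral => //.
- exact: (integrable_funB (Ibarrier t) (Ibarrier s)).
- apply: torus_smooth_integrable; apply: torus_smoothM => //.
  apply: torus_smoothD; first exact: torus_smooth_galerkin.
  rewrite (_ : (fun x => _) = (fun x => (-1) * galerkin s x)).
    by apply: torus_smoothM; [exact: torus_smooth_cst|exact: torus_smooth_galerkin].
  by apply/funext => x; rewrite mulN1r.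
- by move=> x _; exact: barrier_tangent.
Qed.

(** Convexity bounds the growth of the energy by the tangent at the later time [t], that is, by the
    integral over (s, t] of the sum of [dual_coef j t * g j r]. Replacing [dual_coef j t] by
    [dual_coef j r] costs a factor [C1 * (gam t - gam s)] in front of |g j r|, whose integral is
    again at most the increment of [gam]. *)
Let defect_incr s t : 0 <= s -> s <= t ->
  (energy t - prim energy_rate t) - (energy s - prim energy_rate s) <=
  (#|J|%:R * C1) * (gam t - gam s) ^+ 2.
Proof.
move=> s0 st; have st' : 0 <= s <= t by rewrite s0.
have mst : measurable (`]s, t] : set (measurableTypeR R)) by exact: measurable_itv.
have -> : energy t - prim energy_rate t - (energy s - prim energy_rate s) =
   (energy t - energy s) - (prim energy_rate t - prim energy_rate s).
  by set a := energy t; set b := energy s; set u := prim energy_rate t; set v := prim energy_rate s; fring.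
apply: le_trans (lerD (energy_tangent s t) (lexx _)) _.
rewrite (primB energy_rate_integrable st').
have Idg j : L1 (fun r => dual_coef j r * g j r).
  under [X in _.-integrable _ (_ \o X)]eq_fun do rewrite mulrC.
  apply: (@integrable_bounded_mul _ _ _ _ _ _ c) => //.
  - exact: measurable_dual_coef.
  - exact: dual_coef_bound.
have -> : \int[mu]_(r in `]s, t]) energy_rate r = \sum_j \int[mu]_(r in `]s, t]) (dual_coef j r * g j r).
  rewrite Rintegral_mkcond.
  rewrite (_ : _ \_ _ = fun r => \sum_j ((fun r => dual_coef j r * g j r) \_ `]s, t]) r).
    rewrite Rintegral_sum => [|j].
      by apply: eq_bigr => j _; rewrite [RHS]Rintegral_mkcond.
    rewrite (_ : EFin \o _ = (EFin \o (fun r => dual_coef j r * g j r)) \_ `]s, t]).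
      by apply: (integrable_mkcond _ mst).1; exact: integrable_sub.
    by rewrite restrict_EFin.
  apply/funext => r; rewrite patchE; case: ifPn => rst.
    by apply: eq_bigr => j _; rewrite patchE rst.
  by rewrite big1// => j _; rewrite patchE (negbTE rst).
rewrite -sumrB -[X in _ <= X * _ * _](_ : \sum_(j : J) 1 = _); last by rewrite sumr_const.
rewrite expr2 mulr_suml mulr_suml ler_sum// => j _; rewrite mul1r.
have -> : coef j t - coef j s = \int[mu]_(r in `]s, t]) g j r.
  by rewrite -primB// /coef opprD addrACA subrr add0r.
have Igst := integrable_sub mst (Ig j).
have Igz : L1 (fun r => dual_coef j t * g j r) by exact: integrable_funZ.
have E1 := @RintegralZl _ _ _ mu _ (g j) (dual_coef j t) mst Igst.
have E2 := @RintegralB _ _ _ mu _ (fun r => dual_coef j t * g j r)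
  (fun r => dual_coef j r * g j r) mst (integrable_sub mst Igz) (integrable_sub mst (Idg j)).
rewrite [X in X <= _](etrans (congr1 (fun z => z - _) (esym E1)) (esym E2)).
have Iabs : L1 (fun r => C1 * (gam t - gam s) * `|g j r|).
  by apply: integrable_funZ; exact: (integrable_abse (Ig j)).
apply: (@le_trans _ _ (\int[mu]_(r in `]s, t]) (C1 * (gam t - gam s) * `|g j r|))).
  apply: le_Rintegral => //.
  - exact: (integrable_sub mst (integrable_funB Igz (Idg j))).
  - exact: (integrable_sub mst Iabs).
  - move=> r /=; rewrite in_itv/= => /andP[sr rt].
    rewrite -mulrBl; apply: le_trans (ler_norm _) _; rewrite normrM ler_wpM2r//.
    apply: le_trans (dual_incr j _ rt) _; first exact: le_trans (ltW sr).
    by rewrite ler_wpM2l// lerD2l lerN2; apply: gam_nd => //; exact: ltW.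
have Iabs1 : L1 (fun r => `|g j r|) by exact: (integrable_abse (Ig j)).
rewrite RintegralZl//; last exact: integrable_sub.
rewrite mulrA ler_wpM2l//; first by rewrite mulr_ge0// subr_ge0 gam_nd.
rewrite /gam (primB Isum st').
by apply: (le_Rintegral mst (integrable_sub mst Iabs1) (integrable_sub mst Isum)) => r _; exact: g_le.
Qed.

(** The difference between the energy and the primitive of its formal rate grows at most
    quadratically in the increments of the continuous nondecreasing [gam], hence does not grow at
    all ([quadratic_increments]). *)
Lemma chain_rule_le t : 0 <= t -> energy t <= energy 0 + prim energy_rate t.
Proof.
move=> t0.
pose Phi := fun t => energy t - prim energy_rate t.
have H : Phi t <= Phi 0.
  apply: (@quadratic_increments R Phi gam (#|J|%:R * C1) t t0).
  - exact: (prim_continuous Isum t0).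
  - by move=> r s r0 rs _; exact: gam_nd.
  - by move=> r s r0 rs _; exact: defect_incr.
have cancel (a b p p0 : R) : p0 = 0 -> a - p <= b - p0 -> a <= b + p.
  by move=> ->; rewrite subr0 lerBlDr.
exact: cancel (prim0 energy_rate) H.
Qed.

End chain_rule.

(** * The commutator of smearing and transport at a fixed time *)

Section commutator_estimate.
Context {R : realType} {d : nat}.
Add Field Rfield : (fcar_field R).
Local Notation vol := (torus_measure R d).
Local Notation point := 'rV[R]_d.
Local Notation sqi := (sq_integrable vol).
Local Notation nrm := (sqnorm vol).
Local Notation L1 f := (vol.-integrable setT (EFin \o f)).
Local Notation e_ := Defs.basis.

Variables (M U kappa : R) (q : point -> R) (G V : 'I_d -> point -> R).
Hypotheses (kappa0 : 0 <= kappa) (U0 : 0 <= U) (sq : sqi q) (sG : forall i, sqi (G i)).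
Hypotheses (mV : forall i, measurable_fun setT (V i)) (VU : forall i x, `|V i x| <= U).
Hypothesis gradq : forall psi, torus_smooth psi -> forall i,
  \int[vol]_x (q x * 'D_(e_ i) psi x) = - \int[vol]_x (G i x * psi x).
Hypothesis divV : forall psi, torus_smooth psi ->
  \int[vol]_x (\sum_(i < d) V i x * 'D_(e_ i) psi x) = 0.

Definition commutator n i (x : point) : R :=
  smear n (fun y => q y * V i y) x - V i x * smear n q x.

Let sqV i : sqi (fun y => q y * V i y).
Proof. exact: sq_integrable_bounded_mul sq (mV i) (VU i). Qed.

Let sVS n i : sqi (fun x => V i x * smear n q x).
Proof.
under eq_fun do rewrite mulrC.
exact: sq_integrable_bounded_mul (sq_integrable_smear n q) (mV i) (VU i).
Qed.

Lemma sq_integrable_commutator n i : sqi (commutator n i).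
Proof. exact: sq_integrableB (sq_integrable_smear n _) (sVS n i). Qed.

Lemma commutator_le n i : nrm (commutator n i) <= 4 * U ^+ 2 * nrm q.
Proof.
have H := sqnormD (sq_integrable_smear n (fun y => q y * V i y)) (sq_integrableN (sVS n i)).
apply: le_trans H _.
have -> : 4 * U ^+ 2 * nrm q = 2 * (U ^+ 2 * nrm q) + 2 * (U ^+ 2 * nrm q).
  have -> : 4 = 2 * 2 :> R by rewrite -natrM.
  by set a := nrm q; fring.
apply: lerD; rewrite ler_pM2l//.
  apply: le_trans (sqnorm_smear n (sqV i)) _.
  exact: sqnorm_bounded_mul sq (mV i) (VU i).
rewrite /sqnorm; under eq_Rintegral do rewrite sqrrN mulrC.
apply: le_trans (sqnorm_bounded_mul (sq_integrable_smear n q) (mV i) (VU i)) _.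
by rewrite ler_wpM2l ?sqr_ge0//; exact: sqnorm_smear.
Qed.

Lemma commutator_cvg i : nrm (commutator n i) @[n --> \oo] --> 0.
Proof.
have c1 := smear_cvg (sqV i); have c2 := smear_cvg sq.
have c3 : 2 * nrm (fun x => smear n (fun y => q y * V i y) x - q x * V i x) +
    2 * (U ^+ 2 * nrm (fun x => smear n q x - q x)) @[n --> \oo] --> 0.
  have -> : 0 = 2 * 0 + 2 * (U ^+ 2 * 0) :> R by rewrite !mulr0 addr0.
  by apply: cvgD; apply: cvgM => //; try exact: cvg_cst; apply: cvgM => //; exact: cvg_cst.
apply: (squeeze_cvgr _ (cvg_cst 0) c3); apply: nearW => n.
rewrite sqnorm_ge0/=.
have s1 := sq_integrableB (sq_integrable_smear n (fun y => q y * V i y)) (sqV i).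
have s2 := sq_integrableB (sq_integrable_smear n q) sq.
have s3 := sq_integrable_bounded_mul s2 (mV i) (VU i).
have -> : commutator n i = (fun x => (smear n (fun y => q y * V i y) x - q x * V i x) +
    - ((smear n q x - q x) * V i x)).
  apply/funext => x; rewrite /commutator; set a := smear n (fun y => q y * V i y) x.
  by set b := smear n q x; set v := V i x; set u := q x; fring.
apply: le_trans (sqnormD s1 (sq_integrableN s3)) _.
rewrite lerD2l ler_pM2l// /sqnorm; under eq_Rintegral do rewrite sqrrN.
exact: sqnorm_bounded_mul s2 (mV i) (VU i).
Qed.

Section fixed_level.
Variable n : nat.
Local Notation Sm := (smear n).
Local Notation w := (@waves R d n).
Local Notation c := (@kernel_mass R d n)^-1.

Let phi (x : point) : R := barrier1 M (Sm q x).

Let sS (f : point -> R) : torus_smooth (Sm f). Proof. exact: torus_smooth_smear. Qed.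

Let sphi : torus_smooth phi.
Proof. by apply: torus_smooth_comp => //; exact: Coo_barrier1. Qed.

Let derive_Sq i : 'D_(e_ i) (Sm q) = Sm (G i).
Proof.
apply: derive_smear_weak; [exact: sq_integrable_integrable|exact: sq_integrable_integrable|].
by move=> psi spsi; exact: gradq.
Qed.

Let derive_comp (h dh : R -> R) i x : (forall s : R, is_derive s 1 h (dh s)) ->
  'D_(e_ i) (fun x => h (Sm q x)) x = dh (Sm q x) * Sm (G i) x.
Proof.
move=> hdh; have H1 := torus_smooth_is_derive (e_ i) x (sS q).
have := @is_derive_comp _ _ h (Sm q) x (e_ i) _ _ (hdh _) H1.
move=> H; rewrite (@derive_val _ _ _ _ _ _ _ H).
by rewrite -(derive_Sq i).
Qed.

(** The sum over [j] reassembles the derivative of the smeared [phi]. Smearing commutes with the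
    derivative and is symmetric, so it moves onto [f], leaving the derivative of [phi] itself, which
    the chain rule computes. *)
Let test (f : point -> R) i : L1 f ->
  \sum_j (c * \int[vol]_x (phi x * w j x)) * \int[vol]_x (f x * 'D_(e_ i) (w j) x) =
  \int[vol]_x (Sm f x * (barrier2 M (Sm q x) * Sm (G i) x)).
Proof.
move=> If.
have sdphi := torus_smooth_derive (e_ i) sphi.
have Idphi := torus_smooth_integrable sdphi.
have ES : 'D_(e_ i) (Sm phi) = Sm ('D_(e_ i) phi).
  apply: derive_smear_weak => //; first exact: torus_smooth_integrable.
  by move=> psi spsi; exact: torus_by_parts.
transitivity (\int[vol]_x (f x * Sm ('D_(e_ i) phi) x)).
  have E x : Sm ('D_(e_ i) phi) x = \sum_j (c * \int[vol]_y (phi y * w j y)) * 'D_(e_ i) (w j) x.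
    by rewrite -ES derive_smear mulr_sumr; apply: eq_bigr => j _; rewrite mulrCA mulrC.
  under [RHS]eq_Rintegral => x _.
    rewrite E mulr_sumr; under eq_bigr do rewrite mulrCA.
    over.
  have If2 j : L1 (fun x => f x * 'D_(e_ i) (w j) x).
    have sw := torus_smooth_derive (e_ i) (torus_smooth_waves j : torus_smooth (w j)).
    have [K _ wK] := torus_smooth_bounded sw.
    by apply: (@integrable_bounded_mul _ _ _ _ _ _ K) => //; exact: torus_smooth_measurable.
  rewrite Rintegral_sum => [|j]; last exact: integrable_funZ.
  by apply: eq_bigr => j _; rewrite RintegralZl.
rewrite -smear_adjoint//; apply: eq_Rintegral => x _.
by rewrite /phi (derive_comp i x (is_derive_barrier1 M)).
Qed.

(** The diffusion term has the right sign, [barrier2] being nonnegative, and is dropped. In the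
    transport term S(qV) is replaced by its difference with V S(q): the subtracted part is the
    integral of V . grad([barrier_flux] of S q), which is 0. Young's inequality with weight [e]
    bounds the commutator term, with 12 bounding [barrier2]. *)
Lemma energy_rate_le (e : R) : 0 < e ->
  \sum_j (c * \int[vol]_x (phi x * w j x)) *
    (\sum_i \int[vol]_x ((q x * V i x) * 'D_(e_ i) (w j) x) -
     kappa * \sum_i \int[vol]_x (G i x * 'D_(e_ i) (w j) x)) <=
  \sum_i (e / 2 * (12 ^+ 2 * nrm (commutator n i)) + (2 * e)^-1 * nrm (G i)).
Proof.
move=> e0.
pose a i := \int[vol]_x (Sm (fun y => q y * V i y) x * (barrier2 M (Sm q x) * Sm (G i) x)).
pose b i := \int[vol]_x (Sm (G i) x * (barrier2 M (Sm q x) * Sm (G i) x)).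
have -> : \sum_j (c * \int[vol]_x (phi x * w j x)) *
    (\sum_i \int[vol]_x ((q x * V i x) * 'D_(e_ i) (w j) x) -
     kappa * \sum_i \int[vol]_x (G i x * 'D_(e_ i) (w j) x)) =
  \sum_i a i - kappa * \sum_i b i.
  under eq_bigr => j _ do rewrite mulrBr mulrCA !mulr_sumr.
  rewrite sumrB; congr (_ - _); rewrite exchange_big; apply/esym.
    apply: eq_bigr => i _; apply/esym; apply: test; exact: sq_integrable_integrable.
  rewrite mulr_sumr; apply: eq_bigr => i _; rewrite -mulr_sumr; congr (_ * _); apply/esym.
  by apply: test; exact: sq_integrable_integrable.
have b0 : 0 <= \sum_i b i.
  apply: sumr_ge0 => i _; apply: Rintegral_ge0 => x _.
  by rewrite mulrCA mulr_ge0 ?barrier2_ge0// -expr2 sqr_ge0.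
have sb2 : torus_smooth (fun x => barrier2 M (Sm q x)).
  by apply: torus_smooth_comp => //; exact: Coo_barrier2.
have sbG i : sqi (fun x => barrier2 M (Sm q x) * Sm (G i) x).
  have [K _ wK] := torus_smooth_bounded (torus_smoothM sb2 (sS (G i))).
  apply: sq_integrable_bounded wK; apply: torus_smooth_measurable; exact: torus_smoothM.
have flux0 : \sum_i \int[vol]_x ((V i x * Sm q x) * (barrier2 M (Sm q x) * Sm (G i) x)) = 0.
  rewrite -Rintegral_sum => [|i]; last exact: sq_integrable_mul (sVS n i) (sbG i).
  have sflux : torus_smooth (fun x => barrier_flux M (Sm q x)).
    by apply: torus_smooth_comp => //; exact: Coo_barrier_flux.
  rewrite -[RHS](divV sflux); apply: eq_Rintegral => x _; apply: eq_bigr => i _.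
  by rewrite (derive_comp i x (is_derive_barrier_flux M)) !mulrA.
apply: (@le_trans _ _ (\sum_i a i)); first by rewrite gerBl mulr_ge0.
have -> : \sum_i a i = \sum_i a i - \sum_i \int[vol]_x ((V i x * Sm q x) * (barrier2 M (Sm q x) * Sm (G i) x)).
  by rewrite flux0 subr0.
rewrite -sumrB; apply: ler_sum => i _.
rewrite /a -RintegralB//; [|exact: sq_integrable_mul (sq_integrable_smear n _) (sbG i)|
  exact: sq_integrable_mul (sVS n i) (sbG i)].
under eq_Rintegral do rewrite -mulrBl mulrA.
have scb : sqi (fun x => commutator n i x * barrier2 M (Sm q x)).
  apply: (@sq_integrable_bounded_mul _ _ _ _ _ _ 12) => //.
  - exact: sq_integrable_commutator.
  - exact: torus_smooth_measurable.
  - by move=> x; exact: barrier2_le.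
apply: le_trans (ler_norm _) _.
apply: le_trans (Rintegral_young e0 scb (sq_integrable_smear n (G i))) _.
apply: lerD; apply: ler_wpM2l.
- by rewrite divr_ge0// ltW.
- apply: sqnorm_bounded_mul => //.
  + exact: sq_integrable_commutator.
  + exact: torus_smooth_measurable.
  + by move=> x; exact: barrier2_le.
- by rewrite invr_ge0 mulr_ge0// ltW.
- exact: sqnorm_smear.
Qed.

End fixed_level.

End commutator_estimate.

Lemma barrier_integrable {R : realType} {d : nat} (M : R) (f : 'rV[R]_d -> R) :
  sq_integrable (torus_measure R d) f ->
  (torus_measure R d).-integrable setT (EFin \o (fun x => barrier M (f x))).
Proof.
move=> sf; apply: (@integrable_le _ _ _ _ _ (fun x => `|f x| + barrier M 0)).
- apply: (measurableT_comp _ sf.1).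
  by apply: continuous_measurable_fun; apply: Coo_continuous; exact: Coo_barrier.
- move=> x; rewrite ger0_norm ?barrier_ge0// -lerBlDr (le_trans (ler_norm _))//.
  by rewrite -[X in _ <= `|X|]subr0; exact: barrier_lip.
- apply: integrable_funD; last exact: integrable_fun_cst.
  exact: (integrable_abse (sq_integrable_integrable sf)).
Qed.

(** * The maximum principle for data defined at every time *)

Section maximum_principle.
Context {R : realType} {d : nat}.
Add Field Rfield : (fcar_field R).
Local Notation mu := (@lebesgue_measure R).
Local Notation vol := (torus_measure R d).
Local Notation point := 'rV[R]_d.
Local Notation sqi := (sq_integrable vol).
Local Notation nrm := (sqnorm vol).
Local Notation L1 f := (mu.-integrable setT (EFin \o f)).
Local Notation e_ := Defs.basis.

Variables (M U A T kappa : R) (q : R -> point -> R) (G V : 'I_d -> R -> point -> R).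
Variable th0 : point -> R.
Hypotheses (kappa0 : 0 <= kappa) (U0 : 0 <= U).
Hypotheses (sq : forall t, sqi (q t)) (qA : forall t, nrm (q t) <= A).
Hypotheses (sG : forall i t, sqi (G i t)) (IG : forall i, L1 (fun t => nrm (G i t))).
Hypotheses (mV : forall i t, measurable_fun setT (V i t)).
Hypothesis VU : forall i t x, `|V i t x| <= U.
Hypotheses (mth0 : measurable_fun setT th0) (th0M : forall x, `|th0 x| <= M).
Hypothesis q_out : forall (t : R) x, ~~ (0 < t < T) -> q t x = 0.
Hypothesis G_out : forall i (t : R) x, ~~ (0 < t < T) -> G i t x = 0.
Hypothesis mq2 : measurable_fun setT (fun p : measurableTypeR R * point => q p.1 p.2).
Hypothesis mG2 : forall i, measurable_fun setT (fun p : measurableTypeR R * point => G i p.1 p.2).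
Hypothesis mV2 : forall i, measurable_fun setT (fun p : measurableTypeR R * point => V i p.1 p.2).
Hypothesis gradq : forall t psi, torus_smooth psi -> forall i,
  \int[vol]_x (q t x * 'D_(e_ i) psi x) = - \int[vol]_x (G i t x * psi x).
Hypothesis divV : forall t psi, torus_smooth psi ->
  \int[vol]_x (\sum_(i < d) V i t x * 'D_(e_ i) psi x) = 0.

(** The weak time derivative of the moment of [q] against [psi]; the hypothesis [weak] below says
    so, with test functions of product form. *)
Let rhs (psi : point -> R) (t : R) : R :=
  \sum_i \int[vol]_x ((q t x * V i t x) * 'D_(e_ i) psi x) -
  kappa * \sum_i \int[vol]_x (G i t x * 'D_(e_ i) psi x).

Hypothesis weak : forall psi (eta : R -> R), torus_smooth psi -> Coo eta ->
  (exists2 T', T' < T & forall t, T' < t -> eta t = 0) ->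
  \int[mu]_t ((\int[vol]_x (q t x * psi x)) * 'D_1 eta t + rhs psi t * eta t) +
  (\int[vol]_x (th0 x * psi x)) * eta 0 = 0.

Let A0 : 0 <= A. Proof. exact: le_trans (sqnorm_ge0 vol (q 0)) (qA 0). Qed.

Let Rintegral_eq0 (f : point -> R) : (forall x, f x = 0) -> \int[vol]_x f x = 0.
Proof. by move=> /funext ->; rewrite Rintegral_fun_cst. Qed.

Let window (t : R) : R := \1_(`]0, T[%classic : set (measurableTypeR R)) t.

Let window_integrable (C : R) : L1 (fun t => C * window t).
Proof.
apply: integrable_funZ; exact: integrable_indic_itv.
Qed.

Let windowE t : 0 < t < T -> window t = 1.
Proof. by move=> tT; rewrite /window indicE mem_set//= in_itv. Qed.

Let window_ge0 t : 0 <= window t. Proof. by rewrite /window indicE. Qed.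

(** Constants are not integrable on the line, but the bound is only needed on (0, T), where [window]
    is 1. *)
Let windowed (h : R -> R) (C : R) (k : R -> R) : measurable_fun setT h -> L1 k ->
  0 <= C -> (forall t, 0 <= k t) -> (forall t : R, ~~ (0 < t < T) -> h t = 0) ->
  (forall t, `|h t| <= C + k t) -> L1 h.
Proof.
move=> mh Ik C0 k0 h_out hC.
apply: (@integrable_le _ _ _ mu h (fun t => C * window t + k t)) => //.
  move=> t; have [tT|tT] := boolP (0 < t < T); first by rewrite windowE// mulr1.
  by rewrite h_out// normr0 addr_ge0// mulr_ge0.
by apply: integrable_funD => //; exact: window_integrable.
Qed.

Section pairing.
Variables (psi : point -> R) (K : R).
Hypotheses (mpsi : measurable_fun setT psi) (psiK : forall x, `|psi x| <= K).

Let mpsi2 : measurable_fun setT (fun p : measurableTypeR R * point => psi p.2).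
Proof. exact: (measurableT_comp mpsi measurable_snd). Qed.

Let spsi : sqi psi := sq_integrable_bounded vol mpsi psiK.

Let psiK2 : nrm psi <= K ^+ 2.
Proof.
apply: le_trans (ler_norm _) _; apply: Rintegral_le_bound; first exact: measurable_funX.
by move=> x; rewrite normrX ler_pXn2r ?nnegrE// (le_trans _ (psiK x)).
Qed.

Let pair_bound (f : point -> R) : sqi f ->
  `|\int[vol]_x (f x * psi x)| <= 1 / 2 * K ^+ 2 + 1 / 2 * nrm f.
Proof.
move=> sf; apply: le_trans (Rintegral_young (@ltr01 R) sf spsi) _.
by rewrite addrC mulr1 mul1r; apply: lerD => //; rewrite ler_wpM2l.
Qed.

Lemma pair_state_integrable : L1 (fun t => \int[vol]_x (q t x * psi x)).
Proof.
apply: (@windowed _ (1 / 2 * K ^+ 2 + 1 / 2 * A) (fun=> 0)).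
- by apply: (@measurable_Rintegral_snd _ _ _ vol (fun p => q p.1 p.2 * psi p.2)); exact: measurable_funM.
- exact: integrable0.
- by rewrite addr_ge0// pmulr_rge0// ?sqr_ge0// mulr_ge0// sqr_ge0.
- by [].
- by move=> t tT; apply: Rintegral_eq0 => x; rewrite q_out// mul0r.
- by move=> t; rewrite addr0 (le_trans (pair_bound (sq t)))// lerD2l ler_wpM2l.
Qed.

Lemma pair_flux_integrable i : L1 (fun t => \int[vol]_x ((q t x * V i t x) * psi x)).
Proof.
apply: (@windowed _ (1 / 2 * K ^+ 2 + 1 / 2 * (U ^+ 2 * A)) (fun=> 0)).
- apply: (@measurable_Rintegral_snd _ _ _ vol (fun p => (q p.1 p.2 * V i p.1 p.2) * psi p.2)).
  by apply: measurable_funM => //; exact: measurable_funM.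
- exact: integrable0.
- by rewrite addr_ge0// pmulr_rge0// ?sqr_ge0// mulr_ge0// sqr_ge0.
- by [].
- by move=> t tT; apply: Rintegral_eq0 => x; rewrite q_out// !mul0r.
- move=> t; rewrite addr0 (le_trans (pair_bound (sq_integrable_bounded_mul (sq t) (mV i t) (VU i t))))//.
  rewrite lerD2l ler_wpM2l// (le_trans (sqnorm_bounded_mul (sq t) (mV i t) (VU i t)))//.
  by rewrite ler_wpM2l ?sqr_ge0.
Qed.

Lemma pair_gradient_integrable i : L1 (fun t => \int[vol]_x (G i t x * psi x)).
Proof.
apply: (@windowed _ (1 / 2 * K ^+ 2) (fun t => 1 / 2 * nrm (G i t))).
- by apply: (@measurable_Rintegral_snd _ _ _ vol (fun p => G i p.1 p.2 * psi p.2)); exact: measurable_funM.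
- exact: integrable_funZ.
- by rewrite pmulr_rge0// sqr_ge0.
- by move=> t; rewrite pmulr_rge0// sqnorm_ge0.
- by move=> t tT; apply: Rintegral_eq0 => x; rewrite G_out// mul0r.
- by move=> t; exact: pair_bound.
Qed.

End pairing.

Let rhs_integrable (psi : point -> R) : torus_smooth psi -> L1 (rhs psi).
Proof.
move=> spsi; apply: integrable_funB; last apply: integrable_funZ.
all: apply: integrable_fun_sum => i; have sD := torus_smooth_derive (e_ i) spsi.
all: have [K _ DK] := torus_smooth_bounded sD; have mD := torus_smooth_measurable sD.
  exact: (pair_flux_integrable mD DK).
exact: (pair_gradient_integrable mD DK).
Qed.

Let rhs_out (psi : point -> R) t : ~~ (0 < t < T) -> rhs psi t = 0.
Proof.
move=> tT; rewrite /rhs !big1 ?mulr0 ?subr0// => i _; apply: Rintegral_eq0 => x.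
  by rewrite G_out// mul0r.
by rewrite q_out// !mul0r.
Qed.

Section level.
Variable n : nat.
Local Notation J := {ffun 'I_d * 'I_n -> 'I_3}.
Local Notation w := (@waves R d n).
Local Notation c := (@kernel_mass R d n)^-1.

Let a0 (j : J) : R := \int[vol]_x (th0 x * w j x).
Let g (j : J) : R -> R := rhs (w j).

Let c0 : 0 <= c. Proof. by rewrite invr_ge0 ltW// kernel_mass_gt0. Qed.
Let sw (j : J) : torus_smooth (w j) := torus_smooth_waves j.

Let w1 (j : J) x : `|w j x| <= 1.
Proof.
rewrite /waves normr_prod; apply: prodr_ile1 => k _; rewrite normr_ge0/= /wave.
case: ifP => _; first by rewrite normr1.
by case: ifP => _; rewrite ler_norml ?sin_geN1 ?sin_le1 ?cos_geN1 ?cos_le1.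
Qed.

Let Ig (j : J) : L1 (g j). Proof. exact: rhs_integrable. Qed.

Definition level_rate : R -> R := energy_rate M c w g a0.

(** Each moment of [q] against a wave is almost everywhere the primitive of its weak derivative; as
    there are finitely many waves, one null set of times serves them all. *)
Lemma galerkin_ae : {ae mu, forall t, 0 < t < T -> galerkin c w g a0 t = smear n (q t)}.
Proof.
have H (j : J) : {ae mu, forall t, 0 < t < T -> \int[vol]_x (q t x * w j x) = a0 j + prim (g j) t}.
  apply: weak_primitive => //.
  - exact: (pair_state_integrable (torus_smooth_measurable (sw j)) (w1 j)).
  - by move=> t; exact: rhs_out.
  - by move=> eta Ceta Teta; exact: weak.
have : {ae mu, forall t (j : J), 0 < t < T -> \int[vol]_x (q t x * w j x) = a0 j + prim (g j) t}.
  exact: (@filter_forall _ _ _ _ (ae_filter_ringOfSetsType mu)) H.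
apply: filterS; first exact: (ae_filter_ringOfSetsType mu).
move=> t Ht tT; apply/funext => x; rewrite /galerkin /smear; congr (_ * _).
by apply: eq_bigr => j _; rewrite Ht.
Qed.

Lemma level_rate_le : {ae mu, forall t, 0 < t < T -> forall e, 0 < e -> level_rate t <=
  \sum_i (e / 2 * (12 ^+ 2 * nrm (commutator (q t) (fun i => V i t) n i)) + (2 * e)^-1 * nrm (G i t))}.
Proof.
apply: filterS galerkin_ae; first exact: (ae_filter_ringOfSetsType mu).
move=> t Ht tT e e0; rewrite /level_rate /energy_rate /dual_coef Ht//.
exact: (@energy_rate_le R d M U kappa (q t) (fun i => G i t) (fun i => V i t) kappa0
  (sq t) (fun i => sG i t) (fun i => mV i t) (fun i => VU i t) (gradq t) (divV t)).
Qed.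

Lemma level_rate_integrable : L1 level_rate.
Proof. exact: energy_rate_integrable. Qed.

Lemma level_rate_out t : ~~ (0 < t < T) -> level_rate t = 0.
Proof. by move=> tT; rewrite /level_rate /energy_rate big1// => j _; rewrite /g rhs_out// mulr0. Qed.

Let pos_rate_integrable : L1 (fun r => Num.max (level_rate r) 0).
Proof.
apply: (@integrable_le _ _ _ mu _ (fun r => `|level_rate r|)).
- apply: measurable_maxr => //; exact: integrable_measurable level_rate_integrable.
- by move=> r; rewrite maxEle; case: ifPn; rewrite ?normr0.
- exact: (integrable_abse level_rate_integrable).
Qed.

Let energy0 : energy M c w g a0 0 = 0.
Proof.
apply: Rintegral_eq0 => x; apply: barrier_le.
rewrite (_ : galerkin _ _ _ _ _ _ = smear n th0 x); first exact: smear_bound.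
rewrite /galerkin /smear; congr (_ * _); apply: eq_bigr => j _.
by rewrite /coef prim0 addr0.
Qed.

(** The energy starts at 0, because smearing keeps the initial state in [-M, M] where the barrier
    vanishes. Passing to the positive part of the rate allows integration over the whole line, hence
    a bound uniform in [t]. *)
Lemma level_energy_le : {ae mu, forall t, 0 < t < T ->
  \int[vol]_x barrier M (smear n (q t) x) <= \int[mu]_r Num.max (level_rate r) 0}.
Proof.
apply: filterS galerkin_ae; first exact: (ae_filter_ringOfSetsType mu).
move=> t Ht tT; have [t0 _] := andP tT.
rewrite -(Ht tT); have := @chain_rule_le R d M c J w g a0 c0 sw w1 Ig t (ltW t0).
rewrite energy0 add0r => /le_trans; apply.
rewrite /prim Rintegral_mkcond; apply: le_Rintegral => //.
- rewrite -restrict_EFin; apply: (integrable_mkcond _ _).1; first exact: measurable_itv.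
  by apply: integrable_sub; [exact: measurable_itv|exact: level_rate_integrable].
- move=> r _; rewrite patchE; case: ifPn => _; first by rewrite le_max lexx.
  by rewrite le_max lexx orbT.
Qed.

End level.

(** For each fixed weight [e] the first sum vanishes in the limit, and the second is as small as
    desired when [e] is large. *)
Let young_squeeze (x : nat -> R) (y : 'I_d -> nat -> R) (z : 'I_d -> R) :
  (forall i, 0 <= z i) -> (forall i, y i n @[n --> \oo] --> 0) ->
  (forall e n, 0 < e -> x n <= \sum_i (e / 2 * (12 ^+ 2 * y i n) + (2 * e)^-1 * z i)) ->
  Num.max (x n) 0 @[n --> \oo] --> 0.
Proof.
move=> z0 y0 xyz; apply/cvgr0Pnorm_le => e e0.
pose Z := \sum_i z i.
have Z0 : 0 <= Z by apply: sumr_ge0.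
have Z1 : 0 < Z + 1 by rewrite ltr_wpDl.
(* With this weight the second sum is (e/2) Z/(Z + 1), at most e/2; adding 1 keeps the weight
   positive when [Z] is 0. *)
pose e1 := (Z + 1) / e.
have e10 : 0 < e1 by rewrite divr_gt0.
have H : \sum_i (e1 / 2 * (12 ^+ 2 * y i n)) @[n --> \oo] --> 0.
  elim: (index_enum 'I_d) => [|i s IH].
    under eq_fun do rewrite big_nil; exact: cvg_cst.
  have Hi : e1 / 2 * (12 ^+ 2 * y i n) @[n --> \oo] --> e1 / 2 * (12 ^+ 2 * 0).
    by apply: cvgM; [exact: cvg_cst|apply: cvgM; [exact: cvg_cst|exact: y0]].
  have := cvgD Hi IH; rewrite !mulr0 addr0; move=> /(_ _); suff -> : (fun n => \sum_(j <- i :: s) e1 / 2 * (12 ^+ 2 * y j n)) =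
    (fun n => e1 / 2 * (12 ^+ 2 * y i n)) \+ (fun n => \sum_(j <- s) e1 / 2 * (12 ^+ 2 * y j n)) by exact.
  by apply/funext => n; rewrite big_cons.
move/cvgr0Pnorm_le : H => /(_ (e / 2)); rewrite divr_gt0// => /(_ isT).
apply: filterS => n Hn; rewrite ger0_norm ?le_max ?lexx ?orbT// ge_max (ltW e0) andbT.
apply: le_trans (xyz e1 n e10) _; rewrite big_split/= -[X in _ + X]mulr_sumr -/Z [leRHS]splitr.
apply: lerD; first exact: le_trans (ler_norm _) Hn.
have e12 : 0 < 2 * e1 by rewrite mulr_gt0.
have en0 : e <> 0 by apply/eqP; rewrite gt_eqF.
have E : 2 * e1 * (e / 2) = Z + 1 by rewrite /e1; set z1 := Z + 1; ffield.
by rewrite ler_pdivrMl// E lerDl.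
Qed.

Let overshoot n : R := \int[mu]_r Num.max (level_rate n r) 0.

Let overshoot_cvg : overshoot n @[n --> \oo] --> 0.
Proof.
(* The dominating function: Young with weight 1 and the bound of [commutator_le], which does not
   depend on [n]. *)
pose b r := \sum_i (1 / 2 * (12 ^+ 2 * (4 * U ^+ 2 * A)) * window r + (2 * 1)^-1 * nrm (G i r)).
have rate_ae : {ae mu, forall r n, 0 < r < T -> forall e, 0 < e -> level_rate n r <=
    \sum_i (e / 2 * (12 ^+ 2 * nrm (commutator (q r) (fun i => V i r) n i)) + (2 * e)^-1 * nrm (G i r))}.
  by apply: ae_foralln => n; exact: level_rate_le.
rewrite -[X in _ --> X](_ : \int[mu]_r (0 : R) = 0); last first.
  by rewrite Rintegral_cst// mul0r.
apply: (@dominated_Rintegral _ _ _ mu setT (fun n r => Num.max (level_rate n r) 0) (fun=> 0) b) => //.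
- move=> n; apply: measurable_maxr => //; exact: integrable_measurable (level_rate_integrable n).
- apply: filterS rate_ae; first exact: (ae_filter_ringOfSetsType mu).
  move=> r Hr _; have [rT|rT] := boolP (0 < r < T); last first.
    under eq_fun do rewrite level_rate_out// maxxx; exact: cvg_cst.
  apply: (young_squeeze (x := fun n => level_rate n r)
    (y := fun i n => nrm (commutator (q r) (fun i => V i r) n i)) (z := fun i => nrm (G i r))).
  + by move=> i; exact: sqnorm_ge0.
  + by move=> i; apply: (commutator_cvg (sq r) (fun i => mV i r) (fun i => VU i r)).
  + by move=> e n e0; exact: Hr.
- apply: integrable_fun_sum => i; apply: integrable_funD; first exact: window_integrable.
  exact: integrable_funZ.
- apply: filterS rate_ae; first exact: (ae_filter_ringOfSetsType mu).
  move=> r Hr n _; have b0 : 0 <= b r.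
    apply: sumr_ge0 => i _; apply: addr_ge0; last by rewrite mulr_ge0 ?sqnorm_ge0.
    apply: mulr_ge0 => //; rewrite pmulr_rge0// pmulr_rge0 ?exprn_gt0//.
    by rewrite mulr_ge0// pmulr_rge0// sqr_ge0.
  rewrite ger0_norm ?le_max ?lexx ?orbT// ge_max b0 andbT.
  have [rT|rT] := boolP (0 < r < T); last by rewrite level_rate_out.
  apply: le_trans (Hr n rT 1 ltr01) _; apply: ler_sum => i _; rewrite lerD2r windowE// mulr1.
  rewrite ler_pM2l// ler_pM2l ?exprn_gt0//.
  apply: le_trans (commutator_le (sq r) (fun i => mV i r) (fun i => VU i r) n i) _.
  by rewrite ler_wpM2l// pmulr_rge0// sqr_ge0.
Qed.

(** The barrier energy of the smeared state is at most [overshoot n], which tends to 0, and it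
    converges to that of [q] because [barrier] is 1-Lipschitz and smearing converges in L^2. *)
Lemma barrier_vanishes : {ae mu, forall t, 0 < t < T -> \int[vol]_x barrier M (q t x) = 0}.
Proof.
have : {ae mu, forall t n, 0 < t < T -> \int[vol]_x barrier M (smear n (q t) x) <= overshoot n}.
  by apply: ae_foralln => n; exact: level_energy_le.
apply: filterS; first exact: (ae_filter_ringOfSetsType mu).
move=> t Ht tT; apply/eqP; rewrite eq_le Rintegral_ge0 ?andbT; last by move=> x _; exact: barrier_ge0.
rewrite leNgt; apply/negP; set B := \int[vol]_x _ => B0.
have b_int := barrier_integrable M.
(* If the limit [B] were positive, some [n] would have an overshoot below B/2 and a squared L^2
   error below (B/2)^2; yet the L^1 error is at least B minus the overshoot, which contradicts
   Cauchy-Schwarz. *)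
have B2 : 0 < B / 2 by rewrite divr_gt0.
have B4 : 0 < (B / 2) ^+ 2 by rewrite exprn_gt0.
have /cvgr0Pnorm_lt /(_ _ B2) n1 := overshoot_cvg.
have /cvgr0Pnorm_lt /(_ _ B4) n2 := smear_cvg (sq t).
have [n [/= m1 m2]] := @filter_ex _ \oo _ _ (filterI n1 n2).
have sD := sq_integrableB (sq_integrable_smear n (q t)) (sq t).
have Iabs : vol.-integrable setT (EFin \o (fun x => `|smear n (q t) x - q t x|)).
  exact: (integrable_abse (sq_integrable_integrable sD)).
have gap : B - \int[vol]_x barrier M (smear n (q t) x) <= \int[vol]_x `|smear n (q t) x - q t x|.
  rewrite -RintegralB//; [|exact: b_int|exact: b_int (sq_integrable_smear n (q t))].
  apply: le_Rintegral => //.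
    by apply: integrable_funB; [exact: b_int|exact: b_int (sq_integrable_smear n (q t))].
  move=> x _; apply: le_trans (ler_norm _) _; rewrite [leRHS]distrC; exact: barrier_lip.
have : (B / 2) ^+ 2 < (B / 2) ^+ 2; last by rewrite ltxx.
apply: le_lt_trans (le_lt_trans (ler_norm _) m2).
have sDa : sqi (fun x => `|smear n (q t) x - q t x|).
  split; first exact: measurableT_comp sD.1.
  by under [X in _.-integrable _ (_ \o X)]eq_fun do rewrite real_normK ?num_real//; exact: sD.2.
apply: (@le_trans _ _ ((\int[vol]_x `|smear n (q t) x - q t x|) ^+ 2)); last first.
  apply: le_trans (Rintegral_sqr_le sDa) _; rewrite /sqnorm.
  by under eq_Rintegral do rewrite real_normK ?num_real//.
rewrite ler_pXn2r ?nnegrE ?(ltW B2)//; last by apply: Rintegral_ge0.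
apply: le_trans gap; rewrite lerBrDr [leRHS]splitr lerD2l.
exact: le_trans (Ht n tT) (ltW (le_lt_trans (ler_norm _) m1)).
Qed.

End maximum_principle.

(** * Null sets of products, norms and essential bounds *)

Section product_null_sets.
Context {R : realType} {d : measure_display} {X : measurableType d}.
Local Notation mu := (@lebesgue_measure R).
Variable P : probability X R.

(** The measure of the sections of a null set is a nonnegative function of time with integral 0. *)
Lemma ae_slice (Q : measurableTypeR R * X -> Prop) :
  {ae (mu \x P)%E, forall p, Q p} -> {ae mu, forall t, {ae P, forall x, Q (t, x)}}.
Proof.
move=> [N [mN N0 QN]].
have mNx := @measurable_fun_xsection _ _ _ _ R P N mN.
have : (\int[mu]_t `|(P \o xsection N) t| = 0)%E.
  rewrite -[RHS]N0; apply: eq_integral => t _; rewrite gee0_abs//.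
move/(ae_eq_integral_abs mu measurableT mNx) => [M [mM M0 HM]].
exists M; split=> // t Ht; apply: HM => /= /(_ I) Nt; apply: Ht.
exists (xsection N t); split => //; first exact: measurable_xsection.
by move=> x Qx; rewrite /xsection/= inE; exact: QN.
Qed.

End product_null_sets.

Section norms.
Context {R : realType} {d : nat}.
Local Notation vol := (torus_measure R d).
Local Notation point := 'rV[R]_d.

Lemma poweR2 (x : \bar R) : (0 <= x -> x `^ 2 = x ^+ 2)%E.
Proof.
case: x => [r| |//]; last by move=> _; rewrite poweRyr.
by rewrite lee_fin => r0; rewrite poweR_EFin powR_mulrn.
Qed.

Lemma L2_norm_sqr (f : point -> R) : (L2_norm f ^+ 2 = \int[vol]_x (f x ^+ 2)%:E)%E.
Proof.
rewrite -poweR2 ?Lnorm_ge0// /L2_norm powR_Lnorm//.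
apply: eq_integral => x _ /=.
by rewrite powR_mulrn// real_normK ?num_real.
Qed.

Lemma L2_vnorm_sqr (g : point -> point) :
  (L2_vnorm g ^+ 2 = \int[vol]_x (\sum_(i < d) g x ord0 i ^+ 2)%:E)%E.
Proof.
rewrite -poweR2 ?Lnorm_ge0// /L2_vnorm powR_Lnorm//.
apply: eq_integral => x _ /=.
rewrite powR_mulrn// real_normK ?num_real// sqr_sqrtr//.
by apply: sumr_ge0 => i _; exact: sqr_ge0.
Qed.

End norms.

Section essential_bound.
Context {d : measure_display} {X : measurableType d} {R : realType}.
Variable mu : {measure set X -> \bar R}.

Lemma Lnorm_oo_bound (f : X -> \bar R) : ('N[mu]_+oo[f] < +oo)%E ->
  exists2 U : R, 0 <= U & {ae mu, forall x, (`|f x| <= U%:E)%E}.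
Proof.
(* When the whole space is null the norm takes a default value, and any bound holds almost
   everywhere. *)
rewrite unlock /=; case: ifPn => [_ fU|mu0 _]; last first.
  exists 0 => //; exists setT; split=> //; apply/eqP; rewrite eq_le measure_ge0 andbT.
  by rewrite leNgt.
exists (Num.max (fine (ess_sup mu (abse \o f))) 0); first by rewrite le_max lexx orbT.
apply/ess_supP; move: fU; case: ess_sup => [r| |] //= _; rewrite ?leNye//.
by rewrite lee_fin le_max lexx.
Qed.

End essential_bound.

Section almost_every_time.
Context {R : realType}.
Local Notation mu := (@lebesgue_measure R).

Lemma ae_timeS (P Q : R -> Prop) : (forall t, P t -> Q t) ->
  {ae mu, forall t, P t} -> {ae mu, forall t, Q t}.
Proof. by move=> PQ [N [mN N0 PN]]; exists N; split=> // t Qt; apply: PN => /PQ. Qed.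

Lemma ae_timeI (P Q : R -> Prop) : {ae mu, forall t, P t} -> {ae mu, forall t, Q t} ->
  {ae mu, forall t, P t /\ Q t}.
Proof. move=> [N [mN N0 PN]] [N' [mN' N0' QN]]; exists (N `|` N'); split.
- exact: measurableU.
- by rewrite measureU0.
- by move=> t; rewrite /= not_andP => -[Pt|Qt]; [left; exact: PN|right; exact: QN]. Qed.

End almost_every_time.

(** * What the definition of weak solution gives at almost every time *)

Section solution.
Context {R : realType} {d : nat}.
Add Field Rfield : (fcar_field R).
Local Notation mu := (@lebesgue_measure R).
Local Notation vol := (torus_measure R d).
Local Notation point := 'rV[R]_d.
Local Notation sqi := (sq_integrable vol).
Local Notation nrm := (sqnorm vol).
Local Notation L1 f := (mu.-integrable setT (EFin \o f)).
Local Notation e_ := Defs.basis.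

Variable T : R.

Let D := [set p : measurableTypeR R * point | 0 < p.1 < T].

Let mD : measurable D.
Proof.
rewrite (_ : D = `]0, T[%classic `*` setT); first by apply: measurableX => //; exact: measurable_itv.
by apply/seteqP; split => p /=; rewrite in_itv/= => // -[].
Qed.

Definition cutoff (f : measurableTypeR R * point -> R) p : R := if 0 < p.1 < T then f p else 0.

Lemma measurable_cutoff f : measurable_fun D f -> measurable_fun setT (cutoff f).
Proof.
move=> mf; rewrite (_ : cutoff f = f \_ D); first exact/(measurable_restrictT _ _).1.
by apply/funext => p; rewrite patchE mem_setE.
Qed.

Lemma enorm_coord (v : point) i : `|v ord0 i| <= enorm v.
Proof.
rewrite -sqrtr_sqr ler_wsqrtr// (bigD1 i)//= lerDl.
by apply: sumr_ge0 => j _; exact: sqr_ge0.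
Qed.

Section speed.
Variable u : R * point -> point.
Hypothesis uL : Loo_spacetime T u.

Lemma speed_bound : exists2 U : R, 0 <= U & {ae mu, forall t, 0 < t < T ->
  {ae vol, forall x i, `|u (t, x) ord0 i| <= U}}.
Proof.
have [_ /Lnorm_oo_bound[U U0 HU]] := uL; exists U => //.
have := ae_slice HU; apply: filterS.
move=> t Ht tT; move: Ht; apply: filterS => x + i; rewrite patchE mem_set/=; last first.
  by have /andP[/ltW -> ->] := tT.
rewrite lee_fin; apply: le_trans; apply: le_trans (enorm_coord _ i) _; exact: ler_norm.
Qed.

Lemma measurable_velocity i : measurable_fun D (fun p => u p ord0 i).
Proof.
have [m _] := uL.
have m' : measurable_fun D u.
  apply: measurable_funS m; last by move=> p /= /andP[/ltW -> ->].
  rewrite (_ : [set p | _] = `[0, T[%classic `*` setT).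
    by apply: measurableX => //; exact: measurable_itv.
  by apply/seteqP; split => p /=; rewrite in_itv/= => // -[].
exact: (measurableT_comp (@measurable_coord _ (measurableTypeR R) d i) m').
Qed.

End speed.

Let tonelli (F : measurableTypeR R * point -> R) : measurable_fun D F -> (forall p, 0 <= F p) ->
  measurable_fun (`]0, T[%classic : set (measurableTypeR R)) (fun t => \int[vol]_x (F (t, x))%:E)%E.
Proof.
move=> mF F0.
pose F' := EFin \o cutoff F.
have mF' : measurable_fun setT F' by apply/measurable_EFinP; exact: measurable_cutoff.
have H : measurable_fun setT (fubini_F vol F').
  apply: measurable_fun_fubini_tonelli_F => // p; rewrite lee_fin /cutoff; case: ifP => //.
apply: (eq_measurable_fun (fubini_F vol F')); last exact: measurable_funS H.
move=> t; rewrite inE/= in_itv/= => tT; apply: eq_integral => x _.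
by rewrite /F' /= /cutoff/= tT.
Qed.

Section weak.
Variables (kappa : R) (u : R * point -> point) (th0 : point -> R).
Variables (th : R * point -> R) (gr : R * point -> point).
Hypothesis uD : {ae mu, forall t, 0 < t < T -> divergence_free (slice u t)}.
Hypothesis uL : Loo_spacetime T u.
Hypothesis ws : weak_solution T kappa u th0 th gr.

Let mth : measurable_fun D th. Proof. by case: ws => _ []. Qed.

Lemma measurable_gradient i : measurable_fun D (fun p => gr p ord0 i).
Proof.
have [_ [_ m _ _] _] := ws.
exact: (measurableT_comp (@measurable_coord _ (measurableTypeR R) d i) m).
Qed.

Let mgrad2 : measurable_fun D (fun p => \sum_(i < d) gr p ord0 i ^+ 2).
Proof. by apply: measurable_sum => i; apply: measurable_funX; exact: measurable_gradient. Qed.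

Lemma measurable_gradient_energy : measurable_fun (`]0, T[%classic : set (measurableTypeR R))
  (fun t => \int[vol]_x (\sum_(i < d) gr (t, x) ord0 i ^+ 2)%:E)%E.
Proof. by apply: (tonelli mgrad2) => p; apply: sumr_ge0 => i _; exact: sqr_ge0. Qed.

(** The squared H^1 norm of a slice is the squared L^2 norm of the state plus that of the gradient,
    so the time integrability of the former controls the latter. *)
Lemma gradient_energy_fin :
  (\int[mu]_(t in `]0%R, T[) \int[vol]_x (\sum_(i < d) gr (t, x) ord0 i ^+ 2)%:E < +oo)%E.
Proof.
have [_ [_ _ _ [_ _ H]] _] := ws.
have : ('N[mu]_2[(H1_norm \o slice (fun p => (th p, gr p))) \_ `]0%R, T[] `^ 2 < +oo)%E.
  exact: poweR_lty.
rewrite poweR_Lnorm//; apply: le_lt_trans.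
rewrite [leLHS]integral_mkcond.
pose S t := (\int[vol]_x (\sum_(i < d) gr (t, x) ord0 i ^+ 2)%:E)%E.
pose Q t := (\int[vol]_x (th (t, x) ^+ 2)%:E)%E.
have S0 t : (0 <= S t)%E.
  by apply: integral_ge0 => x _; rewrite lee_fin; apply: sumr_ge0 => i _; exact: sqr_ge0.
have Q0 t : (0 <= Q t)%E by apply: integral_ge0 => x _; rewrite lee_fin sqr_ge0.
have mQ : measurable_fun (`]0, T[%classic : set (measurableTypeR R)) Q.
  by apply: (@tonelli (fun p => th p ^+ 2)) => [|p]; [exact: measurable_funX|exact: sqr_ge0].
have E t : ((`|((H1_norm \o slice (fun p => (th p, gr p))) \_ `]0%R, T[) t| `^ 2) =
    ((fun t => Q t + S t) \_ `]0%R, T[) t)%E.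
  rewrite !patchE; case: ifPn => _; last by rewrite abse0 poweR0r.
  rewrite gee0_abs ?poweR_ge0// /H1_norm -poweRrM mulVf// L2_vnorm_sqr L2_norm_sqr.
  by rewrite poweRe1//; exact: (adde_ge0 (Q0 t) (S0 t)).
under [leRHS]eq_integral do rewrite E.
apply: ge0_le_integral => //.
- by move=> t _; rewrite patchE; case: ifPn => // _; exact: S0.
- apply/(measurable_restrictT _ _).1; first exact: measurable_itv.
  exact: measurable_gradient_energy.
- by apply/(measurable_restrictT _ _).1; [exact: measurable_itv|apply: emeasurable_funD => //; exact: measurable_gradient_energy].
- move=> t _; rewrite !patchE; case: ifPn => // _; exact: leeDr.
Qed.

(** All properties of the slices that hold at almost every time ([good_ae]), with bounds [A] and [U]
    independent of the time. *)
Definition good A U t := [/\ divergence_free (slice u t),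
  H1_space (slice (fun p => (th p, gr p)) t), (L2_norm (slice th t) <= A%:E)%E &
  {ae vol, forall x i, `|u (t, x) ord0 i| <= U}].

Lemma good_ae : exists A U, [/\ 0 <= A, 0 <= U & {ae mu, forall t, 0 < t < T -> good A U t}].
Proof.
have [U U0 HU] := speed_bound uL.
have [_ [_ _ [_ _ /Lnorm_oo_bound[A A0 HA]] [_ H1 _]] _] := ws.
exists A, U; split=> //.
have := ae_timeI (ae_timeI uD HU) (ae_timeI HA H1); apply: ae_timeS.
move=> t [[Ht1 Ht2] [Ht3 Ht4]] tT; split; [exact: Ht1|exact: Ht4| |exact: Ht2].
move: Ht3; rewrite patchE mem_set/= ?in_itv//=; apply: le_trans; exact: lee_abs.
Qed.

End weak.
End solution.

(** * Test functions of product form, and L^2 slices *)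

Section precomposition.
Context {R : realType} {V W : normedModType R}.
Variable L : W -> V.
Hypotheses (lL : forall (h : R) v x, L (h *: v + x) = h *: L v + L x) (cL : continuous L).

Lemma derive_precomp (f : V -> R) x v : 'D_v (fun y => f (L y)) x = 'D_(L v) f (L x).
Proof. by rewrite derive_dir [RHS]derive_dir; under eq_fun do rewrite lL. Qed.

Lemma Ck_precomp n (f : V -> R) : Ck n f -> Ck n (fun y => f (L y)).
Proof.
elim: n f => [|n IH] f Cf.
  by split => // x; apply: continuous_comp; [exact: cL|exact: Ck_continuous Cf _].
apply: (@CkS _ _ _ _ (fun v y => 'D_(L v) f (L y))) => [v x|x|v].
- split; last exact: derive_precomp.
  have H := (derivable_dir f (L x) (L v)).1 (@Ck_derivable _ _ n f (L v) (L x) Cf).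
  by apply/derivable_dir; under eq_fun do rewrite lL.
- by apply: continuous_comp; [exact: cL|exact: Ck_continuous Cf _].
- exact: (IH ('D_(L v) f) (Ck_derive (L v) Cf)).
Qed.

End precomposition.

Section tensor_products.
Context {R : realType}.

Lemma derive_scale {V : normedModType R} (c : R) (f : V -> R) x v : derivable f x v ->
  'D_v (fun y => c * f y) x = c * 'D_v f x.
Proof. exact: deriveZ. Qed.

Let eq_derive {V : normedModType R} (f g : V -> R) x v : f =1 g -> 'D_v f x = 'D_v g x.
Proof. by move=> /funext ->. Qed.

Section state_test.
Context {d : nat}.
Variables (eta : R -> R) (psi : 'rV[R]_d -> R).
Hypotheses (Ceta : Coo eta) (spsi : torus_smooth psi).

Definition state_test (p : R * 'rV[R]_d) : R := eta p.1 * psi p.2.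

Lemma dt_state_test t x : dt state_test (t, x) = 'D_1 eta t * psi x.
Proof.
rewrite /dt derive_dir /state_test/= mulrC [in RHS]derive_dir -derive_scale//.
  apply: eq_derive => h /=; rewrite scaler0 add0r mulrC.
  by congr (_ * eta (_ + _)).
exact: (derivable_dir eta t 1).1 (Coo_derivable Ceta).
Qed.

Lemma dx_state_test i t x : dx i state_test (t, x) = eta t * 'D_(Defs.basis i) psi x.
Proof.
rewrite /dx derive_dir /state_test/= [in RHS]derive_dir -derive_scale//.
  apply: eq_derive => h.
  by rewrite scaler0 add0r.
exact: (derivable_dir psi x (Defs.basis i)).1 (Coo_derivable spsi.2).
Qed.

Lemma test_function_state_test (T : R) :
  (exists2 T', T' < T & forall t, T' < t -> eta t = 0) -> test_function T state_test.
Proof.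
move=> [T' T'T etaT]; split.
- by move=> t _ x k; rewrite /state_test/= spsi.1.
- apply: Coo_smooth_on => m; apply: CkM.
    by apply: (@Ck_precomp _ _ _ fst) => // z; exact: cvg_fst.
  by apply: (@Ck_precomp _ _ _ snd) => // [z|]; [exact: cvg_snd|exact: spsi.2].
- by exists T' => // t x _ /etaT; rewrite /state_test/= => ->; rewrite mul0r.
Qed.

End state_test.

Section kinetic_test.
Context {d : nat}.
Variables (eta zeta : R -> R).
Hypotheses (Ceta : Coo eta) (Czeta : Coo zeta).

Definition kinetic_test (p : R * 'rV[R]_d * R) : R := eta p.1.1 * zeta p.2.

Lemma dxi_kinetic_test (f : R -> R) (h : R -> R) t x xi : Coo f ->
  dxi (fun p : R * 'rV[R]_d * R => h p.1.1 * f p.2) (t, x, xi) = h t * 'D_1 f xi.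
Proof.
move=> Cf; rewrite /dxi derive_dir/= [in RHS]derive_dir -derive_scale//.
  by apply: eq_derive => y; rewrite scaler0 add0r.
exact: (derivable_dir f xi 1).1 (Coo_derivable Cf).
Qed.

Lemma dxi2_kinetic_test t x xi :
  dxi (dxi kinetic_test) (t, x, xi) = eta t * 'D_1 ('D_1 zeta) xi.
Proof.
rewrite -(@dxi_kinetic_test ('D_1 zeta) eta t x)//; last exact: Coo_derive.
by congr (dxi _ _); apply/funext => -[[s y] z]; exact: dxi_kinetic_test.
Qed.

Lemma kinetic_test_functionP (T : R) :
  (exists2 T', T' < T & forall t, T' < t -> eta t = 0) ->
  (exists M, forall xi, M < `|xi| -> zeta xi = 0) -> kinetic_test_function T kinetic_test.
Proof.
move=> [T' T'T etaT] [M zetaM]; split.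
- by [].
- apply: Coo_smooth_on => m; apply: CkM.
    apply: (@Ck_precomp _ _ _ (fun p : R * 'rV[R]_d * R => p.1.1)) => //.
    by move=> p; apply: (@continuous_comp _ _ _ fst fst); exact: cvg_fst.
  by apply: (@Ck_precomp _ _ _ snd) => // z; exact: cvg_snd.
- exists T' => //; exists M => t x xi _ /orP[/etaT|/zetaM]; rewrite /kinetic_test/= => ->.
    by rewrite mul0r.
  by rewrite mulr0.
Qed.

End kinetic_test.
End tensor_products.

Section L2_theory.
Context {R : realType} {d : nat}.
Local Notation vol := (torus_measure R d).
Local Notation point := 'rV[R]_d.

Lemma sqnorm_L2_norm (f : point -> R) : sq_integrable vol f ->
  ((sqnorm vol f)%:E = L2_norm f ^+ 2)%E.
Proof. by move=> [_ If]; rewrite L2_norm_sqr /sqnorm /Rintegral fineK//; exact: integrable_fin_num. Qed.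

Lemma sq_integrable_fin (f : point -> R) : measurable_fun setT f ->
  (\int[vol]_x (f x ^+ 2)%:E < +oo)%E -> sq_integrable vol f.
Proof.
move=> mf fi; split=> //; apply/integrableP; split.
  by apply/measurable_EFinP; exact: measurable_funX.
by under eq_integral do rewrite /= ger0_norm ?sqr_ge0//.
Qed.

Lemma L2_space_sq_integrable (f : point -> R) : L2_space f -> sq_integrable vol f.
Proof.
move=> [_ mf fi]; apply: sq_integrable_fin => //.
by rewrite -L2_norm_sqr -poweR2 ?Lnorm_ge0// poweR_lty.
Qed.

Lemma L2_vspace_sq_integrable (g : point -> point) i : L2_vspace g ->
  sq_integrable vol (fun x => g x ord0 i).
Proof.
move=> [_ mg gi].
have mgi j : measurable_fun setT (fun x => g x ord0 j).
  exact: (measurableT_comp (@measurable_coord _ (measurableTypeR R) d j) mg).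
apply: sq_integrable_fin => //.
have : (L2_vnorm g ^+ 2 < +oo)%E by rewrite -poweR2 ?Lnorm_ge0// poweR_lty.
rewrite L2_vnorm_sqr; apply: le_lt_trans.
apply: ge0_le_integral => //.
- by move=> x _; rewrite lee_fin sqr_ge0.
- by apply/measurable_EFinP; exact: measurable_funX.
- by apply/measurable_EFinP; apply: measurable_sum => j; exact: measurable_funX.
- move=> x _; rewrite lee_fin (bigD1 i)//= lerDl.
  by apply: sumr_ge0 => j _; exact: sqr_ge0.
Qed.

End L2_theory.

(** * The maximum principle for weak solutions *)

Section max_principle.
Context {R : realType} {d : nat}.
Add Field Rfield : (fcar_field R).
Local Notation mu := (@lebesgue_measure R).
Local Notation vol := (torus_measure R d).
Local Notation point := 'rV[R]_d.
Local Notation sqi := (sq_integrable vol).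
Local Notation nrm := (sqnorm vol).
Local Notation L1 f := (mu.-integrable setT (EFin \o f)).
Local Notation e_ := Defs.basis.

Variables (T kappa M : R) (u : R * point -> point) (th0 : point -> R).
Variables (th : R * point -> R) (gr : R * point -> point).
Hypothesis kappa0 : 0 <= kappa.
Hypothesis uD : {ae mu, forall t, 0 < t < T -> divergence_free (slice u t)}.
Hypothesis uL : Loo_spacetime T u.
Hypothesis ws : weak_solution T kappa u th0 th gr.
Hypotheses (mth0 : measurable_fun setT th0) (th0M : forall x, `|th0 x| <= M).

Section good_times.
Variables (A U : R) (N : set (measurableTypeR R)).
Hypotheses (A0 : 0 <= A) (U0 : 0 <= U) (mN : measurable N) (N0 : mu N = 0%E).
Hypothesis goodN : forall t, 0 < t < T -> ~ N t -> good u th gr A U t.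

(** Away from the good times in (0, T) all data are replaced by 0, so that the hypotheses of
    [barrier_vanishes] hold at every time and not only at almost every one. *)
Let E (t : R) : bool := (0 < t < T) && (t \notin N).

Let goodE t : E t -> good u th gr A U t.
Proof. by move=> /andP[tT]; rewrite notin_setE; exact: goodN. Qed.

Let ED t : E t -> 0 < t < T. Proof. by case/andP. Qed.

Let cut (f : R * point -> R) (p : measurableTypeR R * point) : R := if E p.1 then f p else 0.

Let mcut f : measurable_fun [set p : measurableTypeR R * point | 0 < p.1 < T] f ->
  measurable_fun setT (cut f).
Proof.
move=> /measurable_cutoff mf.
pose B : set (measurableTypeR R * point) := ~` N `*` setT.
have mB : measurable B by apply: measurableX => //; exact: measurableC.
rewrite (_ : cut f = cutoff T f \_ B).
  by apply: (measurable_restrictT _ _).1 => //; exact: measurable_funS mf.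
apply/funext => -[t x]; rewrite patchE /cut /E /cutoff/=.
have -> : ((t, x) \in B) = (t \notin N).
  apply/idP/idP; rewrite inE /B/= notin_setE; first by case.
  by move=> Nt; split.
by case: (t \notin N); rewrite ?andbT ?andbF.
Qed.

Let mslice (f : measurableTypeR R * point -> R) t : measurable_fun setT f ->
  measurable_fun setT (fun x => f (t, x)).
Proof. by move=> mf; apply: (measurableT_comp mf); exact: pair1_measurable. Qed.

(** The velocity is bounded by [U] only for almost every point; discarding larger values makes the
    bound hold everywhere and alters a good slice on a null set only ([V_ae]). *)
Let clip (y : R) : R := if `|y| <= U then y else 0.

Let mclip : measurable_fun setT clip.
Proof.
rewrite (_ : clip = id \_ [set` `[- U, U]]).
  by apply: (measurable_restrictT _ _).1 => //; exact: measurable_itv.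
by apply/funext => y; rewrite patchE /clip mem_setE in_itv/= ler_norml.
Qed.

Let q t x := cut th (t, x).
Let G i t x := cut (fun p => gr p ord0 i) (t, x).
Let V i t x := clip (cut (fun p => u p ord0 i) (t, x)).

Let mq2 : measurable_fun setT (fun p : measurableTypeR R * point => q p.1 p.2).
Proof.
by rewrite (_ : (fun p => _) = cut th); [apply: mcut; case: ws => _ []|apply/funext => -[]].
Qed.

Let mG2 i : measurable_fun setT (fun p : measurableTypeR R * point => G i p.1 p.2).
Proof.
rewrite (_ : (fun p => _) = cut (fun p => gr p ord0 i)); last by apply/funext => -[].
by apply: mcut; exact: (measurable_gradient ws).
Qed.

Let mV2 i : measurable_fun setT (fun p : measurableTypeR R * point => V i p.1 p.2).
Proof.
rewrite (_ : (fun p => _) = clip \o cut (fun p => u p ord0 i)); last by apply/funext => -[].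
by apply: measurableT_comp => //; apply: mcut; exact: (measurable_velocity uL).
Qed.

Let mV i t : measurable_fun setT (V i t).
Proof. exact: (@mslice (fun p => V i p.1 p.2) t (mV2 i)). Qed.

Let VU i t x : `|V i t x| <= U.
Proof. by rewrite /V /clip; case: ifP => // _; rewrite normr0. Qed.

Let qE t : E t -> q t = slice th t.
Proof. by move=> Et; apply/funext => x; rewrite /q /cut/= Et. Qed.

Let q_out t : ~~ E t -> q t = fun=> 0.
Proof. by move=> /negPf Et; apply/funext => x; rewrite /q /cut/= Et. Qed.

Let GE i t : E t -> G i t = fun x => slice gr t x ord0 i.
Proof. by move=> Et; apply/funext => x; rewrite /G /cut/= Et. Qed.

Let G_out i t : ~~ E t -> G i t = fun=> 0.
Proof. by move=> /negPf Et; apply/funext => x; rewrite /G /cut/= Et. Qed.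

Let sq t : sqi (q t).
Proof.
have [Et|Et] := boolP (E t); last by rewrite q_out//; exact: sq_integrable_cst.
by rewrite qE//; have [_ [H _ _] _ _] := goodE Et; exact: L2_space_sq_integrable H.
Qed.

Let qA t : nrm (q t) <= A ^+ 2.
Proof.
have [Et|Et] := boolP (E t); last first.
  by rewrite q_out// /sqnorm Rintegral_fun_cst expr0n sqr_ge0.
have [_ _ tA _] := goodE Et.
rewrite -lee_fin (sqnorm_L2_norm (sq t)) qE//.
by rewrite EFin_expe; apply: lee_pmul => //; exact: Lnorm_ge0.
Qed.

Let sG i t : sqi (G i t).
Proof.
have [Et|Et] := boolP (E t); last by rewrite G_out//; exact: sq_integrable_cst.
by rewrite GE//; have [_ [_ H _] _ _] := goodE Et; exact: (L2_vspace_sq_integrable i H).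
Qed.

Let IG i : L1 (fun t => nrm (G i t)).
Proof.
have mGn : measurable_fun setT (fun t : measurableTypeR R => nrm (G i t)).
  by apply: (@measurable_Rintegral_snd _ _ _ vol (fun p => G i p.1 p.2 ^+ 2)); exact: measurable_funX.
apply/integrableP; split; first exact/measurable_EFinP.
apply: le_lt_trans (gradient_energy_fin ws).
rewrite [leRHS]integral_mkcond; apply: ge0_le_integral => //.
- by apply: measurableT_comp => //; exact/measurable_EFinP.
- apply/(measurable_restrictT _ _).1; first exact: measurable_itv.
  exact: (measurable_gradient_energy ws).
- move=> t _; rewrite /= ger0_norm ?sqnorm_ge0// patchE.
  have [Et|Et] := boolP (E t); last first.
    rewrite G_out// /sqnorm Rintegral_fun_cst expr0n; case: ifP => // _.
    by apply: integral_ge0 => x _; rewrite lee_fin sumr_ge0// => j _; exact: sqr_ge0.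
  rewrite mem_set/=; last by rewrite in_itv/=; exact: ED.
  rewrite (sqnorm_L2_norm (sG i t)) L2_norm_sqr GE//.
  have [_ [_ [_ mg _] _] _ _] := goodE Et.
  have mgj j : measurable_fun setT (fun x => slice gr t x ord0 j).
    exact: (measurableT_comp (@measurable_coord _ (measurableTypeR R) d j) mg).
  apply: ge0_le_integral => //.
  + by move=> x _; rewrite lee_fin sqr_ge0.
  + by apply/measurable_EFinP; exact: measurable_funX.
  + by apply/measurable_EFinP; apply: measurable_sum => j; apply: measurable_funX; exact: mgj.
  + move=> x _; rewrite lee_fin (bigD1 i)//= lerDl.
    by apply: sumr_ge0 => j _; exact: sqr_ge0.
Qed.

Let gradq t psi : torus_smooth psi -> forall i,
  \int[vol]_x (q t x * 'D_(e_ i) psi x) = - \int[vol]_x (G i t x * psi x).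
Proof.
move=> [ppsi Cpsi] i; have [Et|Et] := boolP (E t); last first.
  rewrite q_out// G_out//; under eq_Rintegral do rewrite mul0r.
  by under [in RHS]eq_Rintegral do rewrite mul0r; rewrite Rintegral_fun_cst oppr0.
have [_ [_ _ H] _ _] := goodE Et.
by rewrite qE// GE//; apply: H => //; exact: Coo_smooth_on.
Qed.

Let V_ae t : E t -> {ae vol, forall x i, V i t x = u (t, x) ord0 i}.
Proof.
move=> Et; have [_ _ _] := goodE Et; apply: filterS => x uU i.
by rewrite /V /clip /cut/= Et uU.
Qed.

Let mu_slice t i : E t -> measurable_fun setT (fun x => u (t, x) ord0 i).
Proof.
move=> Et; have := @mslice (cut (fun p => u p ord0 i)) t (mcut (measurable_velocity uL i)).
by rewrite /cut/= Et.
Qed.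

Let divV t psi : torus_smooth psi ->
  \int[vol]_x (\sum_(i < d) V i t x * 'D_(e_ i) psi x) = 0.
Proof.
move=> spsi; have [Et|/negPf Et] := boolP (E t); last first.
  rewrite -[RHS](@Rintegral_fun_cst _ _ _ vol 0); apply: eq_Rintegral => x _; apply: big1 => i _.
  by rewrite /V /cut/= Et /clip; case: ifP => _; rewrite mul0r.
have [H _ _ _] := goodE Et.
rewrite -[RHS](H psi spsi.1 (Coo_smooth_on (A := setT) spsi.2)) /Rintegral; congr fine.
have mD i : measurable_fun setT ('D_(e_ i) psi).
  exact: torus_smooth_measurable (torus_smooth_derive (e_ i) spsi).
apply: ae_eq_integral => //.
- apply/measurable_EFinP; apply: measurable_sum => i; exact: measurable_funM.
- apply/measurable_EFinP; apply: measurable_sum => i; apply: measurable_funM => //; exact: mu_slice.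
- apply: filterS (V_ae Et) => x Vx _; congr EFin; apply: eq_bigr => i _.
  by rewrite Vx.
Qed.

Let rhs (psi : point -> R) (t : R) : R :=
  \sum_i \int[vol]_x ((q t x * V i t x) * 'D_(e_ i) psi x) -
  kappa * \sum_i \int[vol]_x (G i t x * 'D_(e_ i) psi x).

Section tested.
Variables (psi : point -> R) (eta : R -> R).
Hypotheses (spsi : torus_smooth psi) (Ceta : Coo eta).

Let mDpsi i : measurable_fun setT ('D_(e_ i) psi).
Proof. exact: torus_smooth_measurable (torus_smooth_derive (e_ i) spsi). Qed.

Let sDpsi i : sqi ('D_(e_ i) psi).
Proof.
have [K _ DK] := torus_smooth_bounded (torus_smooth_derive (e_ i) spsi).
exact: sq_integrable_bounded (mDpsi i) DK.
Qed.

Let mpsi : measurable_fun setT psi := torus_smooth_measurable spsi.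

Let spsi2 : sqi psi.
Proof. by have [K _ psiK] := torus_smooth_bounded spsi; exact: sq_integrable_bounded mpsi psiK. Qed.

Let meta : measurable_fun [set: R] eta.
Proof. by apply: continuous_measurable_fun; apply: Coo_continuous. Qed.

Let mdeta : measurable_fun [set: R] ('D_1 eta).
Proof. by apply: continuous_measurable_fun; apply: Coo_continuous; exact: Coo_derive. Qed.

Let mpsi2 (f : point -> R) : measurable_fun setT f ->
  measurable_fun setT (fun p : measurableTypeR R * point => f p.2).
Proof. by move=> mf; exact: (measurableT_comp mf measurable_snd). Qed.

Let lhs t : R := (\int[vol]_x (q t x * psi x)) * 'D_1 eta t + rhs psi t * eta t.

Let lhs_out t : ~~ E t -> lhs t = 0.
Proof.
move=> Et; have Z (f : point -> R) : (forall x, f x = 0) -> \int[vol]_x f x = 0.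
  by move=> /funext ->; rewrite Rintegral_fun_cst.
have Z1 : \int[vol]_x (q t x * psi x) = 0 by apply: Z => x; rewrite q_out// mul0r.
have Z2 : rhs psi t = 0.
  rewrite /rhs; set s1 := \sum_i _; set s2 := \sum_i _.
  have -> : s1 = 0 by apply: big1 => i _; apply: Z => x; rewrite q_out// !mul0r.
  have -> : s2 = 0 by apply: big1 => i _; apply: Z => x; rewrite G_out// mul0r.
  by rewrite mulr0 subr0.
by rewrite /lhs Z1 Z2 !mul0r addr0.
Qed.

Let measurable_lhs : measurable_fun [set: measurableTypeR R] lhs.
Proof.
apply: measurable_funD; apply: measurable_funM => //.
  apply: (@measurable_Rintegral_snd _ _ _ vol (fun p => q p.1 p.2 * psi p.2)).
  by apply: measurable_funM => //; exact: (mpsi2 mpsi).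
apply: measurable_funB.
  apply: measurable_sum => i.
  apply: (@measurable_Rintegral_snd _ _ _ vol (fun p => (q p.1 p.2 * V i p.1 p.2) * 'D_(e_ i) psi p.2)).
  by apply: measurable_funM => //; [exact: measurable_funM|exact: (mpsi2 (mDpsi i))].
apply: measurable_funM => //; apply: measurable_sum => i.
apply: (@measurable_Rintegral_snd _ _ _ vol (fun p => G i p.1 p.2 * 'D_(e_ i) psi p.2)).
by apply: measurable_funM => //; exact: (mpsi2 (mDpsi i)).
Qed.

Let integrand (p : measurableTypeR R * point) : R :=
  th p * dt (state_test eta psi) p +
  th p * (\sum_(i < d) u p ord0 i * dx i (state_test eta psi) p) -
  kappa * (\sum_(i < d) gr p ord0 i * dx i (state_test eta psi) p).

Let measurable_integrand :
  measurable_fun [set p : measurableTypeR R * point | 0 < p.1 < T] integrand.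
Proof.
have mth : measurable_fun [set p : measurableTypeR R * point | 0 < p.1 < T] th by case: ws => _ [].
have mdt : measurable_fun [set: measurableTypeR R * point] (dt (state_test eta psi)).
  rewrite (_ : dt _ = fun p => 'D_1 eta p.1 * psi p.2).
    by apply: measurable_funM; [exact: (measurableT_comp mdeta measurable_fst)|exact: (mpsi2 mpsi)].
  by apply/funext => -[t x]; exact: dt_state_test.
have mdx i : measurable_fun [set: measurableTypeR R * point] (dx i (state_test eta psi)).
  rewrite (_ : dx i _ = fun p => eta p.1 * 'D_(e_ i) psi p.2).
    by apply: measurable_funM; [exact: (measurableT_comp meta measurable_fst)|exact: (mpsi2 (mDpsi i))].
  by apply/funext => -[t x]; exact: dx_state_test.
apply: measurable_funB; first apply: measurable_funD.
- by apply: measurable_funM => //; exact: measurable_funTS.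
- apply: measurable_funM => //; apply: measurable_sum => i; apply: measurable_funM.
    exact: (measurable_velocity uL).
  exact: measurable_funTS.
- apply: measurable_funM => //; apply: measurable_sum => i; apply: measurable_funM.
    exact: (measurable_gradient ws).
  exact: measurable_funTS.
Qed.

Let integrable_funZr (f : point -> R) (c : R) : vol.-integrable setT (EFin \o f) ->
  vol.-integrable setT (EFin \o (fun x => f x * c)).
Proof.
move=> If; rewrite (_ : (fun x => _) = fun x => c * f x); first exact: integrable_funZ.
by apply/funext => x; rewrite mulrC.
Qed.

(** The three terms of the weak formulation, tested with a product, separate into moments times
    functions of time. The integrands agree for almost every point only, because of the clipping. *)
Let integrand_good t : E t -> \int[vol]_x integrand (t, x) = lhs t.
Proof.
move=> Et.
have I1 : vol.-integrable setT (EFin \o (fun x => q t x * psi x)) by exact: sq_integrable_mul.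
have I2 i : vol.-integrable setT (EFin \o (fun x => (q t x * V i t x) * 'D_(e_ i) psi x)).
  by apply: sq_integrable_mul => //; exact: sq_integrable_bounded_mul (sq t) (mV i t) (VU i t).
have I3 i : vol.-integrable setT (EFin \o (fun x => G i t x * 'D_(e_ i) psi x)).
  exact: sq_integrable_mul.
rewrite /lhs /rhs -!Rintegral_sum//.
have J2 := @integrable_fun_sum _ _ _ vol _ (index_enum 'I_d) _ I2.
have J3 := @integrable_fun_sum _ _ _ vol _ (index_enum 'I_d) _ I3.
rewrite -(RintegralZl kappa measurableT J3) -RintegralB//; last exact: integrable_funZ.
have J23 := integrable_funB J2 (integrable_funZ kappa J3).
have K1 : vol.-integrable setT (EFin \o (fun x => q t x * psi x * 'D_1 eta t)).
  exact: (integrable_funZr _ I1).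
have K2 : vol.-integrable setT (EFin \o (fun x => (\sum_i q t x * V i t x * 'D_(e_ i) psi x -
    kappa * \sum_i G i t x * 'D_(e_ i) psi x) * eta t)).
  exact: (integrable_funZr _ J23).
rewrite -(RintegralZr _ measurableT J23) -(RintegralZr _ measurableT I1) -RintegralD//.
rewrite /Rintegral; congr fine; apply: ae_eq_integral => //.
- apply/measurable_EFinP; have := mslice t (measurable_cutoff measurable_integrand).
  by rewrite /cutoff/= (ED Et).
- apply/measurable_EFinP; exact: integrable_measurable (integrable_funD K1 K2).
- apply: filterS (V_ae Et) => x Vx _; congr EFin.
  rewrite /integrand dt_state_test// (qE Et) /slice.
  set s1 := \sum_(i < d) _; set s2 := \sum_(i < d) _; set s3 := \sum_i _; set s4 := \sum_i _.
  have E3 : s3 * eta t = th (t, x) * s1.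
    rewrite /s1 /s3 mulr_suml mulr_sumr; apply: eq_bigr => i _.
    rewrite dx_state_test// Vx; set a := th _; set b := u _ _ _; set D := 'D_(e_ i) psi x.
    by set c := eta t; fring.
  have E4 : s4 * eta t = s2.
    rewrite /s2 /s4 mulr_suml; apply: eq_bigr => i _.
    by rewrite dx_state_test// GE// /slice mulrAC mulrA.
  rewrite mulrBl E3 -[kappa * s4 * _]mulrA E4 addrA; congr (_ + _ - _).
  by rewrite mulrAC mulrA.
Qed.

Lemma weak_reduced : (exists2 T', T' < T & forall t, T' < t -> eta t = 0) ->
  \int[mu]_t lhs t + (\int[vol]_x (th0 x * psi x)) * eta 0 = 0.
Proof.
move=> etaT; have [_ _ /(_ _ (test_function_state_test Ceta spsi etaT))] := ws.
move=> H; rewrite -[RHS]H; congr (_ + _).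
  pose F t := \int[vol]_x (cutoff T integrand (t, x)).
  have mF : measurable_fun [set: measurableTypeR R] F.
    by apply: measurable_Rintegral_snd; exact: measurable_cutoff.
  transitivity (\int[mu]_t F t).
    rewrite /Rintegral; congr fine; apply: ae_eq_integral => //.
    - exact/measurable_EFinP.
    - exact/measurable_EFinP.
    (* The two functions of time can differ only on the null set [N] of bad times. *)
    - exists N; split=> // t /= /not_implyP[_ /=]; apply: contra_notP => Nt.
      congr EFin; have [tT|tT] := boolP (0 < t < T).
        by rewrite /F /cutoff/= tT integrand_good// /E tT notin_setE.
      by rewrite /F /cutoff/= (negPf tT) Rintegral_fun_cst lhs_out// /E negb_and tT.
  rewrite [RHS]Rintegral_mkcond; apply: eq_Rintegral => t _.
  rewrite patchE /F /cutoff/= mem_setE in_itv/=; case: ifP => // _.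
  by rewrite Rintegral_fun_cst.
rewrite -RintegralZr//.
  apply: eq_Rintegral => x _; rewrite /state_test/=.
  by set a := th0 x; set b := psi x; set c := eta 0; fring.
have [K _ psiK] := torus_smooth_bounded spsi.
by apply: (@integrable_bounded_mul _ _ _ _ _ _ K) => //; exact: (bounded_integrable vol mth0 th0M).
Qed.

End tested.

(** A nonnegative function with integral 0 vanishes almost everywhere, and the zeros of [barrier M]
    lie in [-M, M]. *)
Lemma max_principle_good : {ae mu, forall t, 0 < t < T -> {ae vol, forall x, `|th (t, x)| <= M}}.
Proof.
have H : {ae mu, forall t, 0 < t < T -> \int[vol]_x barrier M (q t x) = 0}.
  apply: (@barrier_vanishes R d M U (A ^+ 2) T kappa q G V th0) => //.
  - by move=> t x tT; rewrite q_out// /E negb_and tT.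
  - by move=> i t x tT; rewrite G_out// /E negb_and tT.
  - by move=> psi eta spsi Ceta etaT; exact: weak_reduced.
have aeN : {ae mu, forall t, ~ N t} by exists N; split=> // t /= /contrapT.
have := ae_timeI H aeN; apply: ae_timeS => t [Ht Nt] tT.
have Et : E t by rewrite /E tT notin_setE.
have Ib := barrier_integrable M (sq t).
have B0 : (\int[vol]_x `|(barrier M (q t x))%:E| = 0)%E.
  under eq_integral do rewrite gee0_abs ?lee_fin ?barrier_ge0//.
  by have := fineK (integrable_fin_num measurableT Ib) => /= <-; congr EFin; exact: Ht tT.
have mb : measurable_fun setT (fun x => (barrier M (q t x))%:E).
  by apply/measurable_EFinP; exact: (integrable_measurable Ib).
have := (ae_eq_integral_abs vol measurableT mb).1 B0; apply: filterS => x /(_ I)[].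
by rewrite (qE Et); exact: barrier_eq0.
Qed.

End good_times.
Theorem max_principle :
  {ae mu, forall t, 0 < t < T -> {ae vol, forall x, `|th (t, x)| <= M}}.
Proof.
have [A [U [A0 U0 [N [mN N0 goodN]]]]] := good_ae uD uL ws.
apply: (max_principle_good (A := A) (U := U) (N := N)) => // t tT Nt.
by apply: contrapT => bad; apply: Nt; apply: goodN => /(_ tT).
Qed.

End max_principle.

(** * The test function in the kinetic variable and the lower bound of the defect *)

Section plateau.
Context {R : realType}.
Local Notation mu := (@lebesgue_measure R).
Variable M : R.

(** The identity on [-M, M], cut off smoothly to 0 beyond M + 1: compactly supported, yet of
    derivative 1 inside. *)
Definition plateau (xi : R) : R := xi * (smooth_step (xi - M) * smooth_step (- xi - M)).

Lemma Coo_plateau : Coo plateau.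
Proof.
move=> m; apply: CkM; first exact: Coo_id.
apply: CkM; apply: (Ck_comp (g := smooth_step)); try exact: Coo_step.
- by apply: CkD; [exact: Coo_id|exact: Ck_cst].
- by apply: CkD; [apply: CkN; exact: Coo_id|exact: Ck_cst].
Qed.

Lemma plateau_out xi : M + 1 < `|xi| -> plateau xi = 0.
Proof.
rewrite /plateau lter_normr => /orP[]; rewrite -ltrBrDl => /ltW H.
  by rewrite step_ge1 ?mul0r ?mulr0// -lerBlDr opprK addrC; rewrite lerBrDl in H.
by rewrite [X in _ * (_ * X)]step_ge1 ?mulr0.
Qed.

Lemma plateau_in xi : `|xi| <= M -> plateau xi = xi.
Proof.
rewrite ler_norml => /andP[H1 H2]; rewrite /plateau !step_le0 ?mulr1// subr_le0//.
by rewrite lerNl.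
Qed.

Lemma derive_plateau_in xi : `|xi| < M -> 'D_1 plateau xi = 1.
Proof.
move=> xiM; rewrite -[RHS](@derive_val _ _ _ _ _ _ _ (is_derive_id xi (1 : R))).
have O : open [set y : R | `|y| < M].
  by apply: (@open_comp _ _ (fun y : R => `|y|) [set z | z < M]) => [y _|]; [exact: norm_continuous|exact: open_lt].
apply: near_eq_derive; apply: filterS (open_nbhs_nbhs (conj O xiM)) => y /= yM.
exact/plateau_in/ltW.
Qed.

Lemma derive_zero_out (f : R -> R) (K xi : R) : (forall y, K < `|y| -> f y = 0) ->
  K < `|xi| -> 'D_1 f xi = 0.
Proof.
move=> f0 xiK; rewrite -[RHS](@derive_val _ _ _ _ _ _ _ (is_derive_cst 0 xi (1 : R))).
have O : open [set y : R | K < `|y|].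
  by apply: (@open_comp _ _ (fun y : R => `|y|) [set z | K < z]) => [y _|]; [exact: norm_continuous|exact: open_gt].
by apply: near_eq_derive; apply: filterS (open_nbhs_nbhs (conj O xiK)) => y /= /f0.
Qed.

End plateau.

Section half_line.
Context {R : realType}.
Local Notation mu := (@lebesgue_measure R).

(* The kinetic function of the value [s] integrates a derivative to its primitive at [s]. *)
Lemma integral_below (g : R -> R) (K c s : R) : Coo g -> (forall y, K < `|y| -> g y = 0) ->
  \int[mu]_xi (c * (if xi <= s then 1 else 0) * 'D_1 g xi) = c * g s.
Proof.
(* The point lies below both [s] and - K: to its left the derivative of [g] vanishes, and so does
   [g] at the point itself. *)
move=> Cg g0; pose a := Num.min s (- K) - 1.
have as_ : a < s by rewrite /a ltrBlDr (@le_lt_trans _ _ s) ?ltrDl// ge_min lexx.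
have aK x : x <= a -> K < `|x|.
  move=> xa; rewrite lter_normr ltrNr; apply/orP; right; apply: le_lt_trans xa _.
  by rewrite /a ltrBlDr (@le_lt_trans _ _ (- K)) ?ltrDl// ge_min lexx orbT.
have cg : continuous g by apply: Coo_continuous.
have cdg : continuous ('D_1 g) by apply: Coo_continuous; exact: Coo_derive.
have Idg : mu.-integrable `[a, s] (EFin \o 'D_1 g).
  apply: continuous_compact_integrable; first exact: segment_compact.
  exact: continuous_subspaceT.
transitivity (\int[mu]_(xi in `[a, s]) (c * 'D_1 g xi)).
  rewrite [RHS]Rintegral_mkcond; apply: eq_Rintegral => x _.
  rewrite patchE mem_setE in_itv/=; have [xs|xs] := leP x s; last by rewrite andbF mulr0 mul0r.
  rewrite mulr1 andbT; case: leP => // xa.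
  by rewrite (derive_zero_out g0) ?mulr0//; exact/aK/ltW.
rewrite (RintegralZl c _ Idg); last exact: measurable_itv.
rewrite /Rintegral (@continuous_FTC2 _ ('D_1 g) g _ _ as_).
- by rewrite /= (g0 a) ?subr0//; exact: aK.
- exact: continuous_subspaceT.
- split => [x _||]; first exact: Coo_derivable Cg.
    exact: cvg_at_right_filter (cg _).
  exact: cvg_at_left_filter (cg _).
- by move=> x _; rewrite derive1E.
Qed.

End half_line.

Section defect.
Context {R : realType} {d : nat}.
Add Field Rfield : (fcar_field R).
Local Notation mu := (@lebesgue_measure R).
Local Notation vol := (torus_measure R d).
Local Notation point := 'rV[R]_d.

Variables (T tau M kappa : R) (u : R * point -> point) (th0 : point -> R).
Variables (th : R * point -> R) (gr : R * point -> point) (eta : R -> R).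
Hypotheses (tau0 : 0 < tau) (tauT : tau < T) (kappa0 : 0 <= kappa).
Hypothesis ws : weak_solution T kappa u th0 th gr.
Hypothesis thM : {ae mu, forall t, 0 < t < T -> {ae vol, forall x, `|th (t, x)| <= M}}.
Hypotheses (Ceta : Coo eta) (eta0 : forall t, 0 <= eta t) (eta1 : forall t, eta t <= 1).
Hypothesis eta_tau : forall t, t <= tau -> eta t = 1.

Local Notation zeta := (@plateau R (M + 1)).
Local Notation phi := (@kinetic_test R d eta zeta).
Local Notation D := [set p : measurableTypeR R * point | 0 < p.1 < T].
Local Notation itv b := (`]0, b[%classic : set (measurableTypeR R)).

(** What is left of the integrand once the kinetic variable is integrated out ([defectE]). *)
Let I (p : measurableTypeR R * point) : R :=
  kappa * (\sum_(i < d) gr p ord0 i ^+ 2) * eta p.1 * 'D_1 zeta (th p).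

Let S t : \bar R := (\int[vol]_x (\sum_(i < d) gr (t, x) ord0 i ^+ 2)%:E)%E.

Let S0 t : (0 <= S t)%E.
Proof. by apply: integral_ge0 => x _; rewrite lee_fin sumr_ge0// => i _; exact: sqr_ge0. Qed.

Let mS : measurable_fun (itv T) S. Proof. exact: (measurable_gradient_energy ws). Qed.

Let Cg : Coo ('D_1 zeta). Proof. by apply: Coo_derive; exact: Coo_plateau. Qed.

Let meta : measurable_fun [set: R] eta.
Proof. by apply: continuous_measurable_fun; apply: Coo_continuous. Qed.

Let mg : measurable_fun [set: R] ('D_1 zeta).
Proof. by apply: continuous_measurable_fun; apply: Coo_continuous. Qed.

Let mI : measurable_fun D I.
Proof.
have mth : measurable_fun D th by case: ws => _ [].
apply: measurable_funM; last exact: (measurableT_comp mg mth).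
apply: measurable_funM.
  apply: measurable_funM => //; apply: measurable_sum => i; apply: measurable_funX.
  exact: (measurable_gradient ws).
exact: measurable_funTS (measurableT_comp meta measurable_fst).
Qed.

Let F t : R := \int[vol]_x I (t, x).

Let mF : measurable_fun (itv T) F.
Proof.
pose F' t := \int[vol]_x cutoff T I (t, x).
have mF' : measurable_fun setT F' by apply: measurable_Rintegral_snd; exact: measurable_cutoff.
apply: (eq_measurable_fun F'); last exact: measurable_funTS.
move=> t; rewrite inE/= in_itv/= => tT; apply: eq_Rintegral => x _.
by rewrite /cutoff/= tT.
Qed.

Let defectE : defect_distribution T kappa th gr phi = \int[mu]_(t in itv T) F t.
Proof.
apply: eq_Rintegral => t _; apply: eq_Rintegral => x _.
have g0 y : M + 1 + 1 < `|y| -> 'D_1 zeta y = 0.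
  by apply: derive_zero_out; exact: plateau_out.
rewrite /I -(@integral_below R ('D_1 zeta) (M + 1 + 1) _ _ Cg g0).
apply: eq_Rintegral => xi _; rewrite dxi2_kinetic_test; last exact: Coo_plateau.
rewrite /chi; set a := \sum_(i < d) _; set b := (if _ then _ else _).
by set c := eta t; set e := 'D_1 ('D_1 zeta) xi; fring.
Qed.

(** By the maximum principle theta lies in [-M, M], strictly inside the interval where the plateau
    at level M + 1 has derivative 1. *)
Let F_ae : {ae mu, forall t, 0 < t < T -> ((F t)%:E = (kappa * eta t)%:E * S t)%E}.
Proof.
have [_ [_ _ _ [_ H1 _]] _] := ws.
have := ae_timeI thM H1; apply: ae_timeS => t [tM tH] tT.
have [_ gL _] := tH tT.
have sg i := L2_vspace_sq_integrable i gL.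
pose Q x := \sum_(i < d) gr (t, x) ord0 i ^+ 2.
have IQ : vol.-integrable setT (EFin \o Q) by apply: integrable_fun_sum => i; exact: (sg i).2.
have -> : S t = (\int[vol]_x Q x)%:E.
  by rewrite /Rintegral fineK//; exact: integrable_fin_num.
rewrite -EFinM; congr EFin; rewrite -(RintegralZl _ measurableT IQ) /F /Rintegral; congr fine.
apply: ae_eq_integral => //.
- apply/measurable_EFinP.
  have := measurableT_comp (measurable_cutoff mI) (@pair1_measurable _ _ (measurableTypeR R) point t).
  by rewrite /comp /cutoff/= tT.
- by apply/measurable_EFinP; apply: measurable_funM => //; exact: integrable_measurable IQ.
- apply: filterS (tM tT) => x xM _; congr EFin.
  rewrite /I/= derive_plateau_in ?mulr1; first by rewrite mulrAC.
  by rewrite (le_lt_trans xM)// ltrDl.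
Qed.

(** The integrand is nonnegative and the cutoff is 1 before [tau], so restricting the time integral
    to (0, tau) leaves exactly the dissipation and can only decrease the value. *)
Lemma defect_lower (c : R) :
  (c%:E <= kappa%:E * \int[mu]_(s in `]0%R, tau[) (L2_vnorm (slice gr s) ^+ 2))%E ->
  c <= defect_distribution T kappa th gr phi.
Proof.
have -> : (\int[mu]_(s in `]0%R, tau[) (L2_vnorm (slice gr s) ^+ 2) = \int[mu]_(s in itv tau) S s)%E.
  by apply: eq_integral => s _; exact: L2_vnorm_sqr.
move=> cS.
have mkS : measurable_fun (itv T) (fun t => (kappa * eta t)%:E * S t)%E.
  apply: emeasurable_funM => //; apply/measurable_EFinP; apply: measurable_funM => //.
  exact: measurable_funTS.
have FE : (\int[mu]_(t in itv T) (F t)%:E = \int[mu]_(t in itv T) ((kappa * eta t)%:E * S t))%E.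
  by apply: ae_eq_integral => //; exact/measurable_EFinP.
have ke0 t : 0 <= kappa * eta t by rewrite mulr_ge0.
have kS0 t : (0 <= (kappa * eta t)%:E * S t)%E by rewrite mule_ge0// lee_fin.
have subT : itv tau `<=` itv T.
  by move=> t; rewrite /= !in_itv/= => /andP[-> /lt_trans]; apply.
(* Finiteness matters because [fine] sends an infinite integral to 0, which would destroy the lower
   bound. *)
have F_fin : (\int[mu]_(t in itv T) (F t)%:E < +oo)%E.
  rewrite FE; apply: (@le_lt_trans _ _ (kappa%:E * \int[mu]_(t in itv T) S t)%E); last first.
    by apply: lte_mul_pinfty => //; exact: (gradient_energy_fin ws).
  rewrite -ge0_integralZl//; apply: ge0_le_integral => //.
    by apply: emeasurable_funM => //.
  by move=> t _; apply: lee_wpmul2r => //; rewrite lee_fin ler_piMr.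
have F_ge : (c%:E <= \int[mu]_(t in itv T) (F t)%:E)%E.
  rewrite FE; apply: le_trans cS _; rewrite -ge0_integralZl//; last first.
    by apply: (@measurable_funS _ _ _ _ (itv T)) => //; exact: mS.
  rewrite (_ : (\int[mu]_(t in itv tau) (kappa%:E * S t) =
      \int[mu]_(t in itv tau) ((kappa * eta t)%:E * S t))%E).
    exact: ge0_subset_integral.
  apply: eq_integral => t; rewrite inE/= in_itv/= => /andP[_ /ltW /eta_tau ->].
  by rewrite mulr1.
rewrite defectE /Rintegral -lee_fin fineK// ge0_fin_numE// FE.
by apply: integral_ge0 => t _.
Qed.

End defect.

(** * Continuity of the initial state, the cutoff in time, and the conclusion *)

Section initial_state.
Context {R : realType} {d : nat}.

Lemma smooth_on_continuous (f : 'rV[R]_d -> R) : smooth_on setT f -> continuous f.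
Proof.
move=> sf x; have [A [g [Ax sg fg]]] := sf x Logic.I.
have [gx _] := sg nil x Ax.2.
have fgx : \forall y \near x, g y = f y.
  by apply: filterS (open_nbhs_nbhs Ax) => y Ay; rewrite fg// inE.
rewrite /prop_for /continuous_at -(nbhs_singleton fgx).
exact: cvg_trans (near_eq_cvg fgx) gx.
Qed.

End initial_state.

Section time_cutoff.
Context {R : realType}.
Variables (a b : R).
Hypothesis ab : a < b.

Definition time_cutoff (t : R) : R := smooth_step ((b - a)^-1 * (t - a)).

Lemma Coo_time_cutoff : Coo time_cutoff.
Proof.
move=> m; apply: (Ck_comp (g := smooth_step)); first exact: Coo_step.
by apply: CkZ; apply: CkD; [exact: Coo_id|exact: Ck_cst].
Qed.

Lemma time_cutoff_le t : t <= a -> time_cutoff t = 1.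
Proof.
move=> ta; rewrite /time_cutoff step_le0// pmulr_rle0 ?subr_le0//.
by rewrite invr_gt0 subr_gt0.
Qed.

Lemma time_cutoff_ge t : b <= t -> time_cutoff t = 0.
Proof.
by move=> bt; rewrite /time_cutoff step_ge1// ler_pdivlMl ?subr_gt0// mulr1 lerD2r.
Qed.

End time_cutoff.

Theorem theorem1p1 (R : realType) (d : nat) (tau T alpha : R)
    (theta0 : 'rV[R]_d -> R) (u : R * 'rV[R]_d -> 'rV[R]_d)
    (theta : R -> R * 'rV[R]_d -> R)
    (grad_theta : R -> R * 'rV[R]_d -> 'rV[R]_d) :
  0 < tau < T ->
  0 <= alpha < 1 ->
  torus_periodic theta0 ->
  smooth_on setT theta0 ->
  (forall t, 0 <= t <= T -> torus_periodic (slice u t)) ->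
  {ae lebesgue_measure, forall t, 0 < t < T -> divergence_free (slice u t)} ->
  smooth_on [set p : R * 'rV[R]_d | (0 <= p.1 < tau) || (tau < p.1 < T)] u ->
  bochner_Lp T 1 (holder_space alpha) (holder_norm alpha) (slice u) ->
  Loo_spacetime T u ->
  (forall kappa, 0 < kappa ->
    weak_solution T kappa u theta0 (theta kappa) (grad_theta kappa)) ->
  (exists2 c : R, 0 < c & forall kappa, 0 < kappa ->
    (c%:E <= kappa%:E * \int[lebesgue_measure]_(s in `]0%R, tau[)
               (L2_vnorm (slice (grad_theta kappa) s) ^+ 2))%E) ->
  ~ (forall phi, kinetic_test_function T phi ->
      defect_distribution T kappa (theta kappa) (grad_theta kappa) phi
        @[kappa --> 0^'+] --> 0).
Proof.
move=> /andP[tau0 tauT] _ per0 smooth0 _ divu _ _ uL ws [c c0 dissipation] vanish.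
have cont0 := smooth_on_continuous smooth0.
have [M M0 th0M] := periodic_bounded per0 cont0.
have mth0 := measurable_continuous_rV cont0.
(* The cutoff descends from 1 to 0 between [tau] and this midpoint, so the test function vanishes
   before [T]. *)
pose b := (tau + T) / 2.
have taub : tau < b by exact: (midf_lt tauT).1.
have bT : b < T by exact: (midf_lt tauT).2.
(* The plateau is taken at level M + 1 so that its derivative is 1 on a neighbourhood of [-M, M],
   endpoints included. The choice does not depend on [kappa]. *)
pose phi := @kinetic_test R d (time_cutoff tau b) (plateau (M + 1)).
have phiP : kinetic_test_function T phi.
  apply: kinetic_test_functionP; [exact: Coo_time_cutoff|exact: Coo_plateau| |].
    by exists b => // t /ltW; exact: time_cutoff_ge.
  by exists (M + 1 + 1) => xi; exact: plateau_out.
have lower kappa : 0 < kappa ->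
    c <= defect_distribution T kappa (theta kappa) (grad_theta kappa) phi.
  move=> k0.
  have bound := max_principle (ltW k0) divu uL (ws _ k0) mth0 th0M.
  apply: (@defect_lower R d T tau M kappa u theta0 _ _ (time_cutoff tau b)) (dissipation _ k0) => //.
  - exact: ltW.
  - exact: ws.
  - exact: Coo_time_cutoff.
  - by move=> t; exact: step_ge0.
  - by move=> t; exact: step_le1.
  - by move=> t; exact: time_cutoff_le.
have /cvgr0Pnorm_lt /(_ _ c0) small := vanish phi phiP.
(* A single positive [kappa] for which the defect is below [c] in absolute value already contradicts
   the lower bound. *)
have [kappa [/= sk k0]] := @filter_ex _ (0^'+) _ _ (filterI small (nbhs_right_gt (0 : R))).
by have := le_lt_trans (lower kappa k0) (le_lt_trans (ler_norm _) sk); rewrite ltxx.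
Qed.
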